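(* Let $\delta_0\in(0,1/10]$. There exist $b_\star\ge1$ and $m_\star>2$ such that, setting $I_{b_\star}:=(-b_\star-1,-b_\star)\cup(b_\star,b_\star+1)$, the following holds. For every integer $m\ge m_\star$, every $\delta\in(0,1/10]$, and every family $(\psi_\varepsilon)_{\varepsilon\in(0,1)}\subset L^\infty(\mathbb R)$ with $\psi_\varepsilon=0$ a.e. in $\mathbb R\setminus I_{b_\star}$ and $\|\psi_\varepsilon\|_{L^\infty(I_{b_\star})}\to0$ as $\varepsilon\to0$, there exists $\varepsilon_0\in(0,1)$ such that, for every $\varepsilon\in(0,\varepsilon_0)$ and every $\xi=(\xi_1,\dots,\xi_m)\in I_{b_\star}^m$ satisfying $$\mathrm{dist}(\xi_j,\mathbb R\setminus I_{b_\star})\ge\delta_0\quad\text{and}\quad|\xi_j-\xi_i|\ge\delta\qquad\text{for all } i,j\in\{1,\dots,m\},\ i\ne j,$$ the function $u=\mathscr U+\psi_\varepsilon$, where $\mathscr U=\mathscr U_{\varepsilon,\xi}$ is the function defined in the context with parameters $\mu_j=\mu_j(\xi)$, is not a solution of $$(-\Delta)^{\frac12}u=\varepsilon e^u\ \text{ in } I_{b_\star},\qquad u>0\ \text{ in } I_{b_\star},\qquad u=0\ \text{ in }\mathbb R\setminus I_{b_\star}.$$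
   Context: $(-\Delta)^{\frac12}u(x)=\frac1\pi\,\mathrm{P.V.}\int_{\mathbb R}\frac{u(x)-u(x+z)}{z^2}\,dz$. Solutions of the problem are bounded functions $u\in H^{\frac12}(\mathbb R)$ satisfying the equation in the weak sense. Let $I=I_{b_\star}$ and $\Gamma(x)=-2\log|x|$. For $z\in I$, $H(\cdot,z)$ is the unique continuous function on $\mathbb R$ with $(-\Delta)^{\frac12}H(\cdot,z)=0$ in $I$ and $H(\cdot,z)=-\Gamma(\cdot-z)$ in $\mathbb R\setminus I$; and $G(x,z)=H(x,z)+\Gamma(x-z)$ for $x\ne z$ (so $G(\cdot,z)$ solves $(-\Delta)^{\frac12}G(\cdot,z)=2\pi\delta_z$ in $I$, $G(\cdot,z)=0$ in $\mathbb R\setminus I$). For $\xi=(\xi_1,\dots,\xi_m)\in I^m$ with distinct entries, $$\mu_j(\xi):=\tfrac12\exp\Big(H(\xi_j,\xi_j)+\sum_{i\ne j}G(\xi_j,\xi_i)\Big),\qquad j=1,\dots,m.$$ For $\varepsilon\in(0,1)$ let $u_j(x)=\log\frac{2\mu_j}{\mu_j^2\varepsilon^2+(x-\xi_j)^2}$ and let $H_j$ be the unique continuous function on $\mathbb R$ with $(-\Delta)^{\frac12}H_j=0$ in $I$ and $H_j=-u_j$ in $\mathbb R\setminus I$. Then $\mathscr U=\mathscr U_{\varepsilon,\xi}:=\sum_{j=1}^m(u_j+H_j)$. *)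

(* Defs.v *)
From HB Require Import structures.
From mathcomp Require Import all_boot all_order all_algebra.
From mathcomp Require Import all_classical all_reals all_analysis.
Import Order.TTheory GRing.Theory Num.Theory.
Import numFieldNormedType.Exports.

Set Implicit Arguments.
Unset Strict Implicit.
Unset Printing Implicit Defensive.

Local Open Scope classical_set_scope.
Local Open Scope ring_scope.

Notation Leb := lebesgue_measure.

(* I_b = (-b-1, -b) u (b, b+1) *)
Definition two_intervals (R : realType) (b : R) : set R :=
  `](- b - 1), (- b)[ `|` `]b, (b + 1)[.

Definition set_dist (R : realType) (x : R) (A : set R) : R :=
  inf [set `|x - y| | y in A].

(* [half_laplacian_at u x l]: the principal value defining (-Delta)^{1/2} u(x)
   exists and equals l.  It is a relation because the principal value need not
   exist; the integrability clause is needed because [Rintegral] is total. *)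
Definition half_laplacian_at (R : realType) (u : R -> R) (x l : R) : Prop :=
  (forall r : R, 0 < r ->
     Leb.-integrable [set z : R | r < `|z|]
       (fun z : R => ((u x - u (x + z)) / z ^+ 2)%:E)) /\
  pi^-1 * (\int[Leb]_(z in [set z : R | (r < `|z|)%R]) ((u x - u (x + z)) / z ^+ 2))
    @[r --> 0^'+] --> l.

(* For bounded open D this problem has at most one solution h, by the maximum
   principle; the definite descriptions "the unique continuous function such
   that" are rendered by quantifying over the functions satisfying it. *)
Definition half_dirichlet (R : realType) (D : set R) (g h : R -> R) : Prop :=
  [/\ continuous h,
      forall x, D x -> half_laplacian_at h x 0 &
      forall x, ~ D x -> h x = g x].

Definition Gam (R : realType) (x : R) : R := - 2 * ln `|x|.

(* H x z is the regular part of the Green function; the pole is z. *)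
Definition regular_part (R : realType) (D : set R) (H : R -> R -> R) : Prop :=
  forall z, D z -> half_dirichlet D (fun x => - Gam (x - z)) (fun x => H x z).

Definition green (R : realType) (H : R -> R -> R) (x z : R) : R :=
  H x z + Gam (x - z).

Definition mu_coef (R : realType) (H : R -> R -> R) (m : nat)
    (xi : 'I_m -> R) (j : 'I_m) : R :=
  2^-1 * expR (H (xi j) (xi j) + \sum_(i < m | i != j) green H (xi j) (xi i)).

Definition bubble (R : realType) (eps mu p x : R) : R :=
  ln (2 * mu / (mu ^+ 2 * eps ^+ 2 + (x - p) ^+ 2)).

(* Elements of Lebesgue and Sobolev spaces are represented by (Borel)
   functions R -> R, and pointwise conditions on them hold almost
   everywhere. *)
Definition H_half (R : realType) (u : R -> R) : Prop :=
  u \in Lfun (@Leb R) 2%:E /\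
  (\int[(Leb \x Leb)%E]_p (((u p.1 - u p.2) / (p.1 - p.2)) ^+ 2)%:E < +oo)%E.

(* <(-Delta)^{1/2} u, v> ; the factor 1/(2 pi) matches the constant 1/pi of
   the principal value. *)
Definition half_laplacian_form (R : realType) (u v : R -> R) : R :=
  (2 * pi)^-1 *
  \int[(Leb \x Leb)%E]_p ((u p.1 - u p.2) * (v p.1 - v p.2) / (p.1 - p.2) ^+ 2).

(* Bounded weak (energy) solution of (-Delta)^{1/2} u = eps e^u in D,
   u > 0 in D, u = 0 in R \ D. *)
Definition is_solution (R : realType) (D : set R) (eps : R) (u : R -> R) : Prop :=
  [/\ u \in Lfun (@Leb R) +oo%E,
      H_half u,
      forall v : R -> R, H_half v ->
        {ae Leb, forall x : R, ~ D x -> v x = 0} ->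
        half_laplacian_form u v = eps * \int[Leb]_(x in D) (expR (u x) * v x),
      {ae Leb, forall x : R, D x -> 0 < u x} &
      {ae Leb, forall x : R, ~ D x -> u x = 0}].

(* Main.v *)
(* With b = 2 the two components of I are unit intervals at distance 4 from each
   other.  The mass of every solution u is then bounded by an absolute constant.
   Indeed, let J be the component carrying the larger part of the mass and let
   T = id + tau P be the deformation of the line that moves J by the cubic P and
   fixes everything else.  Changing variables in the Gagliardo energy gives
   E(u o T) <= E(u) - tau (mass of u o T in J)^2 + (tau / 10) (cross term).
   Testing the equation with u o T - u and with a parabola supported in J, which
   dominates the loss of exponential mass caused by T, bounds the square of the
   mass by a multiple of the mass; the remaining quadratic error
   ||u o T - u||^2 is o(tau) along a sequence tau -> 0.

   On the other hand, the maximum principle shows that each bubble plus its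
   corrector is nonnegative, and at least 1/2 within distance delta0 / 4 of its
   centre when eps is small.  So the mass of the ansatz is at least
   m delta0 / 4 - 6, which exceeds the bound for large m. *)

Require Import Defs.
From HB Require Import structures.
From mathcomp Require Import all_boot all_order all_algebra.
From mathcomp Require Import all_classical all_reals all_analysis.
From mathcomp Require Import measurable_realfun ess_sup_inf.
From mathcomp Require Import ring lra.
Import Order.TTheory GRing.Theory Num.Theory.
Import numFieldNormedType.Exports.

Local Open Scope classical_set_scope.
Local Open Scope ring_scope.

Set Implicit Arguments.
Unset Strict Implicit.
Unset Printing Implicit Defensive.

(** The deformation replaces the Pohozaev identity, which is out of reach for a [u] that is only
    bounded and in H^{1/2}: energies are compared at a finite [tau] instead of being differentiated.
    Away from the two kinks of T, the perturbation T'(x)T'(y)/(Tx-Ty)^2 - (x-y)^{-2} has integral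
    zero in y for fixed x. Hence the squares in (w(x)-w(y))^2, where w = u o T, contribute nothing,
    and the energy difference becomes bilinear in w. To first order in [tau] the perturbation is tau
    (P'(x)+P'(y)-2(P(x)-P(y))/(x-y))/(x-y)^2. For P(s) = s/4 - s^3 this is the constant -tau on J x
    J, so that the square of the mass appears; the linear part makes P vanish at the ends of J.
    Between the components there is only an upper bound, and the distance 4 makes it as small as
    tau/40. On the side of the ansatz, the threshold for m must not depend on [delta]. The
    separation of the points therefore enters only through an upper bound of the mu_j, that is,
    through the threshold for eps. *)

(** * Change of variables along an increasing bijection of the line *)

Section density.
Local Open Scope ereal_scope.
Context d (T : measurableType d) (R : realType).
Variables (mu : {measure set T -> \bar R}) (g : T -> R).

(** The two proofs are arguments so that the measure instance declared below can be attached to the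
    term [density mg g0]. *)
Definition density (_ : measurable_fun [set: T] g) (_ : forall x, (0 <= g x)%R) :=
  fun A : set T => \int[mu]_(x in A) (g x)%:E.

Hypothesis mg : measurable_fun [set: T] g.
Hypothesis g0 : forall x, (0 <= g x)%R.

Local Notation nu := (density mg g0).

Let nu0 : nu set0 = 0. Proof. by rewrite /density integral_set0. Qed.

Let nu_ge0 A : 0 <= nu A.
Proof. by apply: integral_ge0 => x _; rewrite lee_fin. Qed.

Let nu_sigma_additive : semi_sigma_additive nu.
Proof.
move=> F mF tF mUF; rewrite /density ge0_integral_bigcup//; last 2 first.
- by apply/measurable_EFinP; exact: measurable_funTS.
- by move=> x _; rewrite lee_fin.
apply: is_cvg_ereal_nneg_natsum_cond => n _ _.
by apply: integral_ge0 => x _; rewrite lee_fin.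
Qed.

HB.instance Definition _ := isMeasure.Build _ _ _ nu nu0 nu_ge0 nu_sigma_additive.

Import HBNNSimple.

Lemma ge0_integral_density (f : T -> \bar R) : measurable_fun [set: T] f ->
  (forall x, 0 <= f x) -> \int[nu]_x f x = \int[mu]_x (f x * (g x)%:E).
Proof.
move=> mf f0; pose f_ := nnsfun_approx measurableT mf.
transitivity (limn (fun n => \int[nu]_x (f_ n x)%:E)).
  rewrite -monotone_convergence//=.
  - apply: eq_integral => y _; apply/esym/cvg_lim => //.
    exact: cvg_nnsfun_approx.
  - by move=> n; exact/measurable_EFinP/measurable_funP.
  - by move=> n y _; rewrite lee_fin.
  - by move=> y _ m n mn; rewrite lee_fin; exact/lefP/nd_nnsfun_approx.
transitivity (limn (fun n => \int[mu]_x ((f_ n x)%:E * (g x)%:E))); last first.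
  rewrite -monotone_convergence//=.
  - apply: eq_integral => y _; apply/cvg_lim => //.
    by apply: cvgeZr => //; exact: cvg_nnsfun_approx.
  - move=> n; apply: emeasurable_funM; last exact/measurable_EFinP.
    exact/measurable_EFinP/measurable_funP.
  - by move=> n y _; rewrite mule_ge0// lee_fin.
  - move=> y _ m n mn; rewrite lee_wpmul2r ?lee_fin//.
    exact/lefP/nd_nnsfun_approx.
congr (limn _); apply/funext => n.
have mpre r : measurable (f_ n @^-1` [set r]) by rewrite -[X in measurable X]setTI; exact: measurable_funP.
transitivity (\sum_(k \in range (f_ n)) \int[nu]_x (k * \1_(f_ n @^-1` [set k]) x)%:E).
  under eq_integral do rewrite fimfunE -fsumEFin//.
  rewrite ge0_integral_fsum//.
  - by move=> y; exact/measurable_EFinP/measurable_funM.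
  - by move=> y x _; rewrite nnfun_muleindic_ge0.
transitivity (\sum_(k \in range (f_ n))
    \int[mu]_x ((k * \1_(f_ n @^-1` [set k]) x)%:E * (g x)%:E)); last first.
  rewrite -ge0_integral_fsum//.
  - apply: eq_integral => x _; rewrite [in RHS](fimfunE (f_ n)) -fsumEFin//.
    by rewrite ge0_mule_fsuml// => y; rewrite nnfun_muleindic_ge0.
  - move=> y; apply: emeasurable_funM; last exact/measurable_EFinP.
    exact/measurable_EFinP/measurable_funM.
  - by move=> y x _; rewrite mule_ge0 ?nnfun_muleindic_ge0// lee_fin.
apply: eq_fsbigr => r _.
rewrite integralZl_indic_nnsfun// integral_indic// setIT.
have [r0|r0] := ltP r 0%R.
  rewrite preimage_nnfun0// measure0 mule0 integral0_eq// => x _.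
  by rewrite indic0 mulr0 mul0e.
under [RHS]eq_integral do rewrite EFinM -muleA.
rewrite ge0_integralZl//; last 2 first.
- by apply: emeasurable_funM; [exact/measurable_EFinP|exact/measurable_EFinP].
- by move=> x _; rewrite mule_ge0// lee_fin.
congr (_ * _); rewrite /density [LHS]integral_mkcond; apply: eq_integral => x _.
by rewrite patchE indicE; case: ifPn => _; rewrite ?mul1e ?mul0e.
Qed.

End density.

Section change_of_variables.
Local Open Scope ereal_scope.
Context (R : realType).
Local Notation mu := (@lebesgue_measure R).

(** The measure with density [F'], pushed forward by [F], agrees with Lebesgue measure on half-open
    intervals, hence on all measurable sets. [F'] is tied to [F] only by an integral identity, which
    admits the jumps of [deform']. *)
Lemma ge0_change_of_variables (F F' : R -> R) (f : R -> \bar R) :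
  {mono F : x y / (x <= y)%R} -> (forall y, exists x, F x = y) ->
  measurable_fun [set: R] F' -> (forall x, 0 <= F' x)%R ->
  (forall a b, (a <= b)%R ->
    \int[mu]_(x in `]a, b]%classic) (F' x)%:E = (F b - F a)%:E) ->
  measurable_fun [set: R] f -> (forall x, 0 <= f x) ->
  \int[mu]_x (f (F x) * (F' x)%:E) = \int[mu]_x f x.
Proof.
move=> Fmono Fsurj mF' F'0 FTC mf f0.
have mF : measurable_fun [set: R] (F : R -> measurableTypeR R).
  by apply: nondecreasing_measurable => // x y; rewrite Fmono.
transitivity (\int[pushforward (density mu mF' F'0) (F : R -> measurableTypeR R)]_x f x).
  by rewrite ge0_integral_pushforward//= ge0_integral_density//; exact: measurableT_comp.
apply: eq_measure_integral => //= A mA _.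
apply/esym/lebesgue_measure_unique => //= _ [[a b]] /= ab <-.
rewrite /pushforward/= /density lebesgue_measure_itv/= lte_fin.
have [[a' Fa'] [b' Fb']] := (Fsurj a, Fsurj b).
have Flt x y : (F x < F y)%R = (x < y)%R by rewrite !ltNge Fmono.
have -> : F @^-1` `]a, b] = `]a', b']%classic.
  by apply/seteqP; split => x /=; rewrite !in_itv/= -Fa' -Fb' Flt Fmono.
rewrite -Fa' -Fb' Flt; case: ltP => [a'b'|b'a']; last first.
  by rewrite set_itv_ge ?integral_set0// bnd_simp -leNgt.
by rewrite FTC ?ltW.
Qed.

End change_of_variables.

(** * Measurability of the inverse and explicit integrals on the line *)

Section real_line.
Context (R : realType).
Local Notation mu := (@lebesgue_measure R).

Lemma measurable_inv : measurable_fun [set: R] (@GRing.inv R).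
Proof.
(* The inverse is expressed through a real power, whose measurability is known; at 0 the factor [x]
   restores the default value 0. *)
rewrite (_ : @GRing.inv R = fun x => x * (x ^+ 2) `^ (-1)); last first.
  apply/funext => x; rewrite powR_inv1 ?sqr_ge0//.
  have [->|x0] := eqVneq x 0; first by rewrite invr0 mul0r.
  by rewrite expr2 invfM mulrA divff// mul1r.
have mp : measurable_fun [set: R] (fun x : R => (x ^+ 2) `^ (-1)).
  apply: (measurableT_comp (f := fun y : R => y `^ (-1)) (g := fun x : R => x ^+ 2)).
    exact: measurable_powR.
  exact: measurable_funX.
exact: measurable_funM.
Qed.

Lemma measurable_funV d (T : measurableType d) (D : set T) (f : T -> R) :
  measurable_fun D f -> measurable_fun D (fun x => (f x)^-1).
Proof. by move=> mf; apply: measurableT_comp => //; exact: measurable_inv. Qed.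

Lemma ge0_integral_opp (f : R -> \bar R) : measurable_fun [set: R] f ->
  (forall x, 0 <= f x)%E ->
  (\int[mu]_x f (- x)%R = \int[mu]_x f x)%E.
Proof.
move=> mf f0.
transitivity (\int[pushforward mu (-%R : R -> measurableTypeR R)]_x f x)%E.
  by rewrite ge0_integral_pushforward.
apply: eq_measure_integral => //= A mA _; exact: lebesgue_measureN.
Qed.

Lemma ge0_integral_affine (a c : R) (f : R -> \bar R) : 0 < a ->
  measurable_fun [set: R] f -> (forall x, 0 <= f x)%E ->
  (\int[mu]_x (f (a * x + c)%R * a%:E) = \int[mu]_x f x)%E.
Proof.
move=> a0 mf f0.
apply: (@ge0_change_of_variables _ (fun x => a * x + c) (cst a)) => //.
- by move=> x y; rewrite lerD2r ler_pM2l.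
- by move=> y; exists (a^-1 * (y - c)); rewrite mulrA divff ?gt_eqF// mul1r subrK.
- by move=> x; exact: ltW.
- move=> x y xy; rewrite [LHS](integral_cst mu _ a%:E)//= lebesgue_measure_itv/= lte_fin.
  case: ltP => [_|yx]; first by rewrite -EFinB -EFinM; congr EFin; ring.
  by rewrite mule0 (le_anti (_ : x <= y <= x)) ?xy// subrr.
Qed.

Lemma ge0_integral_shift (c : R) (f : R -> \bar R) :
  measurable_fun [set: R] f -> (forall x, 0 <= f x)%E ->
  (\int[mu]_x f (x + c)%R = \int[mu]_x f x)%E.
Proof.
move=> mf f0; rewrite -(@ge0_integral_affine 1 c f)//.
by apply: eq_integral => x _; rewrite mul1r mule1.
Qed.

Lemma integral_invsqr_gt (a c : R) : a < c ->
  (\int[mu]_(x in `]c, +oo[) ((x - a) ^- 2)%:E = ((c - a)^-1)%:E)%E.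
Proof.
move=> ac; rewrite integral_itv_obnd_cbnd//; last first.
  apply/measurable_EFinP; apply: measurable_funTS; apply: measurable_funV.
  by apply: measurable_funX; exact: measurable_funD.
have d1 t : c < t -> is_derive t (1 : R) (fun z : R => - (z - a)^-1) ((t - a) ^- 2).
  move=> cx; have xa : t - a != 0 by rewrite subr_eq0 gt_eqF// (lt_trans ac).
  apply: is_derive_eq.
  by rewrite subr0 /GRing.scale/= mulr1 opprK.
have cF t : a < t -> {for t, continuous (fun z : R => - (z - a)^-1)}.
  move=> at_; apply: (@cvgN _ R^o); apply: (@cvgV _ R^o).
    by rewrite subr_eq0 gt_eqF.
  by apply: (@cvgB _ R^o) => //; exact: cvg_cst.
rewrite (@ge0_continuous_FTC2y _ _ (fun z : R => - (z - a)^-1) c 0).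
- by rewrite sub0e EFinN oppeK.
- by move=> x _; rewrite invr_ge0 sqr_ge0.
- apply/continuous_within_itvcyP; split.
    move=> x; rewrite in_itv/= andbT => cx.
    apply: (@cvgV _ R^o); first by rewrite expf_neq0// subr_eq0 gt_eqF// (lt_trans ac).
    apply: (continuous_comp (f := fun x => x - a) (g := fun x => x ^+ 2)).
      by apply: (@cvgB _ R^o) => //; exact: cvg_cst.
    exact: sqr_continuous.
  apply: cvg_at_right_filter.
  apply: (@cvgV _ R^o); first by rewrite expf_neq0// subr_eq0 gt_eqF.
  apply: (continuous_comp (f := fun x => x - a) (g := fun x => x ^+ 2)).
    by apply: (@cvgB _ R^o) => //; exact: cvg_cst.
  exact: sqr_continuous.
- rewrite -oppr0; apply: (@cvgN _ R^o).
  apply/gtr0_cvgV0; first by near=> x; rewrite subr_gt0; near: x; apply: nbhs_pinfty_gt; exact: num_real.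
  exact: cvg_addrr.
- by move=> x cx; have [] := d1 _ cx.
- by apply: cvg_at_right_filter; exact: cF.
- move=> x; rewrite in_itv/= andbT => cx; rewrite derive1E.
  by have [_ ->] := d1 _ cx.
Unshelve. all: by end_near. Qed.

Lemma integral_invsqr_lt (a c : R) : c < a ->
  (\int[mu]_(x in `]-oo, c[) ((x - a) ^- 2)%:E = ((a - c)^-1)%:E)%E.
Proof.
move=> ca.
rewrite integral_mkcond -ge0_integral_opp; last 2 first.
- apply/(measurable_restrictT _ _).1 => //; apply/measurable_EFinP.
  apply: measurable_funTS; apply: measurable_funV.
  by apply: measurable_funX; exact: measurable_funD.
- by apply: erestrict_ge0 => x _; rewrite lee_fin invr_ge0 sqr_ge0.
have -> : ((a - c)^-1)%:E = ((- c - - a)^-1)%:E :> \bar R by congr (_^-1)%:E; ring.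
rewrite -integral_invsqr_gt ?ltrN2// [RHS]integral_mkcond.
apply: eq_integral => x _; rewrite !patchE !mem_setE !in_itv/= andbT ltrNl.
by case: ifP => // _; congr (_^-1)%:E; ring.
Qed.

Lemma measurable_gt_norm (r : R) : measurable [set z : R | r < `|z|].
Proof.
rewrite -[X in measurable X]setTI; exact: measurable_fun_ltr.
Qed.

Lemma integral_invsqr_norm (r : R) : 0 < r ->
  (\int[mu]_(z in [set z : R | (r < `|z|)%R]) (z ^- 2)%:E = (2 / r)%:E)%E.
Proof.
move=> r0.
have -> : [set z : R | r < `|z|] = `]-oo, (- r)[ `|` `]r, +oo[.
  by apply/seteqP; split => z /=; rewrite !in_itv/= andbT ltrNr; rewrite lter_normr orbC => /orP.
rewrite ge0_integral_setU//=; last 3 first.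
- apply/measurable_EFinP; apply: measurable_funTS; apply: measurable_funV.
  exact: measurable_funX.
- by move=> x _; rewrite lee_fin invr_ge0 sqr_ge0.
- apply/disj_setPS => z []/=; rewrite !in_itv/= andbT => z1 z2.
  have := lt_trans z2 z1; lra.
have e1 := @integral_invsqr_gt 0 r r0.
have e2 := @integral_invsqr_lt 0 (- r) (ltac:(lra)).
under eq_integral do rewrite -[X in X ^+ 2]subr0.
rewrite e2; under eq_integral do rewrite -[X in X ^+ 2]subr0.
by rewrite e1 -EFinD; congr EFin; rewrite subr0 sub0r opprK; field; rewrite gt_eqF.
Qed.

End real_line.

(** * The deformation of the line and its derivative *)

Section deformation.
Context (R : realType).
Local Notation mu := (@lebesgue_measure R).
Variables (tau c : R).

Definition clamp (x : R) : R := Num.max (c - 2^-1) (Num.min x (c + 2^-1)).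

(* The cubic vanishes at [-1/2] and [1/2], so [deform] below fixes every point
   outside [[c - 1/2, c + 1/2]]. *)
Definition cubic (s : R) : R := s / 4 - s ^+ 3.

Definition cutoff_cubic x : R := cubic (clamp x - c).

Definition deform x : R := x + tau * cutoff_cubic x.

(** The derivative of [deform] away from the two kinks. The interval is half-open to match the
    half-open intervals of [integral_deform'], so that cutting at a kink produces no exceptional
    point. *)
Definition deform' x : R :=
  1 + tau * (if c - 2^-1 < x <= c + 2^-1 then 4^-1 - 3 * (x - c) ^+ 2 else 0).

Local Notation l := (c - 2^-1).
Local Notation r := (c + 2^-1).

Lemma clamp_itv x : l <= clamp x <= r.
Proof.
rewrite /clamp le_max lexx/= ge_max ge_min lexx orbT andbT; lra.
Qed.

Lemma clamp_id x : l <= x <= r -> clamp x = x.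
Proof. by rewrite /clamp => /andP[lx xr]; rewrite min_l// max_r. Qed.

Lemma clamp_le x : x <= l -> clamp x = l.
Proof.
move=> xl; rewrite /clamp min_l ?max_l//.
by rewrite (le_trans xl)//; lra.
Qed.

Lemma clamp_ge x : r <= x -> clamp x = r.
Proof. by move=> rx; rewrite /clamp min_r// max_r//; lra. Qed.

Lemma clamp_lip x y : x <= y -> 0 <= clamp y - clamp x <= y - x.
Proof.
move=> xy; have lr : l <= r by lra.
have [xl|lx] := leP x l; have [yl|ly] := leP y l.
- by rewrite !clamp_le// subrr lexx/= subr_ge0.
- rewrite (clamp_le xl); have [yr|ry] := leP y r.
    by rewrite clamp_id; lra.
  by rewrite clamp_ge; lra.
- lra.
have [yr|ry] := leP y r.
  by rewrite (clamp_id (x := x)) ?(clamp_id (x := y)); lra.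
rewrite (clamp_ge (ltW ry)); have [xr|rx] := leP x r.
  by rewrite clamp_id; lra.
by rewrite clamp_ge; lra.
Qed.

Lemma cubic_lip s t : `|s| <= 2^-1 -> `|t| <= 2^-1 ->
  `|cubic t - cubic s| <= `|t - s| / 2.
Proof.
move=> s2 t2; rewrite /cubic.
have -> : t / 4 - t ^+ 3 - (s / 4 - s ^+ 3) =
  (t - s) * (4^-1 - (t ^+ 2 + t * s + s ^+ 2)) by field.
rewrite normrM ler_wpM2l//; move: s2 t2; rewrite !ler_norml => ? ?.
apply/andP; split; nra.
Qed.

Lemma cubic_bound s : `|s| <= 2^-1 -> `|cubic s| <= 8^-1.
Proof.
move=> s2; have -> : cubic s = s * (4^-1 - s ^+ 2) by rewrite /cubic; field.
rewrite normrM (_ : 8^-1 = 2^-1 * 4^-1); last by field.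
by apply: ler_pM => //; move: s2; rewrite !ler_norml => ?; nra.
Qed.

Lemma cutoff_cubic_lip x y : x <= y -> `|cutoff_cubic y - cutoff_cubic x| <= (y - x) / 2.
Proof.
move=> xy; rewrite /cutoff_cubic.
have := clamp_lip xy; have := clamp_itv x; have := clamp_itv y => hy hx hxy.
apply: le_trans (cubic_lip _ _) _.
- by rewrite ler_norml; lra.
- by rewrite ler_norml; lra.
- by rewrite ger0_norm; lra.
Qed.

Lemma cutoff_cubic_bound x : `|cutoff_cubic x| <= 8^-1.
Proof.
by apply: cubic_bound; have := clamp_itv x; rewrite ler_norml; lra.
Qed.

Lemma cutoff_cubic_out x : ~ `]l, r[%classic x -> cutoff_cubic x = 0.
Proof.
rewrite /cutoff_cubic /= in_itv/= => h; have [xl|lx] := leP x l.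
  by rewrite clamp_le// /cubic; field.
have [rx|xr] := leP r x; first by rewrite clamp_ge// /cubic; field.
by exfalso; apply: h; rewrite lx xr.
Qed.

Lemma cutoff_cubic_in x : l <= x <= r -> cutoff_cubic x = cubic (x - c).
Proof. by move=> /clamp_id; rewrite /cutoff_cubic => ->. Qed.

Lemma continuous_cutoff_cubic : continuous cutoff_cubic.
Proof.
move=> x; rewrite /cutoff_cubic /cubic.
have cc : {for x, continuous clamp}.
  by apply: continuous_max; [exact: cvg_cst|apply: continuous_min; [exact: cvg_id|exact: cvg_cst]].
have cs : {for x, continuous (fun y => clamp y - c)}.
  by apply: (@cvgB _ R^o) => //; exact: cvg_cst.
apply: (@cvgB _ R^o); first by apply: cvgM => //; exact: cvg_cst.
exact: (continuous_comp (f := fun y => clamp y - c) (g := fun y => y ^+ 3) cs (@exprn_continuous _ 3 _)).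
Qed.

Lemma continuous_deform : continuous deform.
Proof.
move=> x; apply: (@cvgD _ R^o); first exact: cvg_id.
by apply: cvgM; [exact: cvg_cst|exact: continuous_cutoff_cubic].
Qed.

Lemma measurable_deform' : measurable_fun [set: R] deform'.
Proof.
apply: measurable_funD => //; apply: measurable_funM => //.
rewrite (_ : (fun x => _) = (fun x => 4^-1 - 3 * (x - c) ^+ 2) \_ (`]l, r]%classic)); last first.
  by apply/funext => x; rewrite patchE mem_setE in_itv.
apply/(measurable_restrictT _ _).1 => //; apply: measurable_funTS.
apply: measurable_funB => //; apply: measurable_funM => //.
by apply: measurable_funX; exact: measurable_funB.
Qed.

Hypothesis tau01 : 0 < tau <= 4^-1.

Lemma deform'_ge x : 1 - tau / 2 <= deform' x.
Proof.
have [t0 t1] := andP tau01.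
rewrite /deform'; case: ifP => [/andP[lx xr]|_]; last by lra.
have : 0 <= (x - c) ^+ 2 <= 4^-1 by rewrite sqr_ge0/=; nra.
move: ((x - c) ^+ 2) => s /andP[s0 s4]; nra.
Qed.

Lemma deform'_le x : deform' x <= 1 + tau / 4.
Proof.
have [t0 t1] := andP tau01.
rewrite /deform'; case: ifP => [/andP[lx xr]|_]; last by lra.
have : 0 <= (x - c) ^+ 2 <= 4^-1 by rewrite sqr_ge0/=; nra.
move: ((x - c) ^+ 2) => s /andP[s0 s4]; nra.
Qed.

Lemma deform_sub x y : x <= y ->
  (1 - tau / 2) * (y - x) <= deform y - deform x <= (1 + tau / 2) * (y - x).
Proof.
have [t0 t1] := andP tau01.
move=> /cutoff_cubic_lip; rewrite ler_norml /deform => /andP[h1 h2]; apply/andP; split; nra.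
Qed.

Lemma deform_mono : {mono deform : x y / x <= y}.
Proof.
have [t0 t1] := andP tau01.
apply: le_mono => x y xy; have /andP[h _] := deform_sub (ltW xy).
have : 0 < (1 - tau / 2) * (y - x) by rewrite mulr_gt0//; lra.
by lra.
Qed.

Lemma deform_out x : ~ `]l, r[%classic x -> deform x = x.
Proof. by move=> /cutoff_cubic_out; rewrite /deform => ->; rewrite mulr0 addr0. Qed.

Lemma deform_in x : `]l, r[%classic x -> `]l, r[%classic (deform x).
Proof.
rewrite /= !in_itv/= => /andP[lx xr].
have lt_mono := leW_mono deform_mono.
have el : deform l = l by apply: deform_out; rewrite /= in_itv/= ltxx.
have er : deform r = r by apply: deform_out; rewrite /= in_itv/= ltxx andbF.
by apply/andP; split; [rewrite -el|rewrite -er]; rewrite lt_mono.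
Qed.

Lemma deform_surj y : exists x, deform x = y.
Proof.
have h x : `|tau * cutoff_cubic x| <= 1.
  by have [t0 t1] := andP tau01; have := cutoff_cubic_bound x; rewrite !ler_norml => /andP[h1 h2]; apply/andP; split; nra.
have := h (y - 1); have := h (y + 1); rewrite !ler_norml => h1 h2.
have [|||x _ <-] := @IVT _ deform (y - 1) (y + 1) y.
- lra.
- by apply: continuous_subspaceT; exact: continuous_deform.
- rewrite ge_min le_max; apply/andP; split; apply/orP; [left|right]; rewrite /deform; lra.
by exists x.
Qed.

(** The identity is additive over adjacent intervals. Cutting []a, b]] at the two kinks leaves
    pieces on which [deform] is either the identity or a polynomial. *)
Lemma integral_deform' a b : a <= b ->
  (\int[mu]_(x in `]a, b]%classic) (deform' x)%:E = (deform b - deform a)%:E)%E.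
Proof.
pose C a b := (\int[mu]_(x in `]a, b]%classic) (deform' x)%:E = (deform b - deform a)%:E)%E.
have ge0 x : 0 <= deform' x by have [t0 t1] := andP tau01; have := deform'_ge x; lra.
have Cadd x y z : x <= y -> y <= z -> C x y -> C y z -> C x z.
  move=> xy yz Cxy Cyz; rewrite /C.
  have -> : `]x, z]%classic = `]x, y]%classic `|` `]y, z]%classic.
    by rewrite -itv_bndbnd_setU// bnd_simp.
  rewrite ge0_integral_setU//=.
  - by rewrite Cxy Cyz -EFinD; congr EFin; ring.
  - by apply/measurable_EFinP; apply: measurable_funTS; exact: measurable_deform'.
  - by move=> t _; rewrite lee_fin.
  - apply/disj_setPS => t []/=; rewrite !in_itv/= => /andP[_ t1] /andP[t2 _].
    by have := le_lt_trans t1 t2; rewrite ltxx.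
have C0 x : C x x by rewrite /C set_itvoc0 integral_set0 subrr.
have C1 x y : x <= y -> (y <= l) || (r <= x) -> C x y.
  move=> xy h; rewrite /C.
  rewrite (eq_integral (cst 1%E)); last first.
    move=> t; rewrite inE/= in_itv/= => /andP[xt ty]; rewrite /deform'.
    have -> : (l < t <= r) = false.
      case/orP: h => h; apply/negbTE; rewrite negb_and -!ltNge -leNgt; apply/orP; [left|right].
        exact: le_trans ty h.
      exact: le_lt_trans h xt.
    by rewrite mulr0 addr0.
  rewrite integral_cst//= lebesgue_measure_itv/= lte_fin.
  have o t : (t <= l) || (r <= t) -> deform t = t.
    move=> ht; apply: deform_out; rewrite /= in_itv/= => /andP[h1 h2].
    by case/orP: ht => ht; [have := lt_le_trans h1 ht|have := le_lt_trans ht h2]; rewrite ltxx.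
  rewrite !o; last 2 first.
  - by case/orP: h => h; rewrite ?(le_trans xy h) ?h ?orbT.
  - by case/orP: h => h; rewrite ?(le_trans h xy) ?h ?orbT.
  case: ltP => [_|yx]; first by rewrite mul1e -EFinB.
  by rewrite mule0 (le_anti (_ : x <= y <= x)) ?xy// subrr.
have C2 x y : x <= y -> l <= x -> y <= r -> C x y.
  rewrite le_eqVlt => /predU1P[-> _ _|xy lx yr]; first exact: C0.
  rewrite /C.
  pose g t := 1 + tau * (4^-1 - 3 * (t - c) ^+ 2).
  pose G t := t + tau * cubic (t - c).
  rewrite (eq_integral (fun t : measurableTypeR R => (g t)%:E)); last first.
    move=> t; rewrite inE/= in_itv/= => /andP[xt ty]; rewrite /deform'.
    by rewrite (le_lt_trans lx xt) (le_trans ty yr).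
  have dG t : is_derive t (1 : R) G (g t).
    rewrite /G /g /cubic; apply: is_derive_eq.
    by rewrite /GRing.scale/=; field.
  have cg : continuous g.
    move=> t; apply: (@cvgD _ R^o); first exact: cvg_cst.
    apply: cvgM; first exact: cvg_cst.
    apply: (@cvgB _ R^o); first exact: cvg_cst.
    apply: cvgM; first exact: cvg_cst.
    apply: (continuous_comp (f := fun y => y - c) (g := fun y => y ^+ 2)).
      by apply: (@cvgB _ R^o); [exact: cvg_id|exact: cvg_cst].
    exact: exprn_continuous.
  rewrite integral_itv_obnd_cbnd; last first.
    by apply/measurable_EFinP; apply: measurable_funTS; exact: continuous_measurable_fun.
  rewrite (@continuous_FTC2 _ g G)//.
  - rewrite -EFinB; congr EFin; rewrite /deform !cutoff_cubic_in//.
      by rewrite lx (le_trans (ltW xy) yr).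
    by rewrite yr (le_trans lx (ltW xy)).
  - by apply: continuous_subspaceT.
  - have cG : continuous G by move=> t; apply: differentiable_continuous; apply/derivable1_diffP; have [] := dG t.
    split.
    + by move=> t _; have [] := dG t.
    + by apply: cvg_at_right_filter; exact: cG.
    + by apply: cvg_at_left_filter; exact: cG.
  - by move=> t _; rewrite derive1E; have [_ ->] := dG t.
have lr : l <= r by lra.
move=> ab; have [bl|lb] := leP b l; first by apply: C1 => //; rewrite bl.
have [ra|ar] := leP r a; first by apply: C1 => //; rewrite ra orbT.
have h1 : a <= Num.max a l by rewrite le_max lexx.
have h2 : Num.max a l <= Num.min b r by rewrite le_min !ge_max ab ltW//= (ltW ar).
have h3 : Num.min b r <= b by rewrite ge_min lexx.
apply: (@Cadd _ (Num.max a l)) => //; first exact: le_trans h3.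
  have [al|la] := leP a l; first by apply: C1 => //; rewrite lexx.
  exact: C0.
apply: (@Cadd _ (Num.min b r)) => //.
  by apply: C2 => //; [rewrite le_max lexx orbT|rewrite ge_min lexx orbT].
have [br|rb] := leP b r; first exact: C0.
by apply: C1; rewrite ?lexx ?orbT// ltW.
Qed.


End deformation.

(** * Integrability criteria *)

Section integrable_tools.
Context d (T : measurableType d) (R : realType) (mu : {measure set T -> \bar R}).

Lemma integrable_dominated (D : set T) (f g : T -> R) : measurable D ->
  measurable_fun D f -> mu.-integrable D (EFin \o g) ->
  (forall x, D x -> `|f x| <= g x) -> mu.-integrable D (EFin \o f).
Proof.
move=> mD mf ig fg; apply: le_integrable ig => //; first exact/measurable_EFinP.
by move=> x Dx /=; rewrite lee_fin (le_trans (fg _ Dx))// ler_norm.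
Qed.

Lemma ge0_integrable (D : set T) (f : T -> R) : measurable D ->
  measurable_fun D f -> (forall x, D x -> 0 <= f x) ->
  (\int[mu]_(x in D) (f x)%:E < +oo)%E -> mu.-integrable D (EFin \o f).
Proof.
move=> mD mf f0 foo.
have mEf : measurable_fun D (EFin \o f) by exact/measurable_EFinP.
apply/integrableP; split => //; apply: le_lt_trans foo.
rewrite le_eqVlt; apply/orP; left; apply/eqP; apply: eq_integral => x.
by rewrite inE => Dx /=; rewrite ger0_norm// f0.
Qed.

Lemma integrable_ext (D : set T) (f g : T -> R) : measurable D ->
  (forall x, D x -> f x = g x) -> mu.-integrable D (EFin \o f) ->
  mu.-integrable D (EFin \o g).
Proof.
by move=> mD fg; apply: eq_integrable => // x; rewrite inE => /fg /= ->.
Qed.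

Lemma integrable_sub (D : set T) (f g : T -> R) : measurable D ->
  mu.-integrable D (EFin \o f) -> mu.-integrable D (EFin \o g) ->
  mu.-integrable D (EFin \o (fun x => f x - g x)).
Proof. by move=> mD fi gi; apply: eq_integrable (integrableB mD fi gi). Qed.

Lemma integrable_add (D : set T) (f g : T -> R) : measurable D ->
  mu.-integrable D (EFin \o f) -> mu.-integrable D (EFin \o g) ->
  mu.-integrable D (EFin \o (fun x => f x + g x)).
Proof. by move=> mD fi gi; apply: eq_integrable (integrableD mD fi gi). Qed.

Lemma integrable_scale (D : set T) (k : R) (f : T -> R) : measurable D ->
  mu.-integrable D (EFin \o f) -> mu.-integrable D (EFin \o (fun x => k * f x)).
Proof. by move=> mD fi; apply: eq_integrable (integrableZl mD k fi). Qed.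

Lemma ge0_RintegralE (D : set T) (f : T -> R) (r : R) :
  (\int[mu]_(x in D) (f x)%:E = r%:E)%E -> \int[mu]_(x in D) f x = r.
Proof. by rewrite /Rintegral => ->. Qed.

End integrable_tools.

(** * The Gagliardo kernel after the substitution *)

Section kernel.
Context (R : realType).
Local Notation mu := (@lebesgue_measure R).
Variables (tau c : R).
Hypothesis tau01 : 0 < tau <= 4^-1.

Local Notation deform := (deform tau c).
Local Notation deform' := (deform' tau c).
Local Notation l := (c - 2^-1).
Local Notation r := (c + 2^-1).

Lemma ge0_integral_deform (f : R -> \bar R) :
  measurable_fun [set: R] f -> (forall x, 0 <= f x)%E ->
  (\int[mu]_x (f (deform x) * (deform' x)%:E) = \int[mu]_x f x)%E.
Proof.
apply: ge0_change_of_variables.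
- exact: deform_mono.
- exact: deform_surj.
- exact: measurable_deform'.
- by move=> x; have [t0 t1] := andP tau01; have := deform'_ge c tau01 x; lra.
- exact: integral_deform'.
Qed.

(* Substituting [deform] for both variables turns the energy of [u] into the
   integral of [(w x - w y) ^+ 2 * kerS x y], where [w = u \o deform]. *)
Definition kerS (x y : R) : R := deform' x * deform' y / (deform x - deform y) ^+ 2.

(* The last term only changes [kerR] on the diagonal, where [kerS x x] and
   [(x - x) ^- 2] are both the junk value 0; it makes the bound of [kerR_in]
   hold there as well. *)
Definition kerR (x y : R) : R :=
  kerS x y - (x - y) ^- 2 - (if x == y then tau / 2 else 0).

Lemma kerRC x y : kerR x y = kerR y x.
Proof.
rewrite /kerR /kerS (mulrC (deform' x)).
by rewrite -(sqrrN (deform x - deform y)) -(sqrrN (x - y)) !opprB eq_sym.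
Qed.

Lemma deform'_gt0 x : 0 < deform' x.
Proof. by have [t0 t1] := andP tau01; have := deform'_ge c tau01 x; lra. Qed.

Lemma kerS_ge0 x y : 0 <= kerS x y.
Proof. by rewrite divr_ge0 ?sqr_ge0// mulr_ge0// ltW// deform'_gt0. Qed.

Lemma measurable_deform : measurable_fun [set: R] deform.
Proof. by apply: continuous_measurable_fun; exact: continuous_deform. Qed.

Lemma measurable_kerS : measurable_fun [set: R * R] (fun p => kerS p.1 p.2).
Proof.
apply: measurable_funM.
  apply: measurable_funM.
    by apply: (measurableT_comp (measurable_deform' _ _)).
  by apply: (measurableT_comp (measurable_deform' _ _)).
apply: measurable_funV; apply: measurable_funX; apply: measurable_funB.
  by apply: (measurableT_comp measurable_deform).
by apply: (measurableT_comp measurable_deform).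
Qed.

Lemma measurable_inv_sqr_sub : measurable_fun [set: R * R] (fun p => (p.1 - p.2) ^- 2).
Proof. by apply: measurable_funV; apply: measurable_funX; exact: measurable_funB. Qed.

Lemma measurable_kerR : measurable_fun [set: R * R] (fun p => kerR p.1 p.2).
Proof.
apply: measurable_funB.
  by apply: measurable_funB; [exact: measurable_kerS|exact: measurable_inv_sqr_sub].
by apply: measurable_fun_ifT => //; exact: measurable_fun_eqr.
Qed.

Lemma deform_lt x y : (deform x < deform y) = (x < y).
Proof. exact: (leW_mono (deform_mono c tau01)). Qed.

(** Since [deform] is increasing, z = [deform y] maps the set rho < |y - x| onto the two half-lines
    beyond [deform (x - rho)] and [deform (x + rho)], where the integrand becomes a multiple of the
    elementary kernel (z - [deform x])^{-2}. *)
Lemma kerS_tail (x rho : R) : 0 < rho ->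
  (\int[mu]_(y in [set y | (rho < `|y - x|)%R]) (kerS x y)%:E =
   (deform' x * ((deform (x + rho) - deform x)^-1 +
                 (deform x - deform (x - rho))^-1))%:E)%E.
Proof.
move=> rho0.
pose A := `]-oo, deform (x - rho)[%classic `|` `]deform (x + rho), +oo[%classic.
pose f (z : R) := (((z - deform x) ^- 2)%:E * (deform' x)%:E)%E.
have mg : measurable_fun [set: R] (fun z : R => (z - deform x) ^- 2).
  by apply: measurable_funV; apply: measurable_funX; exact: measurable_funB.
have mA : measurable A by exact: measurableU.
have mf : measurable_fun [set: R] f.
  by apply: emeasurable_funM => //; exact/measurable_EFinP.
have f0 z : (0 <= f z)%E.
  by rewrite mule_ge0// lee_fin ?invr_ge0 ?sqr_ge0// ltW// deform'_gt0.
rewrite integral_mkcond.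
transitivity (\int[mu]_y ((f \_ A) (deform y) * (deform' y)%:E))%E.
  apply: eq_integral => y _; rewrite !patchE.
  have -> : (deform y \in A) = (y \in [set y | rho < `|y - x|]).
    apply/idP/idP; rewrite !inE /A/= !in_itv/= andbT !deform_lt ltr_normr.
      by case=> h; apply/orP; [right|left]; lra.
    by case/orP => h; [right|left]; lra.
  case: ifP => _; last by rewrite mul0e.
  rewrite /f -!EFinM /kerS; congr EFin.
  by rewrite -(sqrrN (deform x - _)) opprB; ring.
rewrite ge0_integral_deform; last 2 first.
- by apply/(measurable_restrictT _ _).1 => //; exact: measurable_funTS.
- by apply: erestrict_ge0.
rewrite -integral_mkcond ge0_integralZr//; last 3 first.
- by apply/measurable_EFinP; exact: measurable_funTS.
- by move=> z _; rewrite lee_fin invr_ge0 sqr_ge0.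
- by rewrite lee_fin ltW// deform'_gt0.
rewrite ge0_integral_setU//=; last 3 first.
- by apply/measurable_EFinP; exact: measurable_funTS.
- by move=> z _; rewrite lee_fin invr_ge0 sqr_ge0.
- apply/disj_setPS => z []/=; rewrite !in_itv/= andbT => z1 z2.
  by have := lt_trans z2 z1; rewrite deform_lt; lra.
rewrite integral_invsqr_lt ?deform_lt; last lra.
rewrite integral_invsqr_gt ?deform_lt; last lra.
by rewrite -EFinD -EFinM; congr EFin; rewrite mulrC addrC.
Qed.

End kernel.

(** * Pointwise bounds of the kernel perturbation *)

Section kernel_estimates.
Context (R : realType).
Local Notation mu := (@lebesgue_measure R).
Variables (tau c : R).
Hypothesis tau01 : 0 < tau <= 4^-1.

Local Notation l := (c - 2^-1).
Local Notation r := (c + 2^-1).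

Definition slope (s t : R) : R := 1 + tau * (4^-1 - (s ^+ 2 + s * t + t ^+ 2)).

Lemma deform_slope x y : l <= x <= r -> l <= y <= r ->
  deform tau c x - deform tau c y = (x - y) * slope (x - c) (y - c).
Proof.
by move=> hx hy; rewrite /deform !cutoff_cubic_in// /cubic /slope; field.
Qed.

Lemma deform'_in x : l < x <= r -> deform' tau c x = 1 + tau * (4^-1 - 3 * (x - c) ^+ 2).
Proof. by rewrite /deform' => ->. Qed.

Lemma deform'_out x : ~~ (l < x <= r) -> deform' tau c x = 1.
Proof. by rewrite /deform' => /negbTE ->; rewrite mulr0 addr0. Qed.

Lemma slope_bounds s t : `|s| <= 2^-1 -> `|t| <= 2^-1 ->
  1 - tau / 2 <= slope s t <= 1 + tau / 4.
Proof.
have [t0 t1] := andP tau01.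
rewrite !ler_norml /slope => hs ht.
have h1 : 0 <= s ^+ 2 + s * t + t ^+ 2 by nra.
have h2 : s ^+ 2 + s * t + t ^+ 2 <= 3 / 4 by nra.
by apply/andP; split; nra.
Qed.

(** With s = x - c and t = y - c, the difference of [deform' x * deform' y] and the squared slope
    contains the factor (s - t)^2. It cancels the singularity and leaves exactly -tau N / slope^2,
    in which both N and the slope tend to 1 with [tau]; the bound -tau/2 leaves room for the higher
    orders. *)
Lemma kerR_in x y : l < x < r -> l < y < r -> -1 <= kerR tau c x y <= - (tau / 2).
Proof.
have [t0 t1] := andP tau01.
move=> hx hy; rewrite /kerR /kerS.
have [->|xy] := eqVneq x y; first by rewrite !subrr expr0n/= invr0 mulr0 subrr sub0r lexx andbT; lra.
rewrite subr0 deform_slope; [|lra|lra].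
rewrite !deform'_in; [|lra|lra].
have hs : `|x - c| <= 2^-1 by rewrite ler_norml; lra.
have ht : `|y - c| <= 2^-1 by rewrite ler_norml; lra.
have /andP[D1 D2] := slope_bounds hs ht.
have xyc : x - y = (x - c) - (y - c) by ring.
have st : (x - c) - (y - c) != 0 by rewrite -xyc subr_eq0.
rewrite xyc.
move: hs ht D1 D2 st; move: (x - c) (y - c) => s t hs ht D1 D2 st.
have D0 : 0 < slope s t by lra.
pose N := 1 + tau / 4 + tau * (s ^+ 2 + 4 * s * t + t ^+ 2).
have -> : (1 + tau * (4^-1 - 3 * s ^+ 2)) * (1 + tau * (4^-1 - 3 * t ^+ 2)) /
    ((s - t) * slope s t) ^+ 2 - (s - t) ^- 2 = - (tau * (N / slope s t ^+ 2)).
  have : slope s t != 0 by rewrite gt_eqF.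
  rewrite /N /slope => D; field.
  rewrite st andbT; apply: contra_neq D => D; apply: (mulfI (_ : 4 != 0)) => //.
  by rewrite mulr0 -D; field.
have [N1 N2] : 1 - tau / 4 <= N /\ N <= 1 + 2 * tau.
  move: hs ht; rewrite !ler_norml => hs ht.
  have st1 : - 4^-1 <= s * t.
    have : 0 <= (2^-1 - s) * (2^-1 - t) by apply: mulr_ge0; lra.
    by have : 0 <= (2^-1 + s) * (2^-1 + t); [apply: mulr_ge0; lra|lra].
  have st2 : s * t <= 4^-1.
    have : 0 <= (2^-1 + s) * (2^-1 - t) by apply: mulr_ge0; lra.
    by have : 0 <= (2^-1 - s) * (2^-1 + t); [apply: mulr_ge0; lra|lra].
  have s4 : s ^+ 2 <= 4^-1 by nra.
  have t4 : t ^+ 2 <= 4^-1 by nra.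
  have h1 : - 2^-1 <= s ^+ 2 + 4 * s * t + t ^+ 2.
    by have := sqr_ge0 (s + t); rewrite sqrrD; lra.
  have h2 : s ^+ 2 + 4 * s * t + t ^+ 2 <= 3 / 2 by lra.
  by rewrite /N; split; nra.
have D20 : 0 < slope s t ^+ 2 by rewrite exprn_gt0.
have hD1 : slope s t ^+ 2 <= 5 / 4 by nra.
have hD2 : 3 / 4 <= slope s t ^+ 2 by nra.
have Q1 : 2^-1 <= N / slope s t ^+ 2 by rewrite ler_pdivlMr//; nra.
have Q2 : N / slope s t ^+ 2 <= 4 by rewrite ler_pdivrMr//; nra.
apply/andP; split; nra.
Qed.

(** Here [y] is a fixed point with [deform' y] equal to 1. Moving x by at most tau/8, at distance at
    least 4 from y, shrinks the squared distance by a factor no smaller than 1 - tau/16, while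
    [deform' x] is at most 1 + tau/4. The relative gain, about 5 tau/16, is multiplied by (x -
    y)^{-2} <= 1/16. *)
Lemma kerR_cross x y : l < x < r -> ~~ (l <= y <= r) -> 4 <= `|x - y| ->
  -1 <= kerR tau c x y <= tau / 40.
Proof.
have [t0 t1] := andP tau01.
move=> hx hy xy4; rewrite /kerR /kerS.
have yo : deform tau c y = y.
  by apply: deform_out; rewrite /= in_itv/= => /andP[h1 h2]; move: hy; rewrite !ltW.
rewrite yo (@deform'_out y); last by apply: contra hy => /andP[/ltW -> ->].
have -> : (x == y) = false by apply/negbTE; apply: contraTneq xy4 => ->; rewrite subrr normr0 -ltNge; lra.
rewrite mulr1 subr0.
have a1 := deform'_le c tau01 x.
have a0 := deform'_ge c tau01 x.
have : `|deform tau c x - x| <= tau / 8.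
  rewrite /deform addrAC subrr add0r normrM gtr0_norm// ler_pM2l//.
  exact: cutoff_cubic_bound.
have -> : deform tau c x - y = (x - y) + (deform tau c x - x) by ring.
move: xy4; move: (x - y) (deform tau c x - x) => d e d4 e8.
have sd : `|d| ^+ 2 = d ^+ 2 by rewrite real_normK ?num_real.
have E2 : (`|d| - tau / 8) ^+ 2 <= (d + e) ^+ 2.
  rewrite -[leRHS]real_normK ?num_real//.
  have := lerB_normD d e => h.
  by rewrite lerXn2r ?nnegrE//; lra.
pose q := `|d|^-1.
have qd : q * `|d| = 1 by rewrite mulVf// gt_eqF//; lra.
have q0 : 0 < q by rewrite invr_gt0; lra.
have q4 : q <= 4^-1 by rewrite lef_pV2 ?posrE//; lra.
have -> : d ^- 2 = q ^+ 2 by rewrite /q exprVn sd.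
have E15 : 15 <= (d + e) ^+ 2 by nra.
have E20 : 0 < (d + e) ^+ 2 by lra.
have ai : 0 <= deform' tau c x / (d + e) ^+ 2 by rewrite divr_ge0//; lra.
apply/andP; split; first by nra.
rewrite lerBlDr ler_pdivrMr//.
have : 1 - tau / 16 <= q ^+ 2 * (d + e) ^+ 2.
  apply: (@le_trans _ _ (q ^+ 2 * (`|d| - tau / 8) ^+ 2)); last by rewrite ler_wpM2l// sqr_ge0.
  by rewrite -exprMn mulrBr qd; nra.
nra.
Qed.

Lemma kerR_out x y : ~~ (l <= x <= r) -> ~~ (l <= y <= r) -> - 1 <= kerR tau c x y <= 0.
Proof.
have [t0 t1] := andP tau01.
have o z : ~~ (l <= z <= r) -> deform tau c z = z /\ deform' tau c z = 1.
  move=> hz; split.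
    by apply: deform_out; rewrite /= in_itv/= => /andP[h1 h2]; move: hz; rewrite !ltW.
  by apply: deform'_out; apply: contra hz => /andP[/ltW -> ->].
move=> /o[ex e'x] /o[ey e'y]; rewrite /kerR /kerS ex ey e'x e'y mulr1 div1r subrr sub0r.
by case: ifP => _; lra.
Qed.

End kernel_estimates.

(** * Integrals of bounded functions on sets of finite measure *)

Section bounded_tools.
Context d (T : measurableType d) (R : realType) (mu : {measure set T -> \bar R}).

Lemma integral_bounded_le (D : set T) (f : T -> R) (M : R) : measurable D ->
  measurable_fun D f -> (forall x, D x -> `|f x| <= M) ->
  (\int[mu]_(x in D) `|(f x)%:E| <= M%:E * mu D)%E.
Proof.
move=> mD mf fM; rewrite -(integral_cst mu mD M%:E).
apply: ge0_le_integral => //=.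
by apply/measurable_EFinP; exact: measurableT_comp.
Qed.

Lemma integrable_bounded (D : set T) (f : T -> R) (M : R) : measurable D ->
  (mu D < +oo)%E -> measurable_fun D f -> (forall x, D x -> `|f x| <= M) ->
  mu.-integrable D (EFin \o f).
Proof.
move=> mD muD mf fM; apply/integrableP; split; first exact/measurable_EFinP.
apply: le_lt_trans (integral_bounded_le mD mf fM) _.
have fD : mu D \is a fin_num by rewrite ge0_fin_numE.
by rewrite ltey_eq fin_numM.
Qed.

Lemma Rintegral_bounded (D : set T) (f : T -> R) (M : R) : measurable D ->
  (mu D < +oo)%E -> measurable_fun D f -> (forall x, D x -> `|f x| <= M) ->
  `|\int[mu]_(x in D) f x| <= M * fine (mu D).
Proof.
move=> mD muD mf fM; have fi := integrable_bounded mD muD mf fM.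
apply: le_trans (le_normr_Rintegral mD fi) _.
rewrite -lee_fin EFinM; have /fineK -> : mu D \is a fin_num by rewrite ge0_fin_numE.
rewrite /Rintegral fineK; last first.
  have /integrableP[mEf fioo] := fi.
  by rewrite ge0_fin_numE ?integral_ge0.
exact: integral_bounded_le.
Qed.

Lemma integrable_bounded_support (A : set T) (f : T -> R) (M : R) : measurable A ->
  (mu A < +oo)%E -> measurable_fun [set: T] f -> (forall x, `|f x| <= M) ->
  (forall x, ~ A x -> f x = 0) -> mu.-integrable [set: T] (EFin \o f).
Proof.
move=> mA muA mf fM fA.
rewrite (_ : EFin \o f = (EFin \o f) \_ A); last first.
  apply/funext => x; rewrite patchE; case: ifPn => //= /negP xA.
  by rewrite fA// => Ax; apply: xA; rewrite inE.
apply/(integrable_mkcond _ mA).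
exact: integrable_bounded (measurable_funTS mf) (fun x _ => fM x).
Qed.

Lemma Rintegral_support (A : set T) (f : T -> R) :
  (forall x, ~ A x -> f x = 0) -> \int[mu]_(x in A) f x = \int[mu]_x f x.
Proof.
move=> fA; rewrite Rintegral_mkcond; apply: eq_Rintegral => x _.
rewrite patchE; case: ifPn => // /negP xA.
by rewrite fA// => Ax; apply: xA; rewrite inE.
Qed.

End bounded_tools.

(** * Vanishing integral of the kernel perturbation in one variable *)

Section potential.
Context (R : realType).
Local Notation mu := (@lebesgue_measure R).
Variables (tau c : R).
Hypothesis tau01 : 0 < tau <= 4^-1.

Local Notation l := (c - 2^-1).
Local Notation r := (c + 2^-1).

(* Only the two kinks of [deform] are excluded. *)
Definition regular_pt x := (l < x < r) || ~~ (l <= x <= r).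

(** Near a regular point the second-order terms of the two one-sided difference quotients have
    opposite signs and cancel, so the difference from 2/rho is of order rho. At a kink the two
    one-sided slopes differ and a term of order 1/rho would remain. *)
Lemma kerR_local x : regular_pt x -> exists2 rho0 : R, 0 < rho0 &
  forall rho, 0 < rho < rho0 ->
    `|deform' tau c x * ((deform tau c (x + rho) - deform tau c x)^-1 +
       (deform tau c x - deform tau c (x - rho))^-1) - 2 / rho| <= 2 * rho /\
    forall y, `|y - x| <= rho -> `|kerR tau c x y| <= 1.
Proof.
have [t0 t1] := andP tau01.
case/orP => hx; last first.
  have [rho0 rho00 hrho] : exists2 rho0 : R, 0 < rho0 &
      forall y, `|y - x| < rho0 -> ~~ (l <= y <= r).
    have [xl|lx] := ltP x l.
      exists (l - x); first lra.
      by move=> y; rewrite ltr_norml => ?; apply/negP => /andP[]; lra.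
    have rx : r < x by move: hx; rewrite lx/= -ltNge.
    exists (x - r); first lra.
    by move=> y; rewrite ltr_norml => ?; apply/negP => /andP[]; lra.
  exists rho0 => // rho /andP[rho_gt0 rho_lt].
  have o z : ~~ (l <= z <= r) -> deform tau c z = z.
    by move=> hz; apply: deform_out; rewrite /= in_itv/= => /andP[h1 h2]; move: hz; rewrite !ltW.
  split.
    have op : ~~ (l <= x + rho <= r).
      by apply: hrho; rewrite (_ : x + rho - x = rho) ?gtr0_norm//; ring.
    have om : ~~ (l <= x - rho <= r).
      by apply: hrho; rewrite (_ : x - rho - x = - rho) ?normrN ?gtr0_norm//; ring.
    rewrite (o _ hx) (o _ op) (o _ om).
    rewrite deform'_out; last by apply: contra hx => /andP[/ltW -> ->].
    have -> : x + rho - x = rho by ring.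
    have -> : x - (x - rho) = rho by ring.
    have -> : 1 * (rho^-1 + rho^-1) - 2 / rho = 0 by ring.
    by rewrite normr0; lra.
  move=> y yx; have := kerR_out tau01 hx (hrho y (le_lt_trans yx rho_lt)).
  by rewrite ler_norml; lra.
exists (Num.min (x - l) (r - x)).
  by rewrite lt_min; lra.
move=> rho; rewrite lt_min => /andP[rho_gt0 /andP[rl rr]].
split; last first.
  move=> y; rewrite ler_norml => yx; have := @kerR_in _ tau c tau01 x y hx.
  by rewrite ler_norml => h; have := h ltac:(lra); lra.
rewrite !deform_slope; try (apply/andP; split; lra).
rewrite deform'_in; last by lra.
have -> : x + rho - x = rho by ring.
have -> : x - (x - rho) = rho by ring.
have e1 : x + rho - c = (x - c) + rho by ring.
have e2 : x - rho - c = (x - c) - rho by ring.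
have b0 : `|x - c| <= 2^-1 by rewrite ler_norml; lra.
have b1 : `|x - c + rho| <= 2^-1 by rewrite ler_norml; lra.
have b2 : `|x - c - rho| <= 2^-1 by rewrite ler_norml; lra.
rewrite e1 e2; have := slope_bounds tau01 b1 b0; have := slope_bounds tau01 b0 b2.
move: b0; rewrite ler_norml; move: (x - c) => s b0.
set p := slope tau s _; set q := slope tau _ s => hp hq.
have ep : 1 + tau * (4^-1 - 3 * s ^+ 2) = p + tau * (- (3 * s * rho) + rho ^+ 2).
  by rewrite /p /slope; ring.
have eq_ : 1 + tau * (4^-1 - 3 * s ^+ 2) = q + tau * (3 * s * rho + rho ^+ 2).
  by rewrite /q /slope; ring.
have pq : p - q = 6 * tau * s * rho by rewrite /p /q /slope; ring.
(* [deform' x] is expanded around the slope [q] in the first summand and around [p] in the second,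
   each time the slope in the denominator; the terms 1/rho then cancel exactly. *)
rewrite mulrDr {1}eq_ ep.
have p0 : p != 0 by rewrite gt_eqF//; lra.
have q0 : q != 0 by rewrite gt_eqF//; lra.
have r0 : rho != 0 by rewrite gt_eqF.
have -> : (q + tau * (3 * s * rho + rho ^+ 2)) * (rho * q)^-1 +
   (p + tau * (- (3 * s * rho) + rho ^+ 2)) * (rho * p)^-1 - 2 / rho =
   tau * (rho * (p + q) + 3 * s * (p - q)) / (p * q).
  by field; rewrite p0 q0 r0.
rewrite pq.
have pq0 : 0 < p * q by rewrite mulr_gt0//; lra.
have pq4 : 3 / 4 <= p * q by nra.
have s4 : s ^+ 2 <= 4^-1 by nra.
have -> : rho * (p + q) + 3 * s * (6 * tau * s * rho) = rho * (p + q + 18 * tau * s ^+ 2) by ring.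
rewrite ger0_norm; last first.
  rewrite divr_ge0 ?ltW// mulr_gt0// mulr_gt0//.
  apply: ltr_wpDr; last by lra.
  by apply: mulr_ge0 (sqr_ge0 _); lra.
rewrite ler_pdivrMr// mulrCA [leRHS](_ : _ = rho * (2 * (p * q))); last by ring.
rewrite ler_pM2l//.
have ts : tau * s ^+ 2 <= 4^-1 * 4^-1 by apply: ler_pM (ltW t0) (sqr_ge0 s) t1 s4.
have t2 : tau * (tau * s ^+ 2) <= 4^-1 * (4^-1 * 4^-1).
  by apply: ler_pM (ltW t0) _ t1 ts; apply: mulr_ge0 (ltW t0) (sqr_ge0 s).
have h1 : 0 <= p + q by lra.
have h2 : p + q <= 5 / 2 by lra.
have tp : tau * (p + q) <= 4^-1 * (5 / 2) by apply: ler_pM (ltW t0) h1 t1 h2.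
by lra.
Qed.

Lemma integral_invsqr_shift (x rho : R) : 0 < rho ->
  (\int[mu]_(y in [set y : R | (rho < `|y - x|)%R]) ((x - y) ^- 2)%:E = (2 / rho)%:E)%E.
Proof.
move=> rho0; rewrite -integral_invsqr_norm// integral_mkcond [RHS]integral_mkcond.
rewrite -[RHS](@ge0_integral_shift _ (- x)); last 2 first.
- apply/(measurable_restrictT _ _).1 => //; first exact: measurable_gt_norm.
  by apply/measurable_EFinP; apply: measurable_funTS; apply: measurable_funV; exact: measurable_funX.
- by apply: erestrict_ge0 => z _; rewrite lee_fin invr_ge0 sqr_ge0.
apply: eq_integral => y _; rewrite !patchE.
have -> : (y - x \in [set z : R | rho < `|z|]) = (y \in [set y : R | rho < `|y - x|]).
  by apply/idP/idP; rewrite !inE.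
by case: ifP => // _; rewrite -(sqrrN (x - y)) opprB.
Qed.

Lemma measurable_kerR1 x : measurable_fun [set: R] (kerR tau c x).
Proof.
exact: (measurableT_comp (measurable_kerR tau c) (pair1_measurable x)).
Qed.

(* Over [rho < |y - x|] both kernels have explicit integrals, whose difference
   is [O(rho)] by [kerR_local]. *)
Lemma kerR_potential x : regular_pt x ->
  mu.-integrable [set: R] (EFin \o kerR tau c x) /\ \int[mu]_y kerR tau c x y = 0.
Proof.
move=> /kerR_local [rho0 rho00 hrho].
have mA rho : measurable [set y : R | rho < `|y - x|].
  rewrite -[X in measurable X]setTI; apply: measurable_fun_ltr => //.
  by apply: measurableT_comp => //; exact: measurable_funB.
have mS : measurable_fun [set: R] (kerS tau c x).
  exact: (measurableT_comp (measurable_kerS tau c) (pair1_measurable x)).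
have mI : measurable_fun [set: R] (fun y => (x - y) ^- 2).
  by apply: measurable_funV; apply: measurable_funX; exact: measurable_funB.
have iS rho : 0 < rho -> mu.-integrable [set y : R | rho < `|y - x|] (EFin \o kerS tau c x).
  move=> r0; apply: ge0_integrable; [exact: mA|exact: measurable_funTS| |].
    by move=> y _; exact: kerS_ge0.
  by rewrite kerS_tail// ltry.
have iI rho : 0 < rho -> mu.-integrable [set y : R | rho < `|y - x|] (EFin \o (fun y => (x - y) ^- 2)).
  move=> r0; apply: ge0_integrable; [exact: mA|exact: measurable_funTS| |].
    by move=> y _; rewrite invr_ge0 sqr_ge0.
  by rewrite integral_invsqr_shift// ltry.
have kerRE rho y : 0 < rho -> [set y : R | rho < `|y - x|] y ->
    kerR tau c x y = kerS tau c x y - (x - y) ^- 2.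
  move=> r0 /= h; rewrite /kerR; case: eqVneq h => [->|_ _]; last by rewrite subr0.
  by rewrite subrr normr0 ltNge ltW.
have iA rho : 0 < rho -> mu.-integrable [set y : R | rho < `|y - x|] (EFin \o kerR tau c x).
  move=> r0.
  have h : mu.-integrable [set y : R | rho < `|y - x|] (EFin \o (fun y => kerS tau c x y - (x - y) ^- 2)).
    by apply: integrable_sub; [exact: mA|exact: iS|exact: iI].
  by apply: integrable_ext h; [exact: mA|move=> y hy; rewrite (kerRE rho)].
have iB rho : 0 < rho < rho0 -> mu.-integrable (~` [set y : R | rho < `|y - x|]) (EFin \o kerR tau c x) /\
   `|\int[mu]_(y in ~` [set y : R | rho < `|y - x|]) kerR tau c x y| <= 2 * rho.
  move=> hr; have [_ h1] := hrho _ hr; have [r0 _] := andP hr.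
  have muB : mu (~` [set y : R | rho < `|y - x|]) = (2 * rho)%:E.
    have -> : ~` [set y : R | rho < `|y - x|] = `[x - rho, x + rho]%classic.
      apply/seteqP; split => y /=; rewrite in_itv/= -ler_distlC distrC leNgt.
        by move/negP.
      by move/negP.
    rewrite lebesgue_measure_itv/= lte_fin ifT; last by lra.
    by rewrite -EFinB; congr EFin; ring.
  have muBy : (mu (~` [set y : R | (rho < `|y - x|)%R]) < +oo)%E by rewrite muB ltry.
  have mB := measurableC (mA rho).
  have h2 y : (~` [set y : R | rho < `|y - x|]) y -> `|kerR tau c x y| <= 1.
    by move=> /negP; rewrite -leNgt; exact: h1.
  have mk := measurable_funTS (measurable_kerR1 x).
  split.
    apply: (@integrable_bounded _ _ _ _ _ _ 1); [exact: mB|exact: muBy|exact: mk|exact: h2].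
  have -> : 2 * rho = 1 * fine (mu (~` [set y : R | rho < `|y - x|])) by rewrite muB mul1r.
  apply: (@Rintegral_bounded _ _ _ _ _ _ 1); [exact: mB|exact: muBy|exact: mk|exact: h2].
have uT rho : [set y : R | rho < `|y - x|] `|` ~` [set y : R | rho < `|y - x|] = [set: R].
  by rewrite setUv.
have r2 : 0 < rho0 / 2 < rho0 by lra.
have ii : mu.-integrable [set: R] (EFin \o kerR tau c x).
  have [r20 _] := andP r2.
  rewrite -(uT (rho0 / 2)); apply/integrableP; split.
    by apply/measurable_EFinP; apply: measurable_funTS; exact: measurable_kerR1.
  have mk : measurable_fun [set: R] (abse \o (EFin \o kerR tau c x)).
    by apply: measurableT_comp => //; apply/measurable_EFinP; exact: measurable_kerR1.
  rewrite ge0_integral_setU//; last 4 first.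
  - exact: mA.
  - exact: (measurableC (mA _)).
  - by rewrite uT.
  - exact/disj_setPCl.
  have /integrableP[_ f1] := iA _ r20.
  have [/integrableP[_ f2] _] := iB _ r2.
  by rewrite lte_add_pinfty.
split=> //; apply/eqP; rewrite -normr_le0; apply/ler_addgt0Pr => e e0.
rewrite add0r.
pose rho := Num.min (rho0 / 2) (e / 4).
have hr : 0 < rho < rho0.
  have h2 : rho0 / 2 < rho0 by lra.
  by rewrite /rho lt_min gt_min h2 !divr_gt0.
have [hr0 _] := andP hr; have [hA _] := hrho _ hr; have [iB1 iB2] := iB _ hr.
rewrite -(uT rho) Rintegral_setU//; last 4 first.
- exact: mA.
- exact: (measurableC (mA _)).
- by rewrite uT.
- exact/disj_setPCl.
apply: le_trans (ler_normD _ _) _.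
have -> : \int[mu]_(y in [set y : R | rho < `|y - x|]) kerR tau c x y =
   deform' tau c x * ((deform tau c (x + rho) - deform tau c x)^-1 +
       (deform tau c x - deform tau c (x - rho))^-1) - 2 / rho.
  rewrite -(ge0_RintegralE (kerS_tail c tau01 x hr0)).
  rewrite -(ge0_RintegralE (integral_invsqr_shift x hr0)).
  rewrite -RintegralB//; [|exact: mA|exact: iS|exact: iI].
  by apply: eq_Rintegral => y; rewrite inE => hy; rewrite (kerRE rho).
have : rho <= e / 4 by rewrite /rho ge_min lexx orbT.
clearbody rho => re; apply: le_trans (lerD hA iB2) _.
by clear -re e0; lra.
Qed.

End potential.

(** * Integrals over the plane and their behaviour under the deformation *)

Section product_tools.
Context (R : realType).
Local Notation mu := (@lebesgue_measure R).
Local Notation mu2 := (mu \x mu)%E.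

Lemma measurable_fst_comp (f : R -> R) : measurable_fun [set: R] f ->
  measurable_fun [set: R * R] (fun p => f p.1).
Proof. by move=> mf; exact: (measurableT_comp mf measurable_fst). Qed.

Lemma measurable_snd_comp (f : R -> R) : measurable_fun [set: R] f ->
  measurable_fun [set: R * R] (fun p => f p.2).
Proof. by move=> mf; exact: (measurableT_comp mf measurable_snd). Qed.

Lemma integrable_tensor (f g : R -> R) :
  measurable_fun [set: R] f -> measurable_fun [set: R] g ->
  mu.-integrable [set: R] (EFin \o f) -> mu.-integrable [set: R] (EFin \o g) ->
  mu2.-integrable [set: R * R] (EFin \o (fun p : R * R => f p.1 * g p.2)) /\
  \int[mu2]_p (f p.1 * g p.2) = (\int[mu]_x f x) * (\int[mu]_y g y).
Proof.
move=> mf mg fi gi.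
have mfg : measurable_fun [set: R * R] (EFin \o (fun p : R * R => f p.1 * g p.2)).
  apply/measurable_EFinP; apply: measurable_funM.
    exact: measurable_fst_comp.
  exact: measurable_snd_comp.
have ii : mu2.-integrable [set: R * R] (EFin \o (fun p : R * R => f p.1 * g p.2)).
  apply/integrable12ltyP => //=.
  have /integrableP[_ fi'] := fi; have /integrableP[_ gi'] := gi.
  have gfin : (\int[mu]_x `|(g x)%:E|)%E \is a fin_num by rewrite ge0_fin_numE// integral_ge0.
  rewrite (eq_integral (fun x : measurableTypeR R => (`|(f x)%:E| * \int[mu]_y `|(g y)%:E|)%E)); last first.
    move=> x _; rewrite -ge0_integralZl//.
    - by apply: eq_integral => y _; rewrite /= normrM EFinM.
    - by apply: measurableT_comp => //; exact/measurable_EFinP.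
  rewrite ge0_integralZr//.
  - rewrite ltey_eq fin_numM// ge0_fin_numE// integral_ge0//.
  - by apply: measurableT_comp => //; exact/measurable_EFinP.
  - exact: integral_ge0.
split=> //; rewrite /Rintegral -(integral12_prod_meas1 ii) /fubini_F/=.
rewrite (eq_integral (fun x : measurableTypeR R => ((f x)%:E * (\int[mu]_y g y)%:E)%E)); last first.
  move=> x _; rewrite /Rintegral fineK; last exact: integrable_fin_num.
  rewrite -integralZl//; by apply: eq_integral => y _; rewrite /= EFinM.
rewrite integralZr//= fineM//=; exact: integrable_fin_num.
Qed.

End product_tools.

Section deformation2.
Context (R : realType).
Local Notation mu := (@lebesgue_measure R).
Local Notation mu2 := (mu \x mu)%E.
Variables (tau c : R).
Hypothesis tau01 : 0 < tau <= 4^-1.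

Lemma ge0_integral_deform_prod (G : R * R -> \bar R) :
  measurable_fun [set: R * R] G -> (forall p, 0 <= G p)%E ->
  (\int[mu2]_p (G (deform tau c p.1, deform tau c p.2) *
     (deform' tau c p.1 * deform' tau c p.2)%:E) = \int[mu2]_p G p)%E.
Proof.
move=> mG G0.
have mT := measurable_deform tau c; have mT' := measurable_deform' tau c.
have T'0 x := deform'_gt0 c tau01 x.
rewrite !fubini_tonelli1//; last 2 first.
- apply: emeasurable_funM.
    apply: (measurableT_comp mG); apply: measurable_fun_pair.
      exact: measurable_fst_comp.
    exact: measurable_snd_comp.
  apply/measurable_EFinP; apply: measurable_funM.
    exact: measurable_fst_comp.
  exact: measurable_snd_comp.
- by move=> p; rewrite mule_ge0// lee_fin mulr_ge0// ltW.
rewrite -[RHS](ge0_integral_deform c tau01); last 2 first.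
- exact: (@measurable_fun_fubini_tonelli_F _ _ _ _ _ mu G).
- by move=> x; exact: integral_ge0.
apply: eq_integral => x _; rewrite /fubini_F/=.
rewrite -(ge0_integral_deform c tau01 (f := fun y => G (deform tau c x, y))); last 2 first.
- exact: (measurableT_comp mG (pair1_measurable _)).
- by move=> y.
rewrite -ge0_integralZr//.
- by apply: eq_integral => y _; rewrite -muleA -EFinM (mulrC (deform' tau c x)).
- apply: emeasurable_funM; last exact/measurable_EFinP.
  apply: (measurableT_comp (measurableT_comp mG (pair1_measurable _))).
  exact: mT.
- by move=> y _; rewrite mule_ge0// lee_fin ltW.
- by rewrite lee_fin ltW.
Qed.

End deformation2.

(** * Energy of the deformed function *)

Section energy.
Context (R : realType).
Local Notation mu := (@lebesgue_measure R).
Local Notation mu2 := (mu \x mu)%E.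

Definition quot_sqr (u : R -> R) (p : R * R) : R := ((u p.1 - u p.2) / (p.1 - p.2)) ^+ 2.

Definition energy (u : R -> R) : R := \int[mu2]_p quot_sqr u p.

Lemma measurable_quot_sqr (u : R -> R) : measurable_fun [set: R] u ->
  measurable_fun [set: R * R] (quot_sqr u).
Proof.
move=> mf; apply: measurable_funX; apply: measurable_funM.
  by apply: measurable_funB; [exact: measurable_fst_comp|exact: measurable_snd_comp].
by apply: measurable_funV; exact: measurable_funB.
Qed.

Variables (tau c : R).
Hypothesis tau01 : 0 < tau <= 4^-1.
Local Notation l := (c - 2^-1).
Local Notation r := (c + 2^-1).
Local Notation J := (`]l, r[%classic).

Variable A : set R.
Hypothesis mA : measurable A.
Hypothesis muA : (mu A < +oo)%E.
Hypothesis JA : J `<=` A.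
Hypothesis Aout : forall y, A y -> ~ J y -> ~~ (l <= y <= r).
Hypothesis Afar : forall x y, J x -> A y -> ~ J y -> 4 <= `|x - y|.

Lemma kerR_norm_le x y : A x -> A y -> `|kerR tau c x y| <= 1.
Proof.
have [t0 t1] := andP tau01.
move=> Ax Ay; rewrite ler_norml.
have [Jx|Jx] := pselect (J x); have [Jy|Jy] := pselect (J y).
- move: Jx Jy; rewrite /= !in_itv/= => Jx Jy.
  by have := kerR_in tau01 Jx Jy; lra.
- have h := Afar Jx Ay Jy; move: Jx; rewrite /= in_itv/= => Jx.
  by have := kerR_cross tau01 Jx (Aout Ay Jy) h; lra.
- have h := Afar Jy Ax Jx; move: Jy; rewrite /= in_itv/= => Jy.
  by rewrite kerRC; have := kerR_cross tau01 Jy (Aout Ax Jx) h; lra.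
- by have := kerR_out tau01 (Aout Ax Jx) (Aout Ay Jy); lra.
Qed.

Variables (u : R -> R) (M : R).
Hypothesis mu_ : measurable_fun [set: R] u.
Hypothesis u0M : forall x, 0 <= u x <= M.
Hypothesis uA : forall x, ~ A x -> u x = 0.
Hypothesis Eu : (\int[mu2]_p (quot_sqr u p)%:E < +oo)%E.

Local Notation w := (u \o deform tau c).

Lemma deform_stable x : A x <-> A (deform tau c x).
Proof.
have [Jx|Jx] := pselect (J x).
  by split => _; apply: JA => //; exact: (deform_in tau01 Jx).
by rewrite deform_out.
Qed.

Let measurable_w : measurable_fun [set: R] w.
Proof. exact: (measurableT_comp mu_ (measurable_deform tau c)). Qed.

Lemma comp_deform_out x : ~ A x -> w x = 0.
Proof. by move=> Ax /=; apply: uA => /(deform_stable x).2. Qed.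

Let w_bound x : 0 <= w x <= M. Proof. exact: u0M. Qed.

Let M_ge0 : 0 <= M. Proof. by have := u0M 0; lra. Qed.

Let iU : mu2.-integrable [set: R * R] (EFin \o quot_sqr u).
Proof.
apply: ge0_integrable => //.
- exact: measurable_quot_sqr.
- by move=> p _; exact: sqr_ge0.
Qed.

Local Notation dw2 := (fun p : R * R => (w p.1 - w p.2) ^+ 2).

Let mdw2 : measurable_fun [set: R * R] dw2.
Proof.
apply: measurable_funX; apply: measurable_funB.
  by apply: measurable_fst_comp; exact: measurable_w.
by apply: measurable_snd_comp; exact: measurable_w.
Qed.

Let intS : (\int[mu2]_p (dw2 p * kerS tau c p.1 p.2)%:E = \int[mu2]_p (quot_sqr u p)%:E)%E.
Proof.
rewrite -(ge0_integral_deform_prod c tau01 (G := fun p => (quot_sqr u p)%:E)).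
- apply: eq_integral => p _; rewrite -EFinM; congr EFin.
  by rewrite /quot_sqr /kerS /= expr_div_n; ring.
- by apply/measurable_EFinP; exact: measurable_quot_sqr.
- by move=> p; rewrite lee_fin sqr_ge0.
Qed.

Let iS : mu2.-integrable [set: R * R] (EFin \o (fun p => dw2 p * kerS tau c p.1 p.2)).
Proof.
apply: ge0_integrable => //.
- by apply: measurable_funM => //; exact: measurable_kerS.
- by move=> p _; rewrite mulr_ge0 ?sqr_ge0// kerS_ge0.
- by rewrite intS.
Qed.

(** [deform] has Lipschitz constant at most 9/8 and [deform'] is at least 7/8, and (9/8)^2 <= 4
    (7/8)^2. This carries finiteness of the energy over from [u] to its deformation. *)
Lemma invsqr_kerS x y : (x - y) ^- 2 <= 4 * kerS tau c x y.
Proof.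
have [t0 t1] := andP tau01.
have [->|xy] := eqVneq x y; first by rewrite subrr expr0n/= invr0 mulr_ge0// kerS_ge0.
have d : (deform tau c x - deform tau c y) ^+ 2 <= (9 / 8) ^+ 2 * (x - y) ^+ 2.
  rewrite -exprMn -[leLHS]real_normK ?num_real// -[leRHS]real_normK ?num_real//.
  rewrite lerXn2r ?nnegrE//.
  wlog xley : x y xy / x <= y.
    move=> h; have [/h//|/ltW yx] := leP x y; first exact.
    by rewrite distrC -[leRHS]normrN -mulrN opprB; apply: h => //; rewrite eq_sym.
  rewrite distrC -[leRHS]normrN -mulrN opprB.
  have := deform_sub c tau01 xley => /andP[h1 h2].
  have h3 : 0 <= y - x by rewrite subr_ge0.
  have h4 : 0 <= (1 - tau / 2) * (y - x) by rewrite mulr_ge0//; lra.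
  by rewrite !ger0_norm; [|nra|nra]; nra.
have xy0 : 0 < (x - y) ^+ 2 by rewrite exprn_even_gt0//= subr_eq0.
have T0 : 0 < (deform tau c x - deform tau c y) ^+ 2.
  rewrite exprn_even_gt0//= subr_eq0; apply: contra xy => /eqP /(inc_inj (deform_mono c tau01)).
  by move=> ->.
have a1 := deform'_ge c tau01 x; have a2 := deform'_ge c tau01 y.
have aa : (7 / 8) ^+ 2 <= deform' tau c x * deform' tau c y by nra.
rewrite /kerS mulrA ler_pdivlMr// -ler_pdivlMl ?invr_gt0// invrK.
nra.
Qed.

Let iW : mu2.-integrable [set: R * R] (EFin \o quot_sqr w).
Proof.
have h : mu2.-integrable [set: R * R] (EFin \o (fun p => 4 * (dw2 p * kerS tau c p.1 p.2))).
  exact: integrable_scale.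
apply: (integrable_dominated _ _ h) => //.
- by apply: measurable_quot_sqr; exact: measurable_w.
- move=> p _; rewrite ger0_norm ?sqr_ge0// /quot_sqr expr_div_n mulrCA.
  by rewrite ler_wpM2l ?sqr_ge0// invsqr_kerS.
Qed.

Let dw2_kerR p : dw2 p * kerR tau c p.1 p.2 = dw2 p * kerS tau c p.1 p.2 - quot_sqr w p.
Proof.
rewrite /quot_sqr /kerR; case: eqVneq => [->|_].
  by rewrite !subrr mul0r expr0n/= !mul0r subrr.
by rewrite subr0 expr_div_n/=; ring.
Qed.

Let iR : mu2.-integrable [set: R * R] (EFin \o (fun p => dw2 p * kerR tau c p.1 p.2)).
Proof.
have h := integrable_sub measurableT iS iW.
by apply: integrable_ext h => // p _; rewrite dw2_kerR.
Qed.

Let EwE : energy u - energy w = \int[mu2]_p (dw2 p * kerR tau c p.1 p.2).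
Proof.
have -> : energy u = \int[mu2]_p (dw2 p * kerS tau c p.1 p.2).
  by rewrite /energy /Rintegral intS.
rewrite -RintegralB//.
by apply: eq_Rintegral => p _; rewrite dw2_kerR.
Qed.

Let mkerR := measurable_kerR tau c.

Let A1 (p : R * R) : R := \1_A p.1 * \1_A p.2.

Let iA1 : mu2.-integrable [set: R * R] (EFin \o A1).
Proof.
have h : mu.-integrable [set: R] (EFin \o (\1_A : R -> R)).
  apply: (@integrable_bounded_support _ _ _ _ _ _ 1); [exact: mA|exact: muA|exact: measurable_indic| |].
  - by move=> x; rewrite indicE ger0_norm// lern1; case: (_ \in _).
  - by move=> x Ax; rewrite indicE memNset.
by have [] := integrable_tensor (measurable_indic mA) (measurable_indic mA) h h.
Qed.

Let indicA x : A x -> \1_A x = 1 :> R.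
Proof. by move=> Ax; rewrite indicE mem_set. Qed.

Let iww : mu2.-integrable [set: R * R] (EFin \o (fun p => w p.1 * w p.2 * kerR tau c p.1 p.2)).
Proof.
have h : mu2.-integrable [set: R * R] (EFin \o (fun p => M ^+ 2 * A1 p)).
  exact: integrable_scale.
apply: (integrable_dominated _ _ h) => //.
  apply: measurable_funM => //; apply: measurable_funM.
    by apply: measurable_fst_comp; exact: measurable_w.
  by apply: measurable_snd_comp; exact: measurable_w.
move=> p _; have M0 := M_ge0.
have A10 : 0 <= A1 p by rewrite /A1 !indicE mulr_ge0.
have [Ax|Ax] := pselect (A p.1); last first.
  by rewrite comp_deform_out// !mul0r normr0 mulr_ge0// sqr_ge0.
have [Ay|Ay] := pselect (A p.2); last first.
  by rewrite (comp_deform_out Ay) mulr0 mul0r normr0 mulr_ge0// sqr_ge0.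
rewrite /A1 !indicA// !mulr1 !normrM.
have /andP[wx0 wxM] := w_bound p.1; have /andP[wy0 wyM] := w_bound p.2.
rewrite -[leRHS]mulr1; apply: ler_pM => //; last exact: kerR_norm_le.
by rewrite !ger0_norm// expr2; apply: ler_pM.
Qed.

(** On A x A the kernel is bounded. For y outside A the bound of [kerR_norm_le] does not apply, but
    there w vanishes at y, and the integrand coincides with the one already known to be integrable
    from [iR]. *)
Let iw1 : mu2.-integrable [set: R * R] (EFin \o (fun p => w p.1 ^+ 2 * kerR tau c p.1 p.2)).
Proof.
have h1 : mu2.-integrable [set: R * R] (EFin \o (fun p => M ^+ 2 * A1 p)).
  exact: integrable_scale.
have h2 : mu2.-integrable [set: R * R] (EFin \o (fun p => `|dw2 p * kerR tau c p.1 p.2|)).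
  exact: (integrable_norm iR).
have h := integrable_add measurableT h1 h2.
apply: (integrable_dominated _ _ h) => //.
  apply: measurable_funM => //; apply: measurable_funX.
  by apply: measurable_fst_comp; exact: measurable_w.
move=> p _; have M0 := M_ge0.
have A10 : 0 <= A1 p by rewrite /A1 !indicE mulr_ge0.
have [Ax|Ax] := pselect (A p.1); last first.
  by rewrite comp_deform_out// expr0n/= !mul0r normr0 addr_ge0// mulr_ge0// sqr_ge0.
have [Ay|Ay] := pselect (A p.2); last first.
  by rewrite (comp_deform_out Ay) subr0 lerDr mulr_ge0// sqr_ge0.
apply: (@le_trans _ _ (M ^+ 2 * A1 p)); last by rewrite lerDl.
rewrite /A1 !indicA// !mulr1 !normrM.
have /andP[wx0 wxM] := w_bound p.1.
rewrite -[leRHS]mulr1; apply: ler_pM => //; last exact: kerR_norm_le.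
by rewrite ger0_norm// expr2; apply: ler_pM.
Qed.

(** Fubini with y innermost: a point of A is never an endpoint of J, by [Aout], so it is regular and
    [kerR_potential] makes the inner integral zero. With its mirror image [int_w2] this leaves only
    the mixed term of the square in [int_R]. *)
Let int_w1 : \int[mu2]_p (w p.1 ^+ 2 * kerR tau c p.1 p.2) = 0.
Proof.
rewrite /Rintegral -(integral12_prod_meas1 iw1) /fubini_F/=.
rewrite integral0_eq// => x _.
have [Ax|Ax] := pselect (A x); last first.
  rewrite integral0_eq// => y _; have := comp_deform_out Ax; rewrite /= => ->.
  by rewrite expr0n/= mul0r.
have [|ik ik0] := kerR_potential tau01 (x := x) (c := c).
  have [Jx|Jx] := pselect (J x); last by rewrite /regular_pt (Aout Ax Jx) orbT.
  by move: Jx; rewrite /regular_pt /= in_itv/= => ->.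
under eq_integral do rewrite EFinM.
rewrite integralZl// -[X in (_ * X)%E]fineK; last exact: integrable_fin_num.
by rewrite -[fine _]/(\int[mu]_y kerR tau c x y) ik0 mule0.
Qed.

Let iw2 : mu2.-integrable [set: R * R] (EFin \o (fun p => w p.2 ^+ 2 * kerR tau c p.1 p.2)).
Proof.
have h1 := integrable_sub measurableT iR iw1.
have h2 := integrable_add measurableT h1 (integrable_scale 2 measurableT iww).
by apply: integrable_ext h2 => // p _; ring.
Qed.

Let int_w2 : \int[mu2]_p (w p.2 ^+ 2 * kerR tau c p.1 p.2) = 0.
Proof.
rewrite /Rintegral -(integral21_prod_meas1 iw2) /fubini_G/=.
rewrite integral0_eq// => x _.
have [Ax|Ax] := pselect (A x); last first.
  rewrite integral0_eq// => y _; have := comp_deform_out Ax; rewrite /= => ->.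
  by rewrite expr0n/= mul0r.
have [|ik ik0] := kerR_potential tau01 (x := x) (c := c).
  have [Jx|Jx] := pselect (J x); last by rewrite /regular_pt (Aout Ax Jx) orbT.
  by move: Jx; rewrite /regular_pt /= in_itv/= => ->.
under eq_integral do rewrite EFinM kerRC.
rewrite integralZl// -[X in (_ * X)%E]fineK; last exact: integrable_fin_num.
by rewrite -[fine _]/(\int[mu]_y kerR tau c x y) ik0 mule0.
Qed.

Let int_R : \int[mu2]_p (dw2 p * kerR tau c p.1 p.2) =
  - (2 * \int[mu2]_p (w p.1 * w p.2 * kerR tau c p.1 p.2)).
Proof.
have h12 := integrable_add measurableT iw1 iw2.
have h3 := integrable_scale 2 measurableT iww.
rewrite -RintegralZl// -[RHS]add0r -[X in X + _](addr0 0) -{1}int_w1 -int_w2.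
rewrite -RintegralD// -RintegralB//.
by apply: eq_Rintegral => p _; ring.
Qed.

Let f (x : R) : R := w x * \1_J x.
Let g (x : R) : R := w x * \1_(A `\` J) x.

Let mJ : measurable J. Proof. by []. Qed.
Let mAJ : measurable (A `\` J). Proof. exact: measurableD. Qed.

Let mf : measurable_fun [set: R] f.
Proof. by apply: measurable_funM; [exact: measurable_w|exact: measurable_indic]. Qed.
Let mg : measurable_fun [set: R] g.
Proof. by apply: measurable_funM; [exact: measurable_w|exact: measurable_indic]. Qed.

Let ind01 (B : set R) x : 0 <= (\1_B x : R) <= 1.
Proof. by rewrite indicE ler0n lern1 leq_b1. Qed.

Let i_f : mu.-integrable [set: R] (EFin \o f).
Proof.
apply: (@integrable_bounded_support _ _ _ _ _ _ M); [exact: mA|exact: muA|exact: mf| |].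
- move=> x; have := w_bound x; have := ind01 J x; rewrite /f ler_norml.
  by move: (w x) (\1_J x) => a b ? ?; apply/andP; split; nra.
- by move=> x Ax; rewrite /f comp_deform_out// mul0r.
Qed.

Let i_g : mu.-integrable [set: R] (EFin \o g).
Proof.
apply: (@integrable_bounded_support _ _ _ _ _ _ M); [exact: mA|exact: muA|exact: mg| |].
- move=> x; have := w_bound x; have := ind01 (A `\` J) x; rewrite /g ler_norml.
  by move: (w x) (\1_(A `\` J) x) => a b ? ?; apply/andP; split; nra.
- by move=> x Ax; rewrite /g comp_deform_out// mul0r.
Qed.

(** The perturbation is at most -tau/2 on J x J, at most tau/40 between the components and at most 0
    on the rest of A x A. After the factor 2 of [int_R] these become the coefficients tau and tau/10
    of [energy_deform], the latter collecting two equal cross terms. *)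
Let pointwise x y :
  tau / 2 * (f x * f y) - tau / 40 * (f x * g y + g x * f y) <=
  - (w x * w y * kerR tau c x y).
Proof.
have [t0 t1] := andP tau01.
have i1 (B : set R) z : B z -> \1_B z = 1 :> R by move=> Bz; rewrite indicE mem_set.
have i0 (B : set R) z : ~ B z -> \1_B z = 0 :> R by move=> Bz; rewrite indicE memNset.
have [Ax|Ax] := pselect (A x); last first.
  by rewrite /f /g (comp_deform_out Ax) !(mul0r, mulr0, addr0) subr0 oppr0.
have [Ay|Ay] := pselect (A y); last first.
  by rewrite /f /g (comp_deform_out Ay) !(mul0r, mulr0, addr0) subr0 oppr0.
have wx := w_bound x; have wy := w_bound y.
have ww : 0 <= w x * w y by apply: mulr_ge0; [case/andP: wx|case/andP: wy].
have key k : kerR tau c x y <= k -> - (w x * w y * k) <= - (w x * w y * kerR tau c x y).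
  by move=> h; rewrite lerN2 ler_wpM2l.
have [Jx|Jx] := pselect (J x); have [Jy|Jy] := pselect (J y).
- rewrite /f /g !(i1 J)// !(i0 (A `\` J)); try by case.
  move: (Jx) (Jy); rewrite /= !in_itv/= => hx hy.
  have /andP[_ /key] := kerR_in tau01 hx hy; apply: le_trans.
  by rewrite /= le_eqVlt; apply/orP; left; apply/eqP; ring.
- have h := Afar Jx Ay Jy; have hx := Jx; rewrite /= in_itv/= in hx.
  have /andP[_ /key] := kerR_cross tau01 hx (Aout Ay Jy) h; apply: le_trans.
  rewrite /f /g (i1 J x Jx) (i0 J y Jy) (i0 (A `\` J) x); last by case.
  rewrite (i1 (A `\` J) y)//.
  by rewrite le_eqVlt; apply/orP; left; apply/eqP; ring.
- have h := Afar Jy Ax Jx; have hy := Jy; rewrite /= in_itv/= in hy.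
  have /andP[_] := kerR_cross tau01 hy (Aout Ax Jx) h; rewrite kerRC => /key; apply: le_trans.
  rewrite /f /g (i1 J y Jy) (i0 J x Jx) (i0 (A `\` J) y); last by case.
  rewrite (i1 (A `\` J) x)//.
  by rewrite le_eqVlt; apply/orP; left; apply/eqP; ring.
- have /andP[_ /key] := kerR_out tau01 (Aout Ax Jx) (Aout Ay Jy); apply: le_trans.
  rewrite /f /g !(i0 J)//.
  by rewrite le_eqVlt; apply/orP; left; apply/eqP; ring.
Qed.

Lemma energy_deform :
  mu2.-integrable [set: R * R] (EFin \o quot_sqr u) /\
  mu2.-integrable [set: R * R] (EFin \o quot_sqr w) /\
  energy w <= energy u - tau * (\int[mu]_(x in J) w x) ^+ 2 +
    tau / 10 * (\int[mu]_(x in J) w x) * \int[mu]_(x in A `\` J) w x.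
Proof.
split=> //; split => //.
have eB (B : set R) (h : R -> R) : \int[mu]_(x in B) h x = \int[mu]_x (h x * \1_B x).
  rewrite Rintegral_mkcond; apply: eq_Rintegral => x _.
  by rewrite patchE indicE; case: ifP => _; rewrite ?mulr1 ?mulr0.
rewrite (eB J) (eB (A `\` J)).
have [iff eff] := integrable_tensor mf mf i_f i_f.
have [ifg efg] := integrable_tensor mf mg i_f i_g.
have [igf egf] := integrable_tensor mg mf i_g i_f.
have i1 := integrable_scale (tau / 2) measurableT iff.
have i2' := integrable_add measurableT ifg igf.
have i2 := integrable_scale (tau / 40) measurableT i2'.
have i3 := integrable_sub measurableT i1 i2.
have i4 := integrable_scale (-1) measurableT iww.
have : \int[mu2]_p (tau / 2 * (f p.1 * f p.2) - tau / 40 * (f p.1 * g p.2 + g p.1 * f p.2)) <=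
   \int[mu2]_p (-1 * (w p.1 * w p.2 * kerR tau c p.1 p.2)).
  by apply: le_Rintegral => // p _; rewrite mulN1r; exact: pointwise.
rewrite RintegralB// RintegralZl// RintegralZl// RintegralD// RintegralZl// eff efg egf.
have := EwE; rewrite int_R.
set X := \int[mu2]_p (w p.1 * _ * _); rewrite -[\int[mu]_x f x]/(\int[mu]_x (w x * \1_J x)).
move: X (\int[mu]_x (w x * \1_J x)) => X a.
rewrite -[\int[mu]_y g y]/(\int[mu]_x (w x * \1_(A `\` J) x)).
move: (\int[mu]_x (w x * \1_(A `\` J) x)) (energy u) (energy w) => b e1 e2.
lra.
Qed.

End energy.

Lemma H_half_bounded_support (R : realType) (A : set R) (v : R -> R) (M : R) :
  measurable A -> (@lebesgue_measure R A < +oo)%E -> measurable_fun [set: R] v ->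
  (forall x, `|v x| <= M) -> (forall x, ~ A x -> v x = 0) ->
  (\int[(@lebesgue_measure R \x @lebesgue_measure R)%E]_p (quot_sqr v p)%:E < +oo)%E ->
  H_half v.
Proof.
move=> mA muA mv vM vA vE; split => //.
rewrite inE; apply/andP; split; rewrite inE//= /finite_norm unlock.
apply: poweR_lty.
have h : (@lebesgue_measure R).-integrable [set: R] (EFin \o (fun x => v x ^+ 2)).
  apply: (@integrable_bounded_support _ _ _ _ _ _ (M ^+ 2)); [exact: mA|exact: muA|exact: measurable_funX| |].
  - by move=> x; rewrite normrX lerXn2r ?nnegrE// (le_trans _ (vM x)).
  - by move=> x Ax; rewrite vA// expr0n.
have /integrableP[_] := h; apply: le_lt_trans.
rewrite le_eqVlt; apply/orP; left; apply/eqP; apply: eq_integral => x _.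
by rewrite /= normrX powR_mulrn.
Qed.

(** * The equation tested with the deformation *)

Section variation.
Context (R : realType).
Local Notation mu := (@lebesgue_measure R).
Local Notation mu2 := (mu \x mu)%E.
Variables (tau c : R).
Hypothesis tau01 : 0 < tau <= 4^-1.
Local Notation l := (c - 2^-1).
Local Notation r := (c + 2^-1).
Local Notation J := (`]l, r[%classic).

Variable A : set R.
Hypothesis mA : measurable A.
Hypothesis muA : (mu A < +oo)%E.
Hypothesis JA : J `<=` A.
Hypothesis Aout : forall y, A y -> ~ J y -> ~~ (l <= y <= r).
Hypothesis Afar : forall x y, J x -> A y -> ~ J y -> 4 <= `|x - y|.

Variables (u : R -> R) (M : R).
Hypothesis mu_ : measurable_fun [set: R] u.
Hypothesis u0M : forall x, 0 <= u x <= M.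
Hypothesis uA : forall x, ~ A x -> u x = 0.
Hypothesis Eu : (\int[mu2]_p (quot_sqr u p)%:E < +oo)%E.

Variable eps : R.
Hypothesis eps0 : 0 < eps.
Hypothesis weak : forall v : R -> R, H_half v ->
  {ae mu, forall x : R, ~ A x -> v x = 0} ->
  half_laplacian_form u v = eps * \int[mu]_(x in A) (expR (u x) * v x).

Local Notation w := (u \o deform tau c).

(** On J, ([deform'] - 1)/tau is 1/4 - 3 s^2, with s the distance to [c]. The parabola lies above
    it, with a margin that absorbs the evaluation at [deform x] instead of x. Its second derivative
    is bounded below, the corners at the ends of J being convex, which is what bounds its
    half-Laplacian from above. *)
Definition parabola (y : R) : R := Num.max 0 (2^-1 - 2 * (y - c) ^+ 2).

Lemma parabola_ge0 y : 0 <= parabola y. Proof. by rewrite le_max lexx. Qed.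

Lemma parabola_le y : parabola y <= 2^-1.
Proof. by rewrite ge_max; have := sqr_ge0 (y - c); lra. Qed.

Lemma parabola_out y : ~ J y -> parabola y = 0.
Proof.
rewrite /= in_itv/= => yJ; apply/max_idPl; rewrite subr_le0.
rewrite leNgt; apply/negP => h; apply: yJ.
have : `|y - c| < 2^-1.
  by rewrite -(@ltr_pXn2r _ 2)// ?nnegrE// real_normK ?num_real//; lra.
by rewrite ltr_norml; lra.
Qed.

Lemma measurable_parabola : measurable_fun [set: R] parabola.
Proof.
apply: measurable_maxr => //; apply: measurable_funB => //.
by apply: measurable_funM => //; apply: measurable_funX; exact: measurable_funB.
Qed.

(** Where 1/4 - 3 s^2 is positive, [deform' x] is at least 1 and may be dropped on the right. There
    [deform] stretches s by a factor at most 17/16, and 2 (17/16)^2 <= 3. Elsewhere the left side is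
    at most 0. *)
Lemma deform'_parabola x : deform' tau c x - 1 <= tau * (deform' tau c x * parabola (deform tau c x)).
Proof.
have [t0 t1] := andP tau01.
have T'0 := deform'_gt0 c tau01 x; have v0 := parabola_ge0 (deform tau c x).
have Tv : 0 <= tau * (deform' tau c x * parabola (deform tau c x)).
  by apply: mulr_ge0; [exact: ltW|apply: mulr_ge0 => //; exact: ltW].
have [xJ|xJ] := boolP (l < x <= r); last by rewrite (deform'_out _ xJ) in Tv *; rewrite subrr.
have e : deform' tau c x - 1 = tau * (4^-1 - 3 * (x - c) ^+ 2) by rewrite deform'_in//; ring.
have [p0|p0] := leP (4^-1 - 3 * (x - c) ^+ 2) 0.
  by rewrite e; apply: le_trans Tv; rewrite pmulr_rle0.
rewrite e ler_pM2l//.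
have T1 : 1 <= deform' tau c x by rewrite -subr_ge0 e mulr_ge0 ?ltW.
apply: (@le_trans _ _ (parabola (deform tau c x))); last by rewrite ler_peMl.
apply: (@le_trans _ _ (2^-1 - 2 * (deform tau c x - c) ^+ 2)); last first.
  by rewrite le_max lexx orbT.
have -> : deform tau c x - c = (x - c) * (1 + tau * (4^-1 - (x - c) ^+ 2)).
  rewrite /deform cutoff_cubic_in; last by move/andP: xJ => [/ltW -> ->].
  by rewrite /cubic; field.
rewrite exprMn.
have s0 := sqr_ge0 (x - c); move: p0 s0; move: ((x - c) ^+ 2) => s p0 s0.
have k1 : 0 <= 1 + tau * (4^-1 - s) by nra.
have k2 : 1 + tau * (4^-1 - s) <= 17 / 16 by nra.
have k3 : (1 + tau * (4^-1 - s)) ^+ 2 <= (17 / 16) ^+ 2 by rewrite lerXn2r ?nnegrE//; lra.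
by nra.
Qed.

(** By convexity the remainder of the first-order expansion at a is at most (e^b - e^a)(b - a), and
    convexity once more bounds e^b - e^a by e^M times b - a, up to the common sign. *)
Lemma expR_second_order (a b : R) : 0 <= a <= M -> 0 <= b <= M ->
  expR b - expR a - expR M * (b - a) ^+ 2 <= expR a * (b - a).
Proof.
move=> /andP[a0 aM] /andP[b0 bM].
have cvx (x y : R) : expR x - expR y <= expR x * (x - y).
  have := expR_ge1Dx (y - x); rewrite expRD expRN => h.
  have ex := expR_gt0 x; have := ler_wpM2l (ltW ex) h.
  by rewrite mulrCA divff ?gt_eqF// mulr1 => k; lra.
have h1 := cvx b a; have h2 := cvx a b.
have eM : expR a <= expR M by rewrite ler_expR.
have eMb : expR b <= expR M by rewrite ler_expR.
have ea := expR_gt0 a; have eb := expR_gt0 b.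
have h3 : (expR b - expR a) * (b - a) <= expR M * (b - a) ^+ 2.
  have [ab|/ltW ba] := leP a b.
    have d0 : 0 <= b - a by rewrite subr_ge0.
    rewrite [leRHS](_ : _ = (expR M * (b - a)) * (b - a)); last by ring.
    apply: ler_wpM2r => //; apply: le_trans h1 _; exact: ler_wpM2r.
  have d0 : 0 <= a - b by rewrite subr_ge0.
  rewrite (_ : _ * (b - a) = (expR a - expR b) * (a - b)); last by ring.
  rewrite [leRHS](_ : _ = (expR M * (a - b)) * (a - b)); last by ring.
  apply: ler_wpM2r => //; apply: le_trans h2 _; exact: ler_wpM2r.
by lra.
Qed.

Local Notation aJ := (\int[mu]_(x in J) w x).
Local Notation aJ' := (\int[mu]_(x in A `\` J) w x).

Let EJ := energy_deform tau01 mA muA JA Aout Afar mu_ u0M uA Eu.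
Let iU := EJ.1.
Let iW := EJ.2.1.

Let M0 : 0 <= M. Proof. by have := u0M 0; lra. Qed.
Let mw : measurable_fun [set: R] w.
Proof. exact: (measurableT_comp mu_ (measurable_deform tau c)). Qed.
Let wA x : ~ A x -> w x = 0.
Proof. by move=> Ax; rewrite (@comp_deform_out R tau c tau01 A JA u uA). Qed.

Let bnd_int (h : R -> R) K : measurable_fun [set: R] h -> (forall x, A x -> `|h x| <= K) ->
  mu.-integrable A (EFin \o h).
Proof.
move=> mh hK; apply: (@integrable_bounded _ _ _ _ _ _ K).
- exact: mA.
- exact: muA.
- exact: measurable_funTS.
- exact: hK.
Qed.

(** The weak equation is tested with [w] and with [u] and the results are subtracted. The mixed form
    is at most half the sum of the two energies, which turns 2 pi into 4 pi. *)
Lemma form_deform_le :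
  eps * \int[mu]_(x in A) (expR (u x) * (w x - u x)) <= (4 * pi)^-1 * (energy w - energy u).
Proof.
have aeA (v : R -> R) : (forall x, ~ A x -> v x = 0) -> {ae mu, forall x : R, ~ A x -> v x = 0}.
  by move=> vA; exact: aeW.
have Hw : H_half w.
  apply: (H_half_bounded_support (M := M) mA muA mw _ wA); first last.
    by apply: integrable_lty => //.
  by move=> x; have /andP[h1 h2] := u0M (deform tau c x); rewrite ger0_norm.
have Hu : H_half u.
  apply: (H_half_bounded_support (M := M) mA muA mu_ _ uA) => //.
  by move=> x; have /andP[h1 h2] := u0M x; rewrite ger0_norm.
have := weak Hw (aeA _ wA); have := weak Hu (aeA _ uA).
have eu x : `|expR (u x)| <= expR M.
  by rewrite ger0_norm ?expR_ge0// ler_expR; have /andP[] := u0M x.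
have mexp : measurable_fun [set: R] (fun x => expR (u x)) by exact: measurableT_comp.
have iexp (v : R -> R) : measurable_fun [set: R] v -> (forall x, 0 <= v x <= M) ->
    mu.-integrable A (EFin \o (fun x => expR (u x) * v x)).
  move=> mv v0M; apply: (@bnd_int _ (expR M * M)); first exact: measurable_funM.
  move=> x _; rewrite normrM; apply: ler_pM => //.
  by have /andP[v0 vM] := v0M x; rewrite ger0_norm.
have -> : \int[mu]_(x in A) (expR (u x) * (w x - u x)) =
  \int[mu]_(x in A) (expR (u x) * w x) - \int[mu]_(x in A) (expR (u x) * u x).
  rewrite -RintegralB; last 3 first.
  - exact: mA.
  - exact: (iexp _ mw (fun x => u0M _)).
  - exact: (iexp _ mu_ u0M).
  by apply: eq_Rintegral => x _; rewrite mulrBr.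
rewrite mulrBr => <- <-; rewrite /half_laplacian_form -mulrBr.
have -> : \int[mu2]_p ((u p.1 - u p.2) * (u p.1 - u p.2) / (p.1 - p.2) ^+ 2) = energy u.
  by apply: eq_Rintegral => p _; rewrite /quot_sqr expr_div_n expr2.
have iUW := integrable_scale 2^-1 measurableT (integrable_add measurableT iU iW).
have pi0 := pi_gt0 R.
have e4 (q e1 e2 : R) : 0 < q -> (4 * q)^-1 * (e1 - e2) = (2 * q)^-1 * (2^-1 * (e2 + e1) - e2).
  by move=> q0; field; rewrite gt_eqF.
rewrite (e4 _ _ _ pi0).
rewrite ler_pM2l ?invr_gt0 ?mulr_gt0// lerD2r /energy -RintegralD// -RintegralZl//; last first.
  exact: (integrable_add measurableT iU iW).
apply: le_Rintegral => //.
- apply: (integrable_dominated _ _ iUW) => //.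
    apply: measurable_funM; last by apply: measurable_funV; apply: measurable_funX; exact: measurable_funB.
    apply: measurable_funM; apply: measurable_funB;
      [exact: measurable_fst_comp|exact: measurable_snd_comp|exact: measurable_fst_comp|exact: measurable_snd_comp].
  move=> p _; rewrite /quot_sqr !expr_div_n -mulrDl mulrA normrM.
  rewrite (ger0_norm (_ : 0 <= ((p.1 - p.2) ^+ 2)^-1)) ?invr_ge0 ?sqr_ge0// ler_wpM2r ?invr_ge0 ?sqr_ge0//.
  rewrite ler_norml; have := sqr_ge0 ((u p.1 - u p.2) + (w p.1 - w p.2)).
  by have := sqr_ge0 ((u p.1 - u p.2) - (w p.1 - w p.2)); lra.
- move=> p _; rewrite /quot_sqr !expr_div_n -mulrDl mulrA ler_wpM2r ?invr_ge0 ?sqr_ge0//.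
  by have := sqr_ge0 ((u p.1 - u p.2) - (w p.1 - w p.2)); lra.
Qed.

Lemma Rintegral_deform (B : set R) (h : R -> R) : measurable B ->
  (forall x, B x <-> B (deform tau c x)) ->
  measurable_fun [set: R] h -> (forall x, 0 <= h x) ->
  \int[mu]_(x in B) h x = \int[mu]_(x in B) (h (deform tau c x) * deform' tau c x).
Proof.
move=> mB BT mh h0; rewrite /Rintegral; congr fine.
rewrite integral_mkcond -(ge0_integral_deform c tau01); last 2 first.
- apply/(measurable_restrictT _ _).1; first exact: mB.
  by apply/measurable_EFinP; exact: measurable_funTS.
- by apply: erestrict_ge0 => x _; rewrite lee_fin.
rewrite [RHS]integral_mkcond; apply: eq_integral => x _; rewrite !patchE.
have -> : (deform tau c x \in B) = (x \in B).
  by apply/idP/idP; rewrite !inE => Bx; apply/(BT x).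
by case: ifP => _; rewrite ?mul0e.
Qed.

Let J_deform x : J x <-> J (deform tau c x).
Proof.
split; first exact: deform_in.
by have [//|Jx] := pselect (J x); rewrite deform_out.
Qed.

Lemma mass_deform :
  \int[mu]_(x in J) u x <= (1 + tau / 4) * aJ /\ aJ' = \int[mu]_(x in A `\` J) u x.
Proof.
split; last first.
  by apply: eq_Rintegral => x; rewrite inE => -[Ax Jx] /=; rewrite deform_out.
rewrite (@Rintegral_deform J)//; last by move=> x; have /andP[] := u0M x.
have ib (h : R -> R) K : measurable_fun [set: R] h -> (forall x, `|h x| <= K) ->
    mu.-integrable J (EFin \o h).
  move=> mh hK; apply: (@integrable_bounded _ _ _ _ _ _ K) => //.
  - by rewrite /= lebesgue_measure_itv/=; case: ifP => _; rewrite ltry.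
  - exact: measurable_funTS.
rewrite -RintegralZl//; last first.
  by apply: (ib _ M mw) => x; have /andP[h1 h2] := u0M (deform tau c x); rewrite ger0_norm.
apply: le_Rintegral => //.
- apply: (ib _ (M * 2)); first by apply: measurable_funM; [exact: mw|exact: measurable_deform'].
  have [t0 t1] := andP tau01.
  move=> x; have /andP[h1 h2] := u0M (deform tau c x); rewrite normrM ger0_norm//.
  apply: ler_pM => //; rewrite ger0_norm ?ltW ?deform'_gt0//.
  by have := deform'_le c tau01 x; lra.
- apply: (ib _ ((1 + tau / 4) * M)); first exact: measurable_funM.
  have [t0 t1] := andP tau01.
  move=> x; have /andP[h1 h2] := u0M (deform tau c x); rewrite normrM.
  by rewrite (ger0_norm (_ : 0 <= 1 + tau / 4)) ?ler_wpM2l ?ger0_norm//; lra.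
- move=> x _; rewrite mulrC ler_wpM2r//; last exact: deform'_le.
  by have /andP[] := u0M (deform tau c x).
Qed.

(** The change of variables writes the integral of e^u as that of e^w times [deform']. So passing
    from u to w loses at most tau times the integral of e^u times the parabola, by
    [deform'_parabola]. This loss bounds the left side of [form_deform_le] from below, up to the
    second-order error, while [energy_deform] bounds its right side from above; division by [tau]
    gives the claim. *)
Lemma deform_inequality :
  (4 * pi)^-1 * (aJ ^+ 2 - aJ * aJ' / 10) <=
  eps * \int[mu]_(x in A) (expR (u x) * parabola x) +
  eps * expR M / tau * \int[mu]_(x in A) (w x - u x) ^+ 2.
Proof.
have [t0 t1] := andP tau01.
have wM x := u0M (deform tau c x).
have mexp (h : R -> R) : measurable_fun [set: R] h -> measurable_fun [set: R] (fun x => expR (h x)).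
  by move=> mh; exact: measurableT_comp.
have eb (h : R -> R) : (forall x, 0 <= h x <= M) -> forall x, `|expR (h x)| <= expR M.
  by move=> hM x; rewrite ger0_norm ?expR_ge0// ler_expR; have /andP[] := hM x.
have mT' := measurable_deform' tau c.
have T'2 x : `|deform' tau c x| <= 2.
  by rewrite ger0_norm ?ltW ?deform'_gt0//; have := deform'_le c tau01 x; lra.
have d2 : measurable_fun [set: R] (fun x => (w x - u x) ^+ 2).
  by apply: measurable_funX; exact: measurable_funB.
have dM x : `|w x - u x| <= M.
  by have := u0M x; have := wM x; rewrite /= ler_norml => ? ?; apply/andP; split; lra.
have i_eu : mu.-integrable A (EFin \o (fun x => expR (u x))).
  by apply: bnd_int (mexp _ mu_) (fun x _ => eb _ u0M x).
have i_ew : mu.-integrable A (EFin \o (fun x => expR (w x))).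
  by apply: bnd_int (mexp _ mw) (fun x _ => eb w wM x).
have i_ewT : mu.-integrable A (EFin \o (fun x => expR (w x) * deform' tau c x)).
  apply: (@bnd_int _ (expR M * 2)); first by apply: measurable_funM => //; exact: mexp.
  by move=> x _; rewrite normrM; apply: ler_pM => //; exact: (eb w wM).
have i_ewTv : mu.-integrable A (EFin \o (fun x => expR (w x) * parabola (deform tau c x) * deform' tau c x)).
  apply: (@bnd_int _ (expR M * 2^-1 * 2)).
    apply: measurable_funM => //; apply: measurable_funM; first exact: mexp.
    by apply: (measurableT_comp measurable_parabola); exact: measurable_deform.
  move=> x _; rewrite normrM; apply: ler_pM => //; rewrite normrM.
  apply: ler_pM => //; first exact: (eb w wM).
  by rewrite ger0_norm ?parabola_ge0// parabola_le.
have i_d2 : mu.-integrable A (EFin \o (fun x => (w x - u x) ^+ 2)).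
  apply: (@bnd_int _ (M ^+ 2)) => // x _.
  by rewrite normrX lerXn2r ?nnegrE.
have i_d1 : mu.-integrable A (EFin \o (fun x => expR (u x) * (w x - u x))).
  apply: (@bnd_int _ (expR M * M)).
    by apply: measurable_funM; [exact: mexp|exact: measurable_funB].
  by move=> x _; rewrite normrM; apply: ler_pM => //; exact: (eb u u0M).
have AT := @deform_stable R tau c tau01 A JA.
have e1 : \int[mu]_(x in A) expR (u x) = \int[mu]_(x in A) (expR (w x) * deform' tau c x).
  exact: (Rintegral_deform mA AT (mexp _ mu_) (fun x => expR_ge0 _)).
have e2 : \int[mu]_(x in A) (expR (u x) * parabola x) =
   \int[mu]_(x in A) (expR (w x) * parabola (deform tau c x) * deform' tau c x).
  apply: (Rintegral_deform mA AT (h := fun x => expR (u x) * parabola x)).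
    by apply: measurable_funM; [exact: mexp|exact: measurable_parabola].
  by move=> x; rewrite mulr_ge0 ?expR_ge0 ?parabola_ge0.
have s1 : \int[mu]_(x in A) (expR (w x) * deform' tau c x) - \int[mu]_(x in A) expR (w x) <=
   tau * \int[mu]_(x in A) (expR (w x) * parabola (deform tau c x) * deform' tau c x).
  rewrite -RintegralB// -RintegralZl//; apply: le_Rintegral => //.
  - exact: integrable_sub.
  - exact: integrable_scale.
  - move=> x _; have := deform'_parabola x; have ew := expR_gt0 (w x).
    by move=> /(ler_wpM2l (ltW ew)); rewrite mulrBr mulr1 => h; apply: le_trans h _; rewrite le_eqVlt; apply/orP; left; apply/eqP; ring.
have s2 : \int[mu]_(x in A) expR (w x) - \int[mu]_(x in A) expR (u x) -
    expR M * \int[mu]_(x in A) (w x - u x) ^+ 2 <= \int[mu]_(x in A) (expR (u x) * (w x - u x)).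
  rewrite -RintegralB// -RintegralZl// -RintegralB//; last 2 first.
  - exact: integrable_sub.
  - exact: integrable_scale.
  apply: le_Rintegral => //.
    apply: integrable_sub; first exact: mA.
      by apply: integrable_sub; [exact: mA|exact: i_ew|exact: i_eu].
    by apply: integrable_scale; [exact: mA|exact: i_d2].
  by move=> x _; exact: (expR_second_order (u0M x) (wM x)).
have s3 := form_deform_le.
have [_ [_ s4]] := EJ.
have pi0 : 0 < (4 * pi)^-1 :> R by rewrite invr_gt0 mulr_gt0// pi_gt0.
rewrite e2; move: e1 s1 s2 s3 s4 pi0.
set Y := \int[mu]_(x in A) expR (u x).
set X1 := \int[mu]_(x in A) (expR (w x) * _); set X2 := \int[mu]_(x in A) expR (w x).
set X3 := \int[mu]_(x in A) (_ * _ * _); set X4 := \int[mu]_(x in A) (_ ^+ 2).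
set X5 := \int[mu]_(x in A) (expR (u x) * _).
clearbody Y X1 X2 X3 X4 X5; move: (expR M) (energy w) (energy u) aJ aJ' ((4 * pi)^-1).
move=> eM ew eu a a' q -> s1 s2 s3 s4 q0.
rewrite -(ler_pM2l t0).
have -> : tau * (eps * X3 + eps * eM / tau * X4) = eps * (tau * X3 + eM * X4).
  by field; rewrite gt_eqF.
have h1 : eps * (- (tau * X3 + eM * X4)) <= eps * X5 by rewrite ler_pM2l//; lra.
have h2 : q * (ew - eu) <= q * (- (tau * (a ^+ 2 - a * a' / 10))).
  by rewrite ler_pM2l//; lra.
lra.
Qed.

End variation.

(** * Smallness of the deformation defect for some parameter *)

Section defect.
Context (R : realType).
Local Notation mu := (@lebesgue_measure R).
Local Notation mu2 := (mu \x mu)%E.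

Lemma integral_inv (a b : R) : 0 < a -> a < b ->
  (\int[mu]_(t in `[a, b]) (t^-1)%:E = (ln b - ln a)%:E)%E.
Proof.
move=> a0 ab.
have dl (t : R) : 0 < t -> is_derive t (1 : R) (@ln R) t^-1 by move=> t0; exact: is_derive1_ln.
have cl (t : R) : 0 < t -> {for t, continuous (@ln R)} by move=> t0; exact: continuous_ln.
rewrite (@continuous_FTC2 _ (@GRing.inv R) (@ln R))//.
- apply: continuous_in_subspaceT => t; rewrite inE/= in_itv/= => /andP[at_ _].
  by apply: inv_continuous; rewrite gt_eqF// (lt_le_trans a0).
- split.
  + by move=> t; rewrite in_itv/= => /andP[at_ _]; have [] := dl t (lt_trans a0 at_).
  + by apply: cvg_at_right_filter; exact: cl.
  + by apply: cvg_at_left_filter; apply: cl; exact: lt_trans ab.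
- move=> t; rewrite in_itv/= => /andP[at_ _]; rewrite derive1E.
  by have [_ ->] := dl t (lt_trans a0 at_).
Qed.

Variables (u : R -> R) (c : R).
Hypothesis mu_ : measurable_fun [set: R] u.
Hypothesis Eu : (\int[mu2]_p (quot_sqr u p)%:E < +oo)%E.

Local Notation phi := (cutoff_cubic c).

(** At (x, t) with t and [phi x] nonzero this is ((u (x + t phi(x)) - u x)/t)^2. The factored form
    shows the energy density of [u] sampled along y = x + t phi(x), ready for a substitution in
    t. *)
Let G (p : R * R) : R := phi p.1 ^+ 2 * quot_sqr u (p.1, p.1 + p.2 * phi p.1).

Let mphi : measurable_fun [set: R] phi.
Proof. by apply: continuous_measurable_fun; exact: continuous_cutoff_cubic. Qed.

Let mG : measurable_fun [set: R * R] (fun p => (G p)%:E).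
Proof.
apply/measurable_EFinP; apply: measurable_funM.
  by apply: measurable_funX; exact: measurable_fst_comp.
apply: (measurableT_comp (measurable_quot_sqr mu_)).
apply: measurable_fun_pair => //; apply: measurable_funD => //.
by apply: measurable_funM => //; exact: measurable_fst_comp.
Qed.

Let G0 p : (0 <= (G p)%:E)%E.
Proof. by rewrite lee_fin mulr_ge0 ?sqr_ge0. Qed.

Let mGF : measurable_fun [set: R] (fun x => \int[mu]_t (G (x, t))%:E)%E.
Proof.
apply: (measurable_fun_fubini_tonelli_F (m2 := mu) (T1 := measurableTypeR R) (fun p => (G p)%:E)).
  exact: mG.
exact: G0.
Qed.

Let mGG : measurable_fun [set: R] (fun t => \int[mu]_x (G (x, t))%:E)%E.
Proof.
apply: (measurable_fun_fubini_tonelli_G (m1 := mu) (T2 := measurableTypeR R) (fun p => (G p)%:E)).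
  exact: mG.
exact: G0.
Qed.

Let mQF : measurable_fun [set: R] (fun x => \int[mu]_y (quot_sqr u (x, y))%:E)%E.
Proof.
apply: (measurable_fun_fubini_tonelli_F (m2 := mu) (T1 := measurableTypeR R) (fun p => (quot_sqr u p)%:E)).
  by apply/measurable_EFinP; exact: measurable_quot_sqr.
by move=> p; rewrite lee_fin sqr_ge0.
Qed.

(** The substitution y = x + t phi(x) turns phi(x)^2 dt into |phi(x)| dy, and |phi(x)| <= 1/8. A
    negative phi(x) is reduced to a positive one by reflecting t. *)
Let inner x : (\int[mu]_t (G (x, t))%:E <= \int[mu]_y (quot_sqr u (x, y))%:E)%E.
Proof.
pose f y := (quot_sqr u (x, y))%:E.
have mf : measurable_fun [set: R] f.
  apply/measurable_EFinP; exact: (measurableT_comp (measurable_quot_sqr mu_) (pair1_measurable x)).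
have f0 y : (0 <= f y)%E by rewrite lee_fin sqr_ge0.
have key (a : R) : 0 < a <= 8^-1 -> (\int[mu]_t ((a ^+ 2)%:E * f (a * t + x)%R) <= \int[mu]_y f y)%E.
  move=> /andP[a0 a8].
  have maf : measurable_fun [set: R] (fun t => f (a * t + x)%R * a%:E)%E.
    apply: emeasurable_funM => //; apply: measurableT_comp => //.
    by apply: measurable_funD => //; exact: measurable_funM.
  rewrite (eq_integral (fun t : measurableTypeR R => (a%:E * (f (a * t + x)%R * a%:E))%E)); last first.
    by move=> t _; rewrite expr2 EFinM -muleA (muleC (f _)).
  rewrite ge0_integralZl//; last 2 first.
  - by move=> t _; rewrite mule_ge0// lee_fin ltW.
  - by rewrite lee_fin ltW.
  rewrite ge0_integral_affine// -[leRHS]mul1e lee_wpmul2r ?lee_fin//.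
    by apply: integral_ge0 => y _; exact: f0.
  by lra.
have phi8 : `|phi x| <= 8^-1 by exact: cutoff_cubic_bound.
have [p0|p0|p0] := ltgtP (phi x) 0.
- have e : (\int[mu]_t (G (x, t))%:E = \int[mu]_t (((- phi x) ^+ 2)%:E * f (- phi x * t + x)%R))%E.
    rewrite -(@ge0_integral_opp _ (fun t => (G (x, t))%:E)).
    + by apply: eq_integral => t _; rewrite /G/= sqrrN -EFinM /f; congr ((_ * quot_sqr u (_, _))%:E); ring.
    + exact: (measurableT_comp mG (pair1_measurable x)).
    + by move=> t; exact: G0.
  rewrite e; apply: key.
  by move: phi8; rewrite ler_norml => ?; apply/andP; split; lra.
- rewrite (eq_integral (fun t : measurableTypeR R => ((phi x ^+ 2)%:E * f (phi x * t + x)%R)%E)).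
    by apply: key; move: phi8; rewrite ler_norml => ?; apply/andP; split; lra.
  by move=> t _; rewrite /G/= -EFinM /f; congr ((_ * quot_sqr u (_, _))%:E); ring.
- rewrite integral0_eq; first by apply: integral_ge0 => y _; exact: f0.
  by move=> t _; rewrite /G/= p0 expr0n/= mul0r.
Qed.

(* Otherwise the defect divided by [tau ^+ 2] would be at least [eta / tau], which is not
   integrable near 0; but its integral over [tau] is at most the energy, by the
   substitution [y = x + tau * cutoff_cubic c x] for fixed [x]. *)
Lemma deform_defect_small (eta : R) : 0 < eta -> exists2 tau : R, 0 < tau <= 4^-1 &
  (\int[mu]_x (((u \o deform tau c) x - u x) ^+ 2)%:E <= (eta * tau)%:E)%E.
Proof.
move=> eta0; apply: contrapT => /forall2NP h.
have big (tau : R) : 0 < tau <= 4^-1 -> ((eta / tau)%:E <= \int[mu]_x (G (x, tau))%:E)%E.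
  move=> t01; have [t0 t1] := andP t01.
  have [//|/negP] := h tau; rewrite -ltNge => hN.
  have -> : (eta / tau)%:E = ((tau ^- 2)%:E * (eta * tau)%:E)%E.
    by rewrite -EFinM; congr EFin; field; rewrite gt_eqF.
  apply: (@le_trans _ _ ((tau ^- 2)%:E * \int[mu]_x (((u \o deform tau c) x - u x) ^+ 2)%:E)%E).
    by apply: lee_wpmul2l (ltW hN); rewrite lee_fin invr_ge0 sqr_ge0.
  rewrite -ge0_integralZl//; last 3 first.
  - apply/measurable_EFinP; apply: measurable_funX; apply: measurable_funB => //.
    by apply: (measurableT_comp mu_); exact: measurable_deform.
  - by move=> x _; rewrite lee_fin sqr_ge0.
  - by rewrite lee_fin invr_ge0 sqr_ge0.
  rewrite le_eqVlt; apply/orP; left; apply/eqP; apply: eq_integral => x _.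
  rewrite -EFinM /G /quot_sqr /= /deform; congr EFin.
  have [->|p0] := eqVneq (phi x) 0; first by rewrite mulr0 addr0 !subrr expr0n/= mul0r mulr0.
  have -> : x - (x + tau * phi x) = - (tau * phi x) by ring.
  by field; rewrite p0 gt_eqF.
have fin : (\int[mu]_t \int[mu]_x (G (x, t))%:E <= \int[mu2]_p (quot_sqr u p)%:E)%E.
  have -> : (\int[mu]_t \int[mu]_x (G (x, t))%:E = \int[mu]_x \int[mu]_t (G (x, t))%:E)%E.
    by symmetry; apply: (@fubini_tonelli _ _ _ _ _ mu mu (fun p => (G p)%:E)).
  rewrite fubini_tonelli1//; last 2 first.
  - by apply/measurable_EFinP; exact: measurable_quot_sqr.
  - by move=> p; rewrite lee_fin sqr_ge0.
  apply: ge0_le_integral; [by []| | | |].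
  - by move=> x _; apply: integral_ge0 => t _; exact: G0.
  - exact: mGF.
  - exact: mQF.
  - by move=> x _; exact: inner.
have [K K0 EK] : exists2 K : R, 0 <= K & (\int[mu2]_p (quot_sqr u p)%:E)%E = K%:E.
  have e0 : (0 <= \int[mu2]_p (quot_sqr u p)%:E)%E by apply: integral_ge0 => p _; rewrite lee_fin sqr_ge0.
  exists (fine (\int[mu2]_p (quot_sqr u p)%:E)%E); first exact: fine_ge0.
  by rewrite fineK// ge0_fin_numE.
rewrite EK in fin.
(* For this [a] the integral of eta/t over [a, 1/4] is exactly K + 1, one more than the energy
   allows. *)
pose a := expR (ln 4^-1 - (K + 1) / eta).
have a0 : 0 < a by exact: expR_gt0.
have a4 : a < 4^-1.
  by rewrite -ltr_ln ?posrE// expRK gtrBl divr_gt0//; lra.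
suff : ((K + 1)%:E <= K%:E :> \bar R)%E by rewrite lee_fin; lra.
apply: le_trans fin.
have -> : (K + 1)%:E = (\int[mu]_(t in `[a, 4^-1%R]) (eta%:E * (t^-1)%:E))%E.
  rewrite ge0_integralZl//; last 3 first.
  - by apply/measurable_EFinP; apply: measurable_funTS; exact: measurable_inv.
  - by move=> t; rewrite /= in_itv/= => /andP[at_ _]; rewrite lee_fin invr_ge0 (le_trans (ltW a0)).
  - by rewrite lee_fin ltW.
  rewrite integral_inv// -EFinM /a expRK; congr EFin.
  by rewrite opprB addrCA subrr addr0; field; rewrite gt_eqF.
apply: (@le_trans _ _ (\int[mu]_(t in `[a, 4^-1%R]) \int[mu]_x (G (x, t))%:E)%E).
  apply: ge0_le_integral => //.
  - move=> t; rewrite /= in_itv/= => /andP[at_ _].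
    have t0 := lt_le_trans a0 at_.
    by rewrite mule_ge0// lee_fin ?invr_ge0 ltW.
  - by apply: emeasurable_funM => //; apply/measurable_EFinP; apply: measurable_funTS; exact: measurable_inv.
  - exact: (measurable_funTS mGG).
  - move=> t; rewrite /= in_itv/= => /andP[at_ t4]; rewrite -EFinM; apply: big.
    by rewrite t4 (lt_le_trans a0).
apply: ge0_subset_integral; [by []|by []|exact: (measurable_funTS mGG)| |by []].
by move=> t _; apply: integral_ge0 => x _; exact: G0.
Qed.

End defect.

(** * Symmetry and kernel integrability on the plane *)

Section product_tools2.
Context (R : realType).
Local Notation mu := (@lebesgue_measure R).
Local Notation mu2 := (mu \x mu)%E.

Lemma integrable_swap (f : R * R -> R) : measurable_fun [set: R * R] f ->
  mu2.-integrable [set: R * R] (EFin \o f) ->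
  mu2.-integrable [set: R * R] (EFin \o (fun p => f (p.2, p.1))) /\
  \int[mu2]_p f (p.2, p.1) = \int[mu2]_p f p.
Proof.
move=> mf fi.
have mfs : measurable_fun [set: R * R] (fun p => f (p.2, p.1)).
  by apply: (measurableT_comp mf); apply: measurable_fun_pair.
have fis : mu2.-integrable [set: R * R] (EFin \o (fun p => f (p.2, p.1))).
  apply/integrable12ltyP; first exact/measurable_EFinP.
  have /integrable21ltyP h := fi; apply: h.
  exact/measurable_EFinP.
split=> //.
by rewrite /Rintegral -(integral12_prod_meas1 fis) -(integral21_prod_meas1 fi).
Qed.

Lemma integrable_kernel (a : R -> R) (k : R * R -> R) (K : R) :
  measurable_fun [set: R] a -> (forall x, 0 <= a x) -> mu.-integrable [set: R] (EFin \o a) ->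
  measurable_fun [set: R * R] k -> (forall p, 0 <= k p) ->
  (forall x, (\int[mu]_y (k (x, y))%:E <= K%:E)%E) ->
  mu2.-integrable [set: R * R] (EFin \o (fun p => a p.1 * k p)).
Proof.
move=> ma a0 ai mk k0 kK.
have mak : measurable_fun [set: R * R] (fun p => a p.1 * k p).
  by apply: measurable_funM => //; exact: measurable_fst_comp.
apply: ge0_integrable; [by []|exact: mak| |].
  by move=> p _; exact: mulr_ge0.
rewrite fubini_tonelli1; last 2 first.
- exact/measurable_EFinP.
- by move=> p; rewrite lee_fin mulr_ge0.
have mkx x : measurable_fun [set: R] (fun y => (k (x, y))%:E).
  by apply/measurable_EFinP; exact: (measurableT_comp mk (pair1_measurable x)).
apply: (@le_lt_trans _ _ (\int[mu]_x ((a x)%:E * K%:E))%E).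
  apply: ge0_le_integral; [by []| | | |].
  - by move=> x _; apply: integral_ge0 => y _; rewrite lee_fin mulr_ge0.
  - apply: (measurable_fun_fubini_tonelli_F (m2 := mu) (T1 := measurableTypeR R) (fun p => (a p.1 * k p)%:E)).
      exact/measurable_EFinP.
    by move=> p; rewrite lee_fin mulr_ge0.
  - by apply: emeasurable_funM => //; exact/measurable_EFinP.
  move=> x _; rewrite /fubini_F/=.
  rewrite (eq_integral (fun y : measurableTypeR R => ((a x)%:E * (k (x, y))%:E)%E)); last first.
    by move=> y _; rewrite EFinM.
  rewrite ge0_integralZl//; last 3 first.
  - exact: mkx.
  - by move=> y _; rewrite lee_fin.
  - by rewrite lee_fin.
  by apply: lee_wpmul2l; rewrite ?lee_fin.
rewrite integralZr//= ltey_eq fin_numM//.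
exact: integrable_fin_num.
Qed.

Lemma Rintegral_odd (x : R) (f : R -> R) : measurable_fun [set: R] f ->
  mu.-integrable [set: R] (EFin \o f) -> (forall y, f (2 * x - y) = - f y) ->
  \int[mu]_y f y = 0.
Proof.
move=> mf fi fodd; rewrite /Rintegral integralE.
have mp : measurable_fun [set: R] ((EFin \o f)^\+)%E by apply: measurable_funepos; exact/measurable_EFinP.
pose g := ((EFin \o f)^\+)%E.
have g0 y : (0 <= g y)%E by rewrite /g funepos_ge0.
have e : (\int[mu]_y g (- y + 2 * x)%R = \int[mu]_y g y)%E.
  rewrite -[RHS](@ge0_integral_shift _ (2 * x))//.
  apply: (@ge0_integral_opp _ (fun y => g (y + 2 * x)%R)) => //.
  by apply: (measurableT_comp mp); exact: measurable_funD.
have -> : (\int[mu]_y (EFin \o f)^\- y = \int[mu]_y g y)%E.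
  rewrite -e; apply: eq_integral => y _.
  by rewrite /g funeposE funenegE /= (addrC (- y)) fodd EFinN.
rewrite subee//.
exact: (integrable_pos_fin_num _ fi).
Qed.

End product_tools2.

(** * The parabola has finite energy *)

Section test_function.
Context (R : realType).
Local Notation mu := (@lebesgue_measure R).
Local Notation mu2 := (mu \x mu)%E.
Variable c : R.
Local Notation l := (c - 2^-1).
Local Notation r := (c + 2^-1).
Local Notation J := (`]l, r[%classic).
Local Notation v := (parabola c).

Lemma parabola_clamp x : v x = 2^-1 - 2 * (clamp c x - c) ^+ 2.
Proof.
have [Jx|Jx] := pselect (J x).
  move: Jx; rewrite /= in_itv/= => /andP[lx xr].
  rewrite clamp_id ?ltW//; apply/max_idPr; rewrite subr_ge0; nra.
rewrite parabola_out//.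
move: Jx; rewrite /= in_itv/= => /negP; rewrite negb_and -!leNgt => /orP[h|h].
  by rewrite clamp_le//; field.
by rewrite clamp_ge//; field.
Qed.

Lemma parabola_lip x y : `|v x - v y| <= 2 * `|x - y|.
Proof.
wlog xy : x y / x <= y.
  move=> h; have [/h//|/ltW yx] := leP x y.
  by rewrite distrC (distrC x); exact: h.
rewrite !parabola_clamp.
have := clamp_lip c xy; have := clamp_itv c x; have := clamp_itv c y.
have -> : 2^-1 - 2 * (clamp c x - c) ^+ 2 - (2^-1 - 2 * (clamp c y - c) ^+ 2) =
   2 * ((clamp c y - clamp c x) * ((clamp c x - c) + (clamp c y - c))) by ring.
rewrite normrM (ger0_norm (ltac:(lra) : 0 <= 2 :> R)) ler_pM2l// normrM => hy hx hl.
rewrite -[leRHS]mulr1 distrC (distrC x); apply: ler_pM => //.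
  by rewrite distrC !ger0_norm//; lra.
by rewrite ler_norml; lra.
Qed.

Definition trunc_ker (rho : R) (p : R * R) : R :=
  if rho < `|p.1 - p.2| then (p.1 - p.2) ^- 2 else 0.

Lemma trunc_ker_ge0 rho p : 0 <= trunc_ker rho p.
Proof. by rewrite /trunc_ker; case: ifP => // _; rewrite invr_ge0 sqr_ge0. Qed.

Let mdist rho : measurable_fun [set: R * R] (fun p : R * R => rho < `|p.1 - p.2|).
Proof.
apply: measurable_fun_ltr => //.
by apply: measurableT_comp => //; exact: measurable_funB.
Qed.

Lemma measurable_trunc_ker rho : measurable_fun [set: R * R] (trunc_ker rho).
Proof. by apply: measurable_fun_ifT => //; exact: measurable_inv_sqr_sub. Qed.

Lemma integral_trunc_ker rho x : 0 < rho ->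
  (\int[mu]_y (trunc_ker rho (x, y))%:E = (2 / rho)%:E)%E.
Proof.
move=> r0; rewrite -(integral_invsqr_shift x r0) [RHS]integral_mkcond.
apply: eq_integral => y _; rewrite patchE /trunc_ker/= distrC.
have -> : (y \in [set y | rho < `|y - x|]) = (rho < `|y - x|) by apply/idP/idP; rewrite inE.
by case: ifP.
Qed.

Definition unit_band (p : R * R) : R := if 1 < `|p.1 - p.2| then 0 else 1.

Lemma measurable_unit_band : measurable_fun [set: R * R] unit_band.
Proof. by apply: measurable_fun_ifT. Qed.

Lemma integral_unit_band x : (\int[mu]_y (unit_band (x, y))%:E = 2%:E)%E.
Proof.
rewrite (eq_integral (fun y : measurableTypeR R => (\1_(`[x - 1, x + 1]%classic) y)%:E)); last first.
  move=> y _; rewrite /unit_band indicE mem_setE/= in_itv/= ltNge if_neg.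
  by rewrite -ler_distlC; case: ifP.
rewrite integral_indic//= setIT lebesgue_measure_itv/= lte_fin ifT; last by lra.
by rewrite -EFinB; congr EFin; ring.
Qed.

Let ind (x : R) : R := \1_J x.

Let i_ind : mu.-integrable [set: R] (EFin \o ind).
Proof. exact: integrable_indic_itv. Qed.

Let m_ind : measurable_fun [set: R] ind. Proof. exact: measurable_indic. Qed.

(** Within distance 1 the Lipschitz constant 2 bounds the quotient by 4; farther away the
    oscillation of the parabola is below 1 and the kernel itself is integrable. A pair with nonzero
    quotient has a point in J, so [k] weighted by the indicator of J in either variable is an
    integrable majorant. *)
Lemma parabola_energy : (\int[mu2]_p (quot_sqr v p)%:E < +oo)%E.
Proof.
pose k p := 4 * unit_band p + trunc_ker 1 p.
have n0 p : 0 <= unit_band p by rewrite /unit_band; case: ifP.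
have k0 p : 0 <= k p by rewrite addr_ge0 ?mulr_ge0 ?trunc_ker_ge0.
have mk : measurable_fun [set: R * R] k.
  by apply: measurable_funD; [by apply: measurable_funM => //; exact: measurable_unit_band|exact: measurable_trunc_ker].
have kK x : (\int[mu]_y (k (x, y))%:E <= 10%:E)%E.
  have m1 : measurable_fun [set: R] (fun y => unit_band (x, y)) by exact: (measurableT_comp measurable_unit_band (pair1_measurable x)).
  have m2 : measurable_fun [set: R] (fun y => trunc_ker 1 (x, y)).
    exact: (measurableT_comp (measurable_trunc_ker 1) (pair1_measurable x)).
  rewrite (eq_integral (fun y : measurableTypeR R => (4%:E * (unit_band (x, y))%:E + (trunc_ker 1 (x, y))%:E)%E)); last first.
    by move=> y _; rewrite /k EFinD EFinM.
  rewrite ge0_integralD//; last 4 first.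
  - by move=> y _; rewrite -EFinM lee_fin mulr_ge0.
  - by apply: emeasurable_funM => //; exact/measurable_EFinP.
  - by move=> y _; rewrite lee_fin trunc_ker_ge0.
  - exact/measurable_EFinP.
  rewrite ge0_integralZl//; last 2 first.
  - exact/measurable_EFinP.
  - by move=> y _; rewrite lee_fin.
  rewrite integral_unit_band integral_trunc_ker// -EFinM -EFinD lee_fin; lra.
have ind0 x : 0 <= ind x by rewrite /ind indicE.
have i1 := integrable_kernel m_ind ind0 i_ind mk k0 kK.
have [i2 _] := integrable_swap (measurable_funM (measurable_fst_comp m_ind) mk) i1.
have i3 := integrable_add measurableT i1 i2.
apply: integrable_lty => //; apply: (integrable_dominated _ _ i3) => //.
  by apply: measurable_quot_sqr; exact: measurable_parabola.
have main (x y : R) : J x -> quot_sqr v (x, y) <= k (x, y).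
  move=> Jx; rewrite /k /unit_band /trunc_ker /quot_sqr /=; case: ltP => [far|near].
    rewrite mulr0 add0r expr_div_n -[leRHS]mul1r ler_wpM2r ?invr_ge0 ?sqr_ge0//.
    have := parabola_ge0 c x; have := parabola_le c x.
    by have := parabola_ge0 c y; have := parabola_le c y; nra.
  rewrite mulr1 addr0; have [->|xy] := eqVneq x y; first by rewrite !subrr mul0r expr0n.
  rewrite expr_div_n ler_pdivrMr ?exprn_even_gt0//= ?subr_eq0//.
  rewrite -[leLHS]real_normK ?num_real// -[(x - y) ^+ 2]real_normK ?num_real//.
  have -> : 4 * `|x - y| ^+ 2 = (2 * `|x - y|) ^+ 2 by ring.
  by rewrite lerXn2r ?nnegrE// ?mulr_ge0// parabola_lip.
have sym x y : quot_sqr v (x, y) = quot_sqr v (y, x).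
  by rewrite /quot_sqr/= -(opprB (v y) (v x)) -(opprB y x) invrN mulrNN.
move=> [x y] _ /=; rewrite ger0_norm ?sqr_ge0//.
have i1' z : J z -> ind z = 1 by move=> Jz; rewrite /ind indicE mem_set.
have [Jx|Jx] := pselect (J x).
  by rewrite i1'// mul1r (le_trans (main _ y Jx))// lerDl mulr_ge0.
have [Jy|Jy] := pselect (J y).
  by rewrite (i1' y)// mul1r sym (le_trans (main _ x Jy))// lerDr mulr_ge0.
by rewrite /quot_sqr/= !parabola_out// subrr mul0r expr0n/= addr_ge0// mulr_ge0.
Qed.

End test_function.

(** * Upper bound for the half-Laplacian of the parabola *)

Section form_bound.
Context (R : realType).
Local Notation mu := (@lebesgue_measure R).
Local Notation mu2 := (mu \x mu)%E.
Variable c : R.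
Local Notation l := (c - 2^-1).
Local Notation r := (c + 2^-1).
Local Notation J := (`]l, r[%classic).
Local Notation v := (parabola c).

Let mtk rho x : measurable_fun [set: R] (fun y => trunc_ker rho (x, y)).
Proof. exact: (measurableT_comp (measurable_trunc_ker rho) (pair1_measurable x)). Qed.

Let itk rho x : 0 < rho -> mu.-integrable [set: R] (EFin \o (fun y => trunc_ker rho (x, y))).
Proof.
move=> r0; apply: ge0_integrable; [by []|exact: mtk| |].
- by move=> y _; exact: trunc_ker_ge0.
- by rewrite integral_trunc_ker// ltry.
Qed.

Let vbound x y : `|v x - v y| <= 2^-1.
Proof.
rewrite ler_norml; have := parabola_ge0 c x; have := parabola_le c x.
have := parabola_ge0 c y; have := parabola_le c y => ? ? ? ?.
by apply/andP; split; lra.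
Qed.

Let itv rho x : 0 < rho ->
  mu.-integrable [set: R] (EFin \o (fun y => (v x - v y) * trunc_ker rho (x, y))).
Proof.
move=> r0; apply: (integrable_dominated _ _ (itk x r0)) => //.
  apply: measurable_funM; last exact: mtk.
  by apply: measurable_funB => //; exact: measurable_parabola.
move=> y _; rewrite normrM (ger0_norm (trunc_ker_ge0 _ _)) ler_piMl ?trunc_ker_ge0//.
by apply: le_trans (vbound x y) _; lra.
Qed.

(* The parabola is semiconvex with constant 4: the first-order term of
   [v x - v y] is odd about [x] and disappears from the truncated integral. *)
Lemma trunc_parabola_le rho x : 0 < rho < 1 ->
  \int[mu]_y ((v x - v y) * trunc_ker rho (x, y)) <= 5.
Proof.
move=> /andP[r0 r1].
(* Outside J the parabola is at its minimum 0 and the integrand is at most 0. *)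
have [Jx|Jx] := pselect (J x); last first.
  apply: (@le_trans _ _ 0) => //.
  rewrite -oppr_ge0 -mulN1r -RintegralZl//; last exact: itv.
  apply: Rintegral_ge0 => y _; rewrite parabola_out// sub0r mulN1r mulNr opprK.
  by rewrite mulr_ge0 ?parabola_ge0 ?trunc_ker_ge0.
(* For x in J, v x - v y is at most 4 (x - c)(y - x) + 2 (y - x)^2. Up to the factor 4 (x - c), [O]
   is the first term divided by (y - x)^2, restricted to the range where it is integrable. *)
pose O (y : R) : R := if rho < `|y - x| <= 1 then (y - x)^-1 else 0.
have mO : measurable_fun [set: R] O.
  apply: measurable_fun_ifT => //; last by apply: measurable_funV; exact: measurable_funB.
  have md : measurable_fun [set: R] (fun y => `|y - x|).
    by apply: measurableT_comp => //; exact: measurable_funB.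
  apply: measurable_and; first exact: measurable_fun_ltr.
  exact: measurable_fun_ler.
have iO : mu.-integrable [set: R] (EFin \o O).
  apply: (@integrable_bounded_support _ (measurableTypeR R) _ _ (`[x - 1, x + 1]%classic : set R) _ rho^-1) => //.
  - by rewrite /= lebesgue_measure_itv/=; case: ifP => _; rewrite ltry.
  - move=> y; rewrite /O; case: ifP => [/andP[h _]|_]; last by rewrite normr0 invr_ge0 ltW.
    by rewrite normfV lef_pV2 ?posrE ?ltW// (lt_trans r0).
  - move=> y; rewrite /= in_itv/= -ler_distlC => /negP h; rewrite /O distrC.
    by rewrite (negbTE h) andbF.
have O0 : \int[mu]_y O y = 0.
  apply: (Rintegral_odd (x := x)) => // y; rewrite /O.
  have -> : 2 * x - y - x = - (y - x) by ring.
  by rewrite normrN; case: ifP => _; rewrite ?oppr0// invrN.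
have in1 : mu.-integrable [set: R] (EFin \o (fun y => unit_band (x, y))).
  apply: ge0_integrable => //.
  - exact: (measurableT_comp (@measurable_unit_band R) (pair1_measurable x)).
  - by move=> y _; rewrite /unit_band; case: ifP.
  - by rewrite integral_unit_band ltry.
have n1 : \int[mu]_y unit_band (x, y) = 2 by rewrite (ge0_RintegralE (integral_unit_band x)).
have t1 : \int[mu]_y trunc_ker 1 (x, y) = 2.
  by rewrite (ge0_RintegralE (integral_trunc_ker x ltr01)) divr1.
have i1 := integrable_scale (4 * (x - c)) measurableT iO.
have i2 := integrable_scale 2 measurableT in1.
have i3 := integrable_scale 2^-1 measurableT (itk x ltr01).
have i12 := integrable_add measurableT i1 i2.
have i123 := integrable_add measurableT i12 i3.
(* The quadratic term gives 2 times the length 2 of the band; the oscillation 1/2 against the tail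
   of mass 2 gives the remaining 1. *)
have -> : 5 = \int[mu]_y (4 * (x - c) * O y + 2 * unit_band (x, y) + 2^-1 * trunc_ker 1 (x, y)).
  rewrite RintegralD// RintegralD// RintegralZl// RintegralZl// RintegralZl//; last exact: itk.
  by rewrite O0 n1 t1; field.
apply: le_Rintegral => //; first exact: itv.
move=> y _; rewrite /O /unit_band /trunc_ker /= (distrC y x).
have [near|far] := leP `|x - y| rho.
  rewrite mulr0 andFb mulr0 add0r ltNge (le_trans near (ltW r1))/=.
  by rewrite !mulr0 addr0 mulr1.
have [unit_band|far1] := leP `|x - y| 1; last first.
  rewrite !mulr0 !add0r ler_wpM2r ?invr_ge0 ?sqr_ge0//.
  exact: le_trans (ler_norm _) (vbound x y).
rewrite mulr0 addr0 mulr1 andTb.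
have z0 : y - x != 0.
  apply: contraTneq far => h; rewrite distrC h normr0 -leNgt; exact: ltW.
have -> : (x - y) ^- 2 = (y - x) ^- 2 by rewrite -(sqrrN (x - y)) opprB.
have z2 : 0 < (y - x) ^+ 2 by rewrite exprn_even_gt0.
rewrite ler_pdivrMr//.
have -> : (4 * (x - c) / (y - x) + 2) * (y - x) ^+ 2 = 4 * (x - c) * (y - x) + 2 * (y - x) ^+ 2.
  by field.
have vx : v x = 2^-1 - 2 * (x - c) ^+ 2.
  move: Jx; rewrite /= in_itv/= => /andP[lx xr].
  by rewrite parabola_clamp clamp_id ?ltW.
have vy : 2^-1 - 2 * (y - c) ^+ 2 <= v y by rewrite le_max lexx orbT.
by rewrite vx; nra.
Qed.

Variable A : set R.
Hypothesis mA : measurable A.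
Hypothesis muA : (mu A < +oo)%E.
Variables (u : R -> R) (M : R).
Hypothesis mu_ : measurable_fun [set: R] u.
Hypothesis u0M : forall x, 0 <= u x <= M.
Hypothesis uA : forall x, ~ A x -> u x = 0.
Hypothesis Eu : (\int[mu2]_p (quot_sqr u p)%:E < +oo)%E.

Let u0 x : 0 <= u x. Proof. by have /andP[] := u0M x. Qed.

Let iu : mu.-integrable [set: R] (EFin \o u).
Proof.
apply: (@integrable_bounded_support _ _ _ _ _ _ M); [exact: mA|exact: muA|exact: mu_| |].
- by move=> x; rewrite ger0_norm//; have /andP[] := u0M x.
- exact: uA.
Qed.

Let g rho (p : R * R) : R := u p.1 * ((v p.1 - v p.2) * trunc_ker rho p).

Let mg rho : measurable_fun [set: R * R] (g rho).
Proof.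
apply: measurable_funM; first exact: measurable_fst_comp.
apply: measurable_funM; last exact: measurable_trunc_ker.
have mv := measurable_parabola c.
by apply: measurable_funB; [exact: measurable_fst_comp|exact: measurable_snd_comp].
Qed.

Let ig rho : 0 < rho -> mu2.-integrable [set: R * R] (EFin \o g rho).
Proof.
move=> r0.
have kK x : (\int[mu]_y (trunc_ker rho (x, y))%:E <= (2 / rho)%:E)%E.
  by rewrite integral_trunc_ker.
have h := integrable_kernel mu_ u0 iu (measurable_trunc_ker rho) (trunc_ker_ge0 rho) kK.
apply: (integrable_dominated _ _ h); [by []|exact: mg|].
move=> p _; rewrite /g !normrM (ger0_norm (u0 _)) (ger0_norm (trunc_ker_ge0 _ _)).
rewrite ler_wpM2l// ler_piMl ?trunc_ker_ge0//.
by apply: le_trans (vbound _ _) _; lra.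
Qed.

Let int_g rho : 0 < rho < 1 -> \int[mu2]_p g rho p <= 5 * \int[mu]_x u x.
Proof.
move=> /[dup] r01 /andP[r0 r1].
rewrite -lee_fin -RintegralZl// /Rintegral fineK; last exact: (integrable_fin_num _ (ig r0)).
rewrite fineK; last by apply: integrable_fin_num => //; exact: integrable_scale.
rewrite -(integral12_prod_meas1 (ig r0)); apply: le_integral => //.
- exact: (integrable_fubini_F (ig r0)).
- exact: integrable_scale.
move=> x _; rewrite /fubini_F/= /g/=.
under eq_integral do rewrite EFinM.
rewrite integralZl//; last exact: itv.
rewrite -[X in (_ * X)%E]fineK; last by apply: integrable_fin_num => //; exact: itv.
rewrite -EFinM lee_fin (mulrC 5) ler_wpM2l//.
exact: trunc_parabola_le.
Qed.

Let F (p : R * R) : R := (u p.1 - u p.2) * (v p.1 - v p.2) / (p.1 - p.2) ^+ 2.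
Let Fr rho (p : R * R) : R := (u p.1 - u p.2) * (v p.1 - v p.2) * trunc_ker rho p.

Let mduv : measurable_fun [set: R * R] (fun p => (u p.1 - u p.2) * (v p.1 - v p.2)).
Proof.
have mv := measurable_parabola c.
apply: measurable_funM; apply: measurable_funB;
  [exact: measurable_fst_comp|exact: measurable_snd_comp|exact: measurable_fst_comp|exact: measurable_snd_comp].
Qed.

(** Exchanging the variables shows that the truncated form is twice the integral of u(x)(v(x) -
    v(y)) against the kernel. The truncation makes each half integrable, so that the product may be
    split in this way. *)
Let FrE rho : 0 < rho < 1 -> \int[mu2]_p Fr rho p <= 10 * \int[mu]_x u x.
Proof.
move=> /[dup] r01 /andP[r0 r1].
have [is_ es] := integrable_swap (mg rho) (ig r0).
have -> : \int[mu2]_p Fr rho p = \int[mu2]_p g rho p + \int[mu2]_p g rho p.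
  rewrite -{2}es -RintegralD//; last exact: ig.
  apply: eq_Rintegral => p _; rewrite /Fr /g/=.
  have -> : trunc_ker rho (p.2, p.1) = trunc_ker rho p.
    by rewrite /trunc_ker/= distrC -(sqrrN (p.1 - p.2)) opprB.
  by ring.
have := int_g r01; lra.
Qed.

(** The bound for the truncated forms does not depend on the truncation, which is removed by
    dominated convergence along the radii 1/(n + 2); the majorant is half the sum of the two energy
    densities. *)
Lemma form_parabola_le : half_laplacian_form u v <= 5 / pi * \int[mu]_(x in A) u x.
Proof.
have iU : mu2.-integrable [set: R * R] (EFin \o quot_sqr u).
  apply: ge0_integrable => //; first exact: measurable_quot_sqr.
  by move=> p _; exact: sqr_ge0.
have iV : mu2.-integrable [set: R * R] (EFin \o quot_sqr v).
  apply: ge0_integrable => //; last exact: parabola_energy.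
    by apply: measurable_quot_sqr; exact: measurable_parabola.
  by move=> p _; exact: sqr_ge0.
have iUV := integrable_scale 2^-1 measurableT (integrable_add measurableT iU iV).
pose B p := 2^-1 * (quot_sqr u p + quot_sqr v p).
have FB p : `|F p| <= B p.
  rewrite /F /B /quot_sqr !expr_div_n -mulrDl mulrA normrM.
  rewrite (ger0_norm (_ : 0 <= ((p.1 - p.2) ^+ 2)^-1)) ?invr_ge0 ?sqr_ge0// ler_wpM2r ?invr_ge0 ?sqr_ge0//.
  rewrite ler_norml; have := sqr_ge0 ((u p.1 - u p.2) + (v p.1 - v p.2)).
  have := sqr_ge0 ((u p.1 - u p.2) - (v p.1 - v p.2)) => ? ?.
  by apply/andP; split; lra.
pose rho_ (n : nat) : R := n.+2%:R^-1.
have rho01 n : 0 < rho_ n < 1 by rewrite invr_gt0 ltr0n/= invf_lt1 ?ltr1n ?ltr0n.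
have FrF n p : `|Fr (rho_ n) p| <= B p.
  rewrite /Fr /trunc_ker; case: ifP => _; first exact: FB.
  by rewrite mulr0 normr0; apply: le_trans (FB p).
have mF : measurable_fun [set: R * R] F.
  by apply: measurable_funM => //; exact: measurable_inv_sqr_sub.
have mFr n : measurable_fun [set: R * R] (Fr (rho_ n)).
  by apply: measurable_funM => //; exact: measurable_trunc_ker.
have cv p : Fr (rho_ n) p @[n --> \oo] --> F p.
  have [e|ne] := eqVneq p.1 p.2.
    rewrite /F e !subrr !mul0r; apply: cvg_near_cst; apply: nearW => n.
    by rewrite /Fr e !subrr !mul0r.
  have d0 : 0 < `|p.1 - p.2| by rewrite normr_gt0 subr_eq0.
  apply: cvg_near_cst; near=> n.
  rewrite /Fr /F /trunc_ker ifT//.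
  apply: le_lt_trans (_ : n.+1%:R^-1 < _).
    by rewrite /rho_ lef_pV2 ?posrE ?ltr0n// ler_nat.
  near: n; exact: (near_infty_natSinv_lt (PosNum d0)).
have mE f : measurable_fun [set: R * R] f -> measurable_fun [set: R * R] (EFin \o f).
  by move=> mf; exact/measurable_EFinP.
have [_ _ dc] : [/\ mu2.-integrable [set: R * R] (EFin \o F),
    (\int[mu2]_p `|(EFin \o Fr (rho_ n)) p - (EFin \o F) p|)%E @[n --> \oo] --> 0%E &
    (\int[mu2]_p (EFin \o Fr (rho_ n)) p)%E @[n --> \oo] --> (\int[mu2]_p (EFin \o F) p)%E].
  apply: (dominated_convergence _ _ _ _ iUV).
  - exact: measurableT.
  - by move=> n; apply: mE; exact: mFr.
  - exact: mE.
  - apply: aeW => p _; apply: cvg_EFin; [exact: nearW|exact: cv].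
  - by apply: aeW => p n _; rewrite /= lee_fin.
have F5 : \int[mu2]_p F p <= 10 * \int[mu]_x u x.
  rewrite -lee_fin.
  have fF G : mu2.-integrable [set: R * R] (EFin \o G) -> (\int[mu2]_p G p)%:E = (\int[mu2]_p (EFin \o G) p)%E.
    by move=> iG; rewrite /Rintegral fineK//; exact: (integrable_fin_num _ iG).
  have iF : mu2.-integrable [set: R * R] (EFin \o F).
    by apply: (integrable_dominated _ _ iUV); [by []|exact: mF|by move=> p _; exact: FB].
  rewrite fF//; apply: (cvge_le _ dc); apply: nearW => n.
  rewrite -fF ?lee_fin; first exact: FrE.
  by apply: (integrable_dominated _ _ iUV); [by []|exact: mFr|by move=> p _; exact: FrF].
have pi0 := @pi_gt0 R.
have -> : \int[mu]_(x in A) u x = \int[mu]_x u x by exact: Rintegral_support.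
have -> : half_laplacian_form u v = (2 * pi)^-1 * \int[mu2]_p F p by [].
rewrite ler_pdivrMl ?mulr_gt0//.
have -> : 2 * pi * (5 / pi * \int[mu]_x u x) = 10 * \int[mu]_x u x.
  move: pi0; move: (pi : R) => q q0; move: (\int[mu]_x u x) => U.
  by field; rewrite gt_eqF.
exact: F5.
Unshelve. all: by end_near.
Qed.

End form_bound.

(** * Absolute bound of the mass, given the heavier component *)

Section mass_bound.
Context (R : realType).
Local Notation mu := (@lebesgue_measure R).
Local Notation mu2 := (mu \x mu)%E.
Variable c : R.
Local Notation l := (c - 2^-1).
Local Notation r := (c + 2^-1).
Local Notation J := (`]l, r[%classic).
Variable A : set R.
Hypothesis mA : measurable A.
Hypothesis muA : (mu A < +oo)%E.
Hypothesis JA : J `<=` A.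
Hypothesis Jend : forall y, A y -> ~ J y -> ~~ (l <= y <= r).
Hypothesis Jfar : forall x y, J x -> A y -> ~ J y -> 4 <= `|x - y|.
Variables (u : R -> R) (M : R).
Hypothesis mu_ : measurable_fun [set: R] u.
Hypothesis u0M : forall x, 0 <= u x <= M.
Hypothesis uA : forall x, ~ A x -> u x = 0.
Hypothesis Eu : (\int[mu2]_p (quot_sqr u p)%:E < +oo)%E.
Variable eps : R.
Hypothesis eps0 : 0 < eps.
Hypothesis weak : forall v : R -> R, H_half v ->
  {ae mu, forall x : R, ~ A x -> v x = 0} ->
  half_laplacian_form u v = eps * \int[mu]_(x in A) (expR (u x) * v x).

Lemma mass_bound : \int[mu]_(x in A `\` J) u x <= \int[mu]_(x in J) u x ->
  \int[mu]_(x in A) u x <= 102.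
Proof.
move=> AJ.
have eM0 : 0 < eps * expR M by rewrite mulr_gt0// expR_gt0.
(* This choice makes the quadratic error in [deform_inequality] at most 1, whatever eps and M
   are. *)
have eta0 : 0 < (eps * expR M)^-1 by rewrite invr_gt0.
have [tau tau01 defect] := deform_defect_small c mu_ Eu eta0.
have [t0 t1] := andP tau01.
have [mJ mJ'] := mass_deform c tau01 A mu_ u0M.
have main := deform_inequality tau01 mA muA JA Jend Jfar mu_ u0M uA Eu eps0 weak.
have Hv : H_half (parabola c).
  apply: (@H_half_bounded_support _ A _ 2^-1).
  - exact: mA.
  - exact: muA.
  - exact: measurable_parabola.
  - by move=> x; rewrite ger0_norm ?parabola_ge0// parabola_le.
  - by move=> x Ax; apply: parabola_out => Jx; apply/Ax/JA.
  - exact: parabola_energy.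
have test := form_parabola_le c mA muA mu_ u0M uA Eu.
rewrite weak// in test; last first.
  by apply: aeW => x Ax; apply: parabola_out => Jx; apply/Ax/JA.
have small : eps * expR M / tau * \int[mu]_(x in A) ((u \o deform tau c) x - u x) ^+ 2 <= 1.
  have h : \int[mu]_(x in A) ((u \o deform tau c) x - u x) ^+ 2 <= (eps * expR M)^-1 * tau.
    rewrite -lee_fin /Rintegral.
    have le1 : (\int[mu]_(x in A) (((u \o deform tau c) x - u x) ^+ 2)%:E <=
                \int[mu]_x (((u \o deform tau c) x - u x) ^+ 2)%:E)%E.
      apply: ge0_subset_integral => //.
      - apply/measurable_EFinP; apply: measurable_funX; apply: measurable_funB => //.
        by apply: measurableT_comp => //; exact: measurable_deform.
      - by move=> x _; rewrite lee_fin sqr_ge0.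
    have le2 := le_trans le1 defect.
    rewrite fineK// ge0_fin_numE; first exact: le_lt_trans le2 (ltry _).
    by apply: integral_ge0 => x _; rewrite lee_fin sqr_ge0.
  have k0 : 0 < eps * expR M / tau by rewrite divr_gt0.
  apply: le_trans (ler_wpM2l (ltW k0) h) _.
  rewrite le_eqVlt; apply/orP; left; apply/eqP; move: (eps * expR M) eM0 t0 => q q0 t0.
  by field; rewrite !gt_eqF.
have split : \int[mu]_(x in A) u x = \int[mu]_(x in J) u x + \int[mu]_(x in A `\` J) u x.
  have AE : A = J `|` (A `\` J) by rewrite setDUK.
  rewrite {1}AE Rintegral_setU//; first exact: measurableD.
  - rewrite -AE; apply: (@integrable_bounded _ _ _ _ _ _ M) => //; first exact: measurable_funTS.
    by move=> x _; rewrite ger0_norm; have /andP[] := u0M x.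
  - by apply/disj_setPS => x [Jx [_ /(_ Jx)]].
have pi4 : (pi : R) <= 4 by have := @pihalf_lt2 R; rewrite ltr_pdivrMr// -natrM; exact: ltW.
have a0 : 0 <= \int[mu]_(x in J) (u \o deform tau c) x.
  by apply: Rintegral_ge0 => x _; have /andP[] := u0M (deform tau c x).
have a'0 : 0 <= \int[mu]_(x in A `\` J) u x.
  by apply: Rintegral_ge0 => x _; have /andP[] := u0M x.
have pi0 := @pi_gt0 R.
rewrite mJ' in main; move: main test small mJ split AJ a0 a'0.
set Q := eps * _ / tau * _; set V := eps * _.
set S := \int[mu]_(x in A) u x; set a := \int[mu]_(x in J) (u \o _) x.
set x1 := \int[mu]_(x in J) u x; set x2 := \int[mu]_(x in A `\` J) u x.
clearbody Q V S a x1 x2; clear -pi0 pi4 t0 t1; move: pi pi0 pi4 => p p0 p4.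
move=> main test small mJ split AJ a0 x20.
have : (4 * p)^-1 * (a ^+ 2 - a * x2 / 10) <= 5 / p * S + 1 by lra.
rewrite ler_pdivrMl ?mulr_gt0//.
have -> : 4 * p * (5 / p * S + 1) = 20 * S + 4 * p by field; rewrite gt_eqF.
move=> h.
have x1a : x1 <= 17 / 16 * a.
  by apply: le_trans mJ _; apply: ler_wpM2r => //; lra.
have ax : a * x2 <= a * (17 / 16 * a) by apply: ler_wpM2l => //; lra.
(* Since x2 <= x1 <= 17/16 a, the total S is at most 17/8 a and the cross term a x2 / 10 at most
   17/160 a^2; moreover 4 p <= 16. *)
have q : a ^+ 2 * (143 / 160) <= 85 / 2 * a + 16 by lra.
(* The positive root of this quadratic inequality lies just below 48. Then x1 <= 17/16 * 48 = 51,
   and the total is at most twice that. *)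
have a48 : a <= 48.
  rewrite leNgt; apply/negP => a48.
  have := ler_wpM2l a0 (ltW a48); lra.
lra.
Qed.

End mass_bound.

(** * From almost everywhere to everywhere *)

Section almost_everywhere.
Context (R : realType).
Local Notation mu := (@lebesgue_measure R).
Local Notation mu2 := (mu \x mu)%E.

Lemma ae_Leb_filter : Filter (nbhs (almost_everywhere mu)).
Proof. exact: (@ae_filter_ringOfSetsType _ (measurableTypeR R) R mu). Qed.

Lemma ae_Leb2_filter : Filter (nbhs (almost_everywhere mu2)).
Proof. exact: (@ae_filter_ringOfSetsType _ (measurableTypeR R * measurableTypeR R)%type R mu2). Qed.

Lemma ae_product (P : R -> Prop) : {ae mu, forall x, P x} ->
  {ae mu2, forall p, P p.1 /\ P p.2}.
Proof.
move=> [N [mN N0 PN]].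
have n1 : mu2.-negligible [set p | ~ P p.1].
  exists (N `*` setT); split.
  - exact: measurableX.
  - transitivity (mu N * mu [set: R])%E; first exact: product_measure1E.
    by rewrite [mu N]N0 mul0e.
  - by move=> p /= Pp; split => //; exact: PN.
have n2 : mu2.-negligible [set p | ~ P p.2].
  exists (setT `*` N); split.
  - exact: measurableX.
  - transitivity (mu [set: R] * mu N)%E; first exact: product_measure1E.
    by rewrite [mu N]N0 mule0.
  - by move=> p /= Pp; split => //; exact: PN.
apply: negligibleS (negligibleU n1 n2) => p /= /not_andP[h|h]; [by left|by right].
Qed.

Lemma lebesgue_measureT_gt0 : (0 < mu [set: R])%E.
Proof.
apply: (@lt_le_trans _ _ (mu `[0, 1]%classic)).
  by rewrite lebesgue_measure_itv/= lte_fin ltr01 oppr0 adde0 lte01.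
by apply: le_measure; rewrite ?inE.
Qed.

Lemma Lfun_oo_ae_bounded (u : R -> R) : u \in Lfun mu +oo%E ->
  measurable_fun [set: R] u /\ exists M, {ae mu, forall x, `|u x| <= M}.
Proof.
move=> /andP[mu_ fin]; split; first exact: (set_mem mu_).
have T0 := lebesgue_measureT_gt0.
have /= : (finite_norm mu +oo u)%E by exact: (set_mem fin).
rewrite /finite_norm unlock /= T0.
rewrite (_ : (abse \o _) = EFin \o (fun x => `|u x|))//.
exact: ess_supr_bounded.
Qed.

End almost_everywhere.

(** * Mass of a solution on the two intervals *)

Section two_components.
Context (R : realType).
Local Notation mu := (@lebesgue_measure R).
Local Notation mu2 := (mu \x mu)%E.
Local Notation I := (two_intervals (2 : R)).

Lemma measurable_two_intervals b : measurable (two_intervals (b : R)).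
Proof. exact: measurableU. Qed.

Lemma two_intervals2E : I = `](- (5 / 2)) - 2^-1, - (5 / 2) + 2^-1[ `|` `]5 / 2 - 2^-1, 5 / 2 + 2^-1[.
Proof.
by rewrite /two_intervals; congr (_ `|` _); apply: eq_set => x; rewrite /= !in_itv/=;
  apply/propext; split => /andP[? ?]; apply/andP; split; lra.
Qed.

Lemma lebesgue_two_intervals : (mu I < +oo)%E.
Proof.
apply: (@le_lt_trans _ _ (mu `[-3, 3]%classic)).
  apply: le_measure; rewrite ?inE; [exact: measurable_two_intervals|exact: measurable_itv|].
  by move=> x; rewrite /two_intervals /= !in_itv/= => -[]/andP[? ?]; apply/andP; split; lra.
by rewrite /= lebesgue_measure_itv/=; case: ifP => _; rewrite ltry.
Qed.

Lemma setD_component (c : R) : c = 5 / 2 \/ c = - (5 / 2) ->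
  I `\` `]c - 2^-1, c + 2^-1[ = `](- c) - 2^-1, - c + 2^-1[%classic.
Proof.
move=> hc; rewrite two_intervals2E; apply/seteqP; split => x; rewrite /= !in_itv/=.
  move=> [[]/andP[h1 h2] /negP]; rewrite negb_and -!leNgt => /orP h; case: hc h => -> [] ?; apply/andP; split; lra.
move=> /andP[h1 h2]; split; last by case: hc h1 h2 => -> ? ? /andP[? ?]; lra.
case: hc h1 h2 => -> h1 h2; [left|right]; apply/andP; split; lra.
Qed.

Lemma mass_two_intervals (u : R -> R) (M : R) (eps : R) :
  measurable_fun [set: R] u ->
  (forall x, 0 <= u x <= M) ->
  (forall x, ~ I x -> u x = 0) ->
  (\int[mu2]_p (quot_sqr u p)%:E < +oo)%E ->
  0 < eps ->
  (forall v : R -> R, H_half v ->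
  {ae mu, forall x : R, ~ I x -> v x = 0} ->
  half_laplacian_form u v = eps * \int[mu]_(x in I) (expR (u x) * v x)) ->
  \int[mu]_(x in I) u x <= 102.
Proof.
move=> mu_ u0M uI Eu e0 weak.
pose J (c : R) := `](c - 2^-1), (c + 2^-1)[%classic.
have mI := measurable_two_intervals (2 : R).
have compl := setD_component : forall c, _ -> I `\` J c = J (- c).
have bound c : c = 5 / 2 \/ c = - (5 / 2) ->
    \int[mu]_(x in I `\` J c) u x <= \int[mu]_(x in J c) u x -> \int[mu]_(x in I) u x <= 102.
  move=> hc; apply: (mass_bound (M := M) mI lebesgue_two_intervals _ _ _ mu_ u0M uI Eu e0 weak).
  - by move=> x Jx; rewrite two_intervals2E; case: hc Jx => ->; [right|left].
  - clear Eu weak; move=> y Iy Jy; have : (I `\` J c) y by [].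
    rewrite compl// /J /= in_itv/= => /andP[? ?]; apply/negP => /andP[? ?].
    by case: hc => ?; subst c; lra.
  - clear Eu weak; move=> x y; rewrite /= in_itv/= => /andP[x1 x2] Iy Jy; have : (I `\` J c) y by [].
    rewrite compl// /J /= in_itv/= => /andP[? ?].
    by rewrite ler_normr; apply/orP; case: hc => ?; subst c; [left|right]; lra.
have [h|/ltW h] := leP (\int[mu]_(x in I `\` J (5 / 2)) u x) (\int[mu]_(x in J (5 / 2)) u x).
  by apply: bound h; left.
apply: (bound (- (5 / 2))); first by right.
rewrite compl; last by right.
by rewrite opprK; move: h; rewrite compl//; left.
Qed.

(** The estimates on the deformation assume pointwise bounds. The solution is therefore replaced by
    a representative that lies between 0 and M everywhere and vanishes off I; the energy and both
    sides of the weak equation depend only on the class modulo null sets. *)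
Lemma solution_mass (eps : R) (u : R -> R) : 0 < eps -> is_solution I eps u ->
  exists ut : R -> R, [/\ measurable_fun [set: R] ut, forall x, 0 <= ut x,
    {ae mu, forall x, I x -> ut x = u x} &
    (\int[mu]_(x in I) (ut x)%:E <= 102%:E)%E].
Proof.
move=> e0 [/Lfun_oo_ae_bounded[mu_ [K uK]] [u2 Eu] weak upos u0].
pose M := Num.max 0 K.
have M0 : 0 <= M by rewrite le_max lexx.
have ub : {ae mu, forall x, `|u x| <= M}.
  by apply: (@filterS _ _ (ae_Leb_filter R)) uK => x uK; rewrite le_max uK orbT.
have mI := measurable_two_intervals (2 : R).
pose ut x := if (x \in I) && (0 <= u x <= M) then u x else 0.
have mut : measurable_fun [set: R] ut.
  apply: measurable_fun_ifT => //; apply: measurable_and.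
    apply: (measurable_fun_bool true); rewrite setTI (_ : _ @^-1` _ = I)//.
    by apply/seteqP; split => x /=; [move=> /set_mem|move=> h; apply: mem_set].
  by apply: measurable_and; exact: measurable_fun_ler.
have utu : {ae mu, forall x, ut x = u x}.
  move: ub upos u0; apply: (@filterS3 _ _ (ae_Leb_filter R)) => x ub upos u0; rewrite /ut.
  have [Ix|Ix] := pselect (I x).
    by rewrite mem_set//= (ltW (upos Ix)) (le_trans (ler_norm _) ub).
  by rewrite memNset//= u0.
have ut0 x : 0 <= ut x <= M.
  by rewrite /ut; case: ifP => [/andP[_]//|_]; rewrite lexx.
have utI x : ~ I x -> ut x = 0 by move=> Ix; rewrite /ut memNset.
have ut2 := ae_product utu.
have Eut : (\int[mu2]_p (quot_sqr ut p)%:E < +oo)%E.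
  apply: le_lt_trans Eu; rewrite le_eqVlt; apply/orP; left; apply/eqP.
  apply: ae_eq_integral => //.
  - by apply/measurable_EFinP; exact: measurable_quot_sqr.
  - by apply/measurable_EFinP; exact: (measurable_quot_sqr mu_).
  - by apply: (@filterS _ _ (ae_Leb2_filter R)) ut2 => p [h1 h2] _; rewrite /quot_sqr h1 h2.
have wut v : H_half v -> {ae mu, forall x, ~ I x -> v x = 0} ->
    half_laplacian_form ut v = eps * \int[mu]_(x in I) (expR (ut x) * v x).
  move=> Hv v0.
  have mv : measurable_fun [set: R] v.
    by case: Hv; rewrite inE => /andP[+ _] _; rewrite inE.
  have -> : half_laplacian_form ut v = half_laplacian_form u v.
    rewrite /half_laplacian_form /Rintegral; congr (_ * fine _).
    have mw (w : R -> R) : measurable_fun [set: R] w -> measurable_fun [set: R * R]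
        (fun p : R * R => ((w p.1 - w p.2) * (v p.1 - v p.2) / (p.1 - p.2) ^+ 2)%:E).
      move=> mw; apply/measurable_EFinP; apply: measurable_funM; last exact: measurable_inv_sqr_sub.
      apply: measurable_funM; apply: measurable_funB;
      [exact: measurable_fst_comp|exact: measurable_snd_comp|exact: measurable_fst_comp|exact: measurable_snd_comp].
    apply: ae_eq_integral => //; [exact: mw|exact: mw|].
    by apply: (@filterS _ _ (ae_Leb2_filter R)) ut2 => p [h1 h2] _; rewrite h1 h2.
  rewrite weak// /Rintegral; congr (_ * fine _).
  have mw (w : R -> R) : measurable_fun [set: R] w -> measurable_fun I (fun x => (expR (w x) * v x)%:E).
    move=> mw; apply/measurable_EFinP; apply: measurable_funTS; apply: measurable_funM => //.
    exact: measurableT_comp.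
  apply: ae_eq_integral => //; [exact: mw|exact: mw|].
  by apply: (@filterS _ _ (ae_Leb_filter R)) utu => x h _; rewrite h.
exists ut; split => //.
- by move=> x; have /andP[] := ut0 x.
- by apply: (@filterS _ _ (ae_Leb_filter R)) utu => x h _.
have := mass_two_intervals mut ut0 utI Eut e0 wut.
rewrite -lee_fin /Rintegral fineK//.
apply: integrable_fin_num => //; apply: (@integrable_bounded _ _ _ _ _ _ M) => //.
- exact: lebesgue_two_intervals.
- exact: measurable_funTS.
- by move=> x _; rewrite ger0_norm; have /andP[] := ut0 x.
Qed.

End two_components.

(** * A maximum principle for principal values *)

Section principal_value.
Context (R : realType).
Local Notation mu := (@lebesgue_measure R).
Implicit Types (u v h b : R -> R) (x : R).

Definition increment u x (z : R) : R := (u x - u (x + z)) / z ^+ 2.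

(** The condition [half_laplacian_at u x 0] with the limit spelled out and the factor 1/pi
    dropped. *)
Definition pv0 u x : Prop :=
  (forall r : R, 0 < r -> mu.-integrable [set z : R | r < `|z|] (EFin \o increment u x)) /\
  forall e : R, 0 < e -> exists2 d : R, 0 < d & forall r, 0 < r < d ->
    `|\int[mu]_(z in [set z : R | (r < `|z|)%R]) increment u x z| <= e.

Definition annulus (r S : R) := [set z : R | r < `|z| <= S].

(* A one-sided form of [(-Delta)^{1/2} b x >= 0] that does not involve the tail
   beyond [S]. The constant 6 is the diameter of the set on which the maximum
   principle is applied: [x + z] lies outside it when [6 < `|z|]. *)
Definition pv_super b x (S : R) : Prop :=
  [/\ 6 <= S, forall z, S < `|z| -> b (x + z) <= b x,
    forall r : R, 0 < r -> mu.-integrable (annulus r S) (EFin \o increment b x) &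
    forall e : R, 0 < e -> exists2 d : R, 0 < d & forall r, 0 < r < d ->
    - e <= \int[mu]_(z in annulus r S) increment b x z].

Lemma half_laplacian_at_pv0 u x : half_laplacian_at u x 0 -> pv0 u x.
Proof.
move=> [iu cu]; split=> // e e0.
have pe0 : 0 < pi^-1 * e by rewrite mulr_gt0// invr_gt0 pi_gt0.
have /cvgr0Pnorm_lt /(_ _ pe0) := cu.
rewrite /at_right /within => -[d /= d0 hd]; exists d => // r /andP[r0 rd].
have := hd r; rewrite /ball_/= sub0r normrN gtr0_norm// => /(_ rd r0).
rewrite normrM gtr0_norm ?invr_gt0 ?pi_gt0// ltr_pM2l ?invr_gt0 ?pi_gt0//.
exact: ltW.
Qed.

Lemma pv0_sub u v x : pv0 u x -> pv0 v x -> pv0 (fun y => u y - v y) x.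
Proof.
move=> [iu cu] [iv cv].
have uv z : increment u x z - increment v x z = increment (fun y => u y - v y) x z.
  by rewrite /increment; ring.
have mS := @measurable_gt_norm R.
split=> [r r0|e e0].
  have iuv : mu.-integrable [set z : R | r < `|z|] (EFin \o (fun z => increment u x z - increment v x z)).
    by apply: integrable_sub; [exact: mS|exact: iu|exact: iv].
  apply: (integrable_ext _ _ iuv); first exact: mS.
  by move=> z _; exact: uv.
have e20 : 0 < e / 2 by rewrite divr_gt0.
have [d1 d10 h1] := cu _ e20; have [d2 d20 h2] := cv _ e20.
exists (Num.min d1 d2); first by rewrite lt_min d10.
move=> r; rewrite lt_min => /andP[r0 /andP[r1 r2]].
under eq_Rintegral do rewrite -uv.
rewrite RintegralB; [|exact: mS|exact: iu|exact: iv].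
have := h1 r; have := h2 r; rewrite r0 r1 r2 => /(_ isT) ? /(_ isT) ?.
by apply: le_trans (ler_normB _ _) _; rewrite [leRHS](splitr e) lerD.
Qed.

Lemma measurable_annulus r S : measurable (annulus r S).
Proof.
rewrite (_ : annulus r S = [set z | r < `|z|] `&` ~` [set z | S < `|z|]).
  exact: (measurableI _ _ (measurable_gt_norm r) (measurableC (measurable_gt_norm S))).
apply/seteqP; split => z; rewrite /annulus /=.
  by move=> /andP[-> h]; split => //; apply/negP; rewrite -leNgt.
by move=> [-> /negP]; rewrite -leNgt.
Qed.

(** At a global minimum of h + b the increments of [h] are at most minus those of [b], which settles
    the annulus. Beyond [S], [b] is no larger than at x, so the gap [k] falls on [h] alone and its
    tail is at most -2k/S. This outweighs the two errors of size k/(2S) allowed in the principal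
    values. *)
Lemma pv_super_min h b x (S k : R) : pv0 h x -> pv_super b x S -> 0 < k ->
  (forall z, h x + b x <= h (x + z) + b (x + z)) ->
  (forall z, 6 < `|z| -> h x + b x + k <= h (x + z) + b (x + z)) -> False.
Proof.
move=> [ih ch] [S6 bS ib cb] k0 hb hbk.
have S0 : 0 < S by lra.
have e0 : 0 < k / (2 * S) by rewrite divr_gt0// mulr_gt0.
have [d1 d10 h1] := ch _ e0; have [d2 d20 h2] := cb _ e0.
pose r := Num.min (Num.min d1 d2) S / 2.
have m0 : 0 < Num.min (Num.min d1 d2) S by rewrite !lt_min d10 d20.
have [r0 [rd1 [rd2 rS]]] : 0 < r /\ (r < d1 /\ (r < d2 /\ r < S)).
  split; first by rewrite divr_gt0.
  have : r < Num.min (Num.min d1 d2) S by rewrite ltr_pdivrMr// ltr_pMr//; lra.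
  by rewrite !lt_min => /andP[/andP[-> ->] ->].
have := h1 r; have := h2 r; rewrite r0 rd1 rd2 => /(_ isT) lb /(_ isT).
have mA := measurable_annulus r S; have mS := measurable_gt_norm S.
have sE : [set z : R | r < `|z|] = annulus r S `|` [set z | S < `|z|].
  apply/seteqP; split => z /=; rewrite /annulus/=.
    by move=> ->; have [|] := leP `|z| S; [left|right].
  by move=> [/andP[]//|]; exact: lt_trans.
have iA : mu.-integrable (annulus r S) (EFin \o increment h x).
  by apply: integrableS (ih _ r0); [exact: measurable_gt_norm|exact: mA|rewrite sE => z; left].
have iS := ih _ S0.
have -> : \int[mu]_(z in [set z : R | (r < `|z|)%R]) increment h x z =
    \int[mu]_(z in annulus r S) increment h x z + \int[mu]_(z in [set z : R | (S < `|z|)%R]) increment h x z.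
  rewrite sE; apply: Rintegral_setU => //; first by rewrite -sE; exact: ih.
  by apply/disj_setPS => z [/andP[_]] /=; rewrite leNgt => /negP.
have z20 (z : R) : 0 <= (z ^+ 2)^-1 by rewrite invr_ge0 sqr_ge0.
have A1 : \int[mu]_(z in annulus r S) increment h x z <= - \int[mu]_(z in annulus r S) increment b x z.
  rewrite -mulN1r -RintegralZl; [|exact: mA|exact: ib].
  have im : mu.-integrable (annulus r S) (EFin \o (fun z => -1 * increment b x z)).
    by apply: integrable_scale; [exact: mA|exact: ib].
  apply: le_Rintegral; [exact: mA|exact: iA|exact: im|].
  by move=> z _; rewrite /increment mulrA ler_wpM2r//; have := hb z; lra.
have ik : mu.-integrable [set z : R | S < `|z|] (EFin \o (fun z => - k * z ^- 2)).
  apply: integrable_scale => //; apply: ge0_integrable => //.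
    apply: measurable_funTS; apply: measurable_funV; exact: measurable_funX.
  by rewrite integral_invsqr_norm// ltry.
have A2 : \int[mu]_(z in [set z : R | (S < `|z|)%R]) increment h x z <= - k * (2 / S).
  rewrite -(ge0_RintegralE (integral_invsqr_norm S0)) -RintegralZl; [|exact: mS|].
    apply: le_Rintegral => // z /= zS; rewrite /increment ler_wpM2r//.
    move: (bS z zS) (hbk z (le_lt_trans S6 zS)).
    move: (h x) (b x) (h (x + z)) (b (x + z)) => p q p' q' h3 h4.
    by clear -h3 h4; lra.
  apply: ge0_integrable => //.
    apply: measurable_funTS; apply: measurable_funV; exact: measurable_funX.
  by rewrite integral_invsqr_norm// ltry.
rewrite ler_norml => /andP[low _].
have E : k / (2 * S) * 4 = k * (2 / S) by field; rewrite gt_eqF.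
rewrite mulNr in A2; move: lb low A1 A2 E e0; clear.
set X := \int[mu]_(z in annulus r S) increment h x z.
set Y := \int[mu]_(z in annulus r S) increment b x z.
set Z := \int[mu]_(z in _) increment h x z.
by move: X Y Z (k / (2 * S)) (k * (2 / S)) => X Y Z K K' *; lra.
Qed.

(** If some value were below L, the minimum over [-3, 3] would be global and attained in [I]. Points
    at distance more than 6 from it lie off [I], where h + b is at least L, and this provides the
    gap for [pv_super_min]. *)
Lemma pv_super_ge h b (I : set R) (L : R) : continuous h -> continuous b ->
  (forall x, I x -> -3 < x < 3) ->
  (forall x, I x -> pv0 h x) -> (forall x, I x -> exists S, pv_super b x S) ->
  (forall x, ~ I x -> L <= h x + b x) -> forall x, L <= h x + b x.
Proof.
move=> ch cb I3 hI bI off x1; rewrite leNgt; apply/negP => x1L.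
have Ix1 : I x1 by apply: contrapT => /off; rewrite leNgt x1L.
have le33 : -3 <= 3 :> R by lra.
have cw : {within `[-3, 3], continuous (fun t => h t + b t)}.
  by apply: continuous_subspaceT => t; apply: cvgD; [exact: ch|exact: cb].
have [x0 x0I x0min] := EVT_min le33 cw.
have x03 : - 3 <= x0 <= 3 by move: x0I; rewrite in_itv.
have x01 : h x0 + b x0 <= h x1 + b x1.
  by apply: x0min; rewrite in_itv/=; have /andP[? ?] := I3 _ Ix1; apply/andP; split; exact: ltW.
have Ix0 : I x0 by apply: contrapT => /off; rewrite leNgt (le_lt_trans x01 x1L).
have [S bS] := bI _ Ix0.
apply: (@pv_super_min h b x0 S (L - (h x0 + b x0)) (hI _ Ix0) bS).
- lra.
- move=> z; have [/I3/andP[? ?]|/off] := pselect (I (x0 + z)); last lra.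
  by apply: x0min; rewrite in_itv/=; apply/andP; split; exact: ltW.
- move=> z z6; have : ~ I (x0 + z).
    by move=> /I3/andP[? ?]; move: z6; rewrite ltNge ler_norml => /negP; apply; apply/andP; split; lra.
  by move=> /off; lra.
Qed.

End principal_value.

(** * A primitive for the symmetrised increment of a bubble *)

Section primitive.
Context (R : realType).
Local Notation mu := (@lebesgue_measure R).
Variables (a y : R).
Hypothesis a0 : 0 < a.

(** With a = mu eps, a bubble is a constant minus a translate of this logarithm; see [bubbleE]. *)
Definition ell (t : R) : R := ln (a ^+ 2 + t ^+ 2).

Let q : R := a ^+ 2 + y ^+ 2.

Lemma ell_arg_gt0 (t : R) : 0 < a ^+ 2 + t ^+ 2.
Proof. by rewrite ltr_pwDl ?sqr_ge0// exprn_gt0. Qed.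

(** What the increments of a bubble at z and -z add up to, before the division by z^2. *)
Definition second_diff (z : R) : R := ell (y + z) + ell (y - z) - 2 * ell y.

(* The primitive of [second_diff z / z ^+ 2] obtained by integrating by parts and
   decomposing [second_diff^`() z / z] into partial fractions. *)
Definition pv_primitive (z : R) : R := - (second_diff z / z) +
  2 * a / q * (atan ((z + y) / a) + atan ((z - y) / a)) +
  y / q * (ell (y - z) - ell (y + z)).

Lemma is_derive_ell (t : R) : is_derive t 1 ell (2 * t / (a ^+ 2 + t ^+ 2)).
Proof.
have d1 : is_derive t 1 (fun t : R => a ^+ 2 + t ^+ 2) (2 * t).
  apply: is_derive_eq; rewrite /= ?scaler0 ?add0r /GRing.scale/=; ring.
have d2 := is_derive1_ln (ell_arg_gt0 t).
have := @is_derive1_comp R (@ln R) (fun t : R => a ^+ 2 + t ^+ 2) t _ _ d2 d1.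
by move=> h; apply: is_derive_eq; rewrite mulrC.
Qed.

Lemma continuous_ell : continuous ell.
Proof.
move=> t; apply/differentiable_continuous; rewrite -derivable1_diffP.
by have [] := is_derive_ell t.
Qed.

Lemma is_derive_pv_primitive (z : R) : z != 0 ->
  is_derive z 1 pv_primitive (second_diff z / z ^+ 2).
Proof.
move=> z0.
have dp : is_derive z 1 (fun z : R => ell (y + z)) (2 * (y + z) / (a ^+ 2 + (y + z) ^+ 2)).
  have e : is_derive z 1 (fun z : R => y + z) 1 by apply: is_derive_eq; rewrite /GRing.scale/=; ring.
  have := @is_derive1_comp R ell (fun z : R => y + z) z _ _ (is_derive_ell (y + z)) e.
  by move=> h; apply: is_derive_eq; rewrite mulr1.
have dm : is_derive z 1 (fun z : R => ell (y - z)) (- (2 * (y - z) / (a ^+ 2 + (y - z) ^+ 2))).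
  have e : is_derive z 1 (fun z : R => y - z) (-1) by apply: is_derive_eq; rewrite /GRing.scale/=; ring.
  have := @is_derive1_comp R ell (fun z : R => y - z) z _ _ (is_derive_ell (y - z)) e.
  by move=> h; apply: is_derive_eq; rewrite mulrN1.
have dat s : is_derive z 1 (fun z : R => atan ((z + s) / a)) (a / (a ^+ 2 + (z + s) ^+ 2)).
  have e : is_derive z 1 (fun z : R => (z + s) / a) a^-1.
    by apply: is_derive_eq; rewrite /GRing.scale/=; ring.
  have d3 : is_derive ((z + s) / a) 1 (@atan R) (1 + ((z + s) / a) ^+ 2)^-1.
    by apply: DeriveDef; [exact: derivable_atan|rewrite -derive1E derive1_atan].
  have := @is_derive1_comp R (@atan R) (fun z : R => (z + s) / a) z _ _ d3 e.
  move=> h; apply: is_derive_eq.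
  have h1 : a ^+ 2 + (z + s) ^+ 2 != 0 by rewrite gt_eqF// ell_arg_gt0.
  have h2 : 1 + ((z + s) / a) ^+ 2 != 0 by rewrite gt_eqF// ltr_pwDl ?sqr_ge0.
  by field; rewrite ?h1 ?gt_eqF//.
rewrite /pv_primitive /second_diff.
have d1 := dat y; have d2 := dat (- y).
have dv : is_derive z 1 (fun z : R => z^-1) (- z ^- 2).
  have h := @is_deriveV R id z 1 1 z0 (is_derive_id z (1 : R)).
  by apply: is_derive_eq; rewrite /GRing.scale/= mulr1.
apply: is_derive_eq.
rewrite /= /GRing.scale/=.
have h1 : a ^+ 2 + (y + z) ^+ 2 != 0 by rewrite gt_eqF// ell_arg_gt0.
have h2 : a ^+ 2 + (y - z) ^+ 2 != 0 by rewrite gt_eqF// ell_arg_gt0.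
have h3 : a ^+ 2 + y ^+ 2 != 0 by rewrite gt_eqF// ell_arg_gt0.
have -> : (z + y) ^+ 2 = (y + z) ^+ 2 by rewrite addrC.
have -> : (z - y) ^+ 2 = (y - z) ^+ 2 by ring.
rewrite /q; move: (ell (y + z)) (ell (y - z)) (ell y) => l1 l2 l3.
by field; rewrite z0 h1 h2 h3.
Qed.

End primitive.

(** * Reflection of integrals *)

Section reflection.
Context (R : realType).
Local Notation mu := (@lebesgue_measure R).

Lemma Rintegral_opp (f : R -> R) : measurable_fun [set: R] f ->
  \int[mu]_x f (- x) = \int[mu]_x f x.
Proof.
move=> mf; have mE : measurable_fun [set: R] (EFin \o f) by exact/measurable_EFinP.
rewrite /Rintegral integralE [in RHS]integralE; congr (fine (_ - _)%E).
  rewrite -[RHS]ge0_integral_opp//; last exact: measurable_funepos.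
  by apply: eq_integral => x _; rewrite !funeposE.
rewrite -[RHS]ge0_integral_opp//; last exact: measurable_funeneg.
by apply: eq_integral => x _; rewrite !funenegE.
Qed.

Lemma Rintegral_itv_opp (f : R -> R) (r S : R) : measurable_fun [set: R] f ->
  \int[mu]_(x in `[(- S), (- r)[) f x = \int[mu]_(x in `]r, S]) f (- x).
Proof.
move=> mf; rewrite Rintegral_mkcond [RHS]Rintegral_mkcond -[LHS]Rintegral_opp.
  apply: eq_Rintegral => x _; rewrite !patchE !mem_setE !in_itv/=.
  by rewrite lerNl opprK ltrN2 andbC.
by apply/(measurable_restrictT _ _).1 => //; exact: measurable_funTS.
Qed.

End reflection.

(** * Integral of the increment of a bubble over an annulus *)

Section bubble_pv.
Context (R : realType).
Local Notation mu := (@lebesgue_measure R).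
Variable a : R.
Hypothesis a0 : 0 < a.
Local Notation ell := (ell a).

Lemma ell_le (s t : R) : s ^+ 2 <= t ^+ 2 -> ell s <= ell t.
Proof. by move=> st; rewrite ler_ln ?posrE ?ell_arg_gt0// lerD2l. Qed.

Lemma ell_opp (t : R) : ell (- t) = ell t.
Proof. by rewrite /ell sqrrN. Qed.

Lemma measurable_ell : measurable_fun [set: R] ell.
Proof. apply: continuous_measurable_fun; exact: continuous_ell. Qed.

Lemma integral_second_diff (y r S : R) : 0 < r < S ->
  \int[mu]_(z in `]r, S]) (second_diff a y z / z ^+ 2) = pv_primitive a y S - pv_primitive a y r.
Proof.
move=> /andP[r0 rS].
have d (z : R) : 0 < z -> is_derive z 1 (pv_primitive a y) (second_diff a y z / z ^+ 2).
  by move=> z0; apply: is_derive_pv_primitive => //; rewrite gt_eqF.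
have cP (z : R) : 0 < z -> {for z, continuous (pv_primitive a y)}.
  move=> z0; apply/differentiable_continuous; rewrite -derivable1_diffP.
  by have [] := d _ z0.
have ms : measurable_fun [set: R] (second_diff a y).
  apply: measurable_funB => //; apply: measurable_funD.
    by apply: (measurableT_comp measurable_ell); exact: measurable_funD.
  by apply: (measurableT_comp measurable_ell); exact: measurable_funB.
have cs : continuous (second_diff a y).
  move=> z; apply: (@cvgB _ R^o); last exact: cvg_cst.
  apply: (@cvgD _ R^o).
    apply: (continuous_comp (f := fun z => y + z)); last exact: continuous_ell.
    by apply: (@cvgD _ R^o); [exact: cvg_cst|exact: cvg_id].
  apply: (continuous_comp (f := fun z => y - z)); last exact: continuous_ell.
  by apply: (@cvgB _ R^o); [exact: cvg_cst|exact: cvg_id].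
rewrite /Rintegral integral_itv_obnd_cbnd//; last first.
  apply/measurable_EFinP; apply: measurable_funTS; apply: measurable_funM => //.
  by apply: measurable_funV; exact: measurable_funX.
rewrite (@continuous_FTC2 _ _ (pv_primitive a y))//.
- apply: continuous_in_subspaceT => z; rewrite inE /= in_itv/= => /andP[rz _].
  apply: (@cvgM _ R^o); first exact: cs.
  apply: (@cvgV _ R^o); last exact: sqr_continuous.
  by rewrite expf_neq0// gt_eqF// (lt_le_trans r0).
- split.
  + by move=> z; rewrite in_itv/= => /andP[rz _]; have [] := d z (lt_trans r0 rz).
  + by apply: cvg_at_right_filter; exact: cP.
  + by apply: cvg_at_left_filter; apply: cP; exact: lt_trans rS.
- move=> z; rewrite in_itv/= => /andP[rz _]; rewrite derive1E.
  by have [_ ->] := d z (lt_trans r0 rz).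
Qed.

Variables (K p : R).
Local Notation b := (fun x => K - ell (x - p)).

Lemma incrementE (x z : R) : increment b x z = (ell (x - p + z) - ell (x - p)) / z ^+ 2.
Proof. by rewrite /increment (addrAC x z); congr (_ / _); ring. Qed.

Lemma measurable_increment (x : R) : measurable_fun [set: R] (increment b x).
Proof.
apply: measurable_funM; last by apply: measurable_funV; exact: measurable_funX.
apply: measurable_funB => //; apply: measurable_funB => //.
apply: (measurableT_comp measurable_ell); apply: measurable_funB => //.
exact: measurable_funD.
Qed.

Lemma integrable_increment (x r S : R) : 0 < r ->
  mu.-integrable (annulus r S) (EFin \o increment b x).
Proof.
move=> r0; set y := x - p.
pose B := `|ell y| + (`|ell 0| + `|ell (`|y| + `|S|)|).
apply: (@integrable_bounded _ _ _ _ _ _ (B / r ^+ 2)).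
- exact: measurable_annulus.
- apply: (@le_lt_trans _ _ (mu `[- S, S]%classic)).
    apply: le_measure; rewrite ?inE; [exact: measurable_annulus|exact: measurable_itv|].
    by move=> z /andP[_]; rewrite ler_norml /= in_itv.
  by rewrite /= lebesgue_measure_itv/=; case: ifP => _; rewrite ltry.
- apply: measurable_funTS; exact: measurable_increment.
- move=> z /andP[rz zS]; rewrite incrementE normrM.
  apply: ler_pM => //.
    apply: le_trans (ler_normB _ _) _; rewrite addrC lerD2l.
    have l0 : ell 0 <= ell (y + z) by apply: ell_le; rewrite expr0n sqr_ge0.
    have l1 : ell (y + z) <= ell (`|y| + `|S|).
      apply: ell_le; rewrite -[leLHS]real_normK ?num_real// lerXn2r ?nnegrE ?addr_ge0//.
      by apply: le_trans (ler_normD _ _) _; rewrite lerD2l (le_trans zS)// ler_norm.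
    move: l0 l1; rewrite -/y; move: (ell 0) (ell (`|y| + `|S|)) (ell (y + z)) => u v w uw wv.
    rewrite ler_norml; have := ler_norm (- u); rewrite normrN => ?.
    have := ler_norm v; have := normr_ge0 u; have := normr_ge0 v => ? ? ?.
    by apply/andP; split; lra.
  have rz2 : r ^+ 2 <= z ^+ 2.
    by rewrite -(real_normK (num_real z)) lerXn2r ?nnegrE// ltW.
  have r2 : 0 < r ^+ 2 by rewrite exprn_gt0.
  by rewrite normfV ger0_norm ?sqr_ge0// lef_pV2 ?posrE// (lt_le_trans r2).
Qed.

Lemma integral_increment (x r S : R) : 0 < r < S ->
  \int[mu]_(z in annulus r S) increment b x z =
  pv_primitive a (x - p) S - pv_primitive a (x - p) r.
Proof.
move=> rS; have [r0 rltS] := andP rS.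
have AE : annulus r S = `]r, S] `|` `[(- S), (- r)[.
  apply/seteqP; split => z; rewrite /annulus /= !in_itv/=.
    have [z0|z0] := leP 0 z; first by rewrite ger0_norm//; left.
    by rewrite ltr0_norm// ltrNr lerNl => h; right; rewrite andbC.
  move=> [/andP[h1 h2]|/andP[h1 h2]].
    by rewrite ger0_norm ?h1 ?h2// ltW// (lt_trans r0).
  have z0 : z < 0 by rewrite (lt_trans h2)// oppr_lt0.
  by rewrite ltr0_norm// ltrNr h2 lerNl h1.
have iA := integrable_increment x S r0.
rewrite AE Rintegral_setU//; last first.
- apply/disj_setPS => z; rewrite /= !in_itv/= => -[/andP[h1 h2] /andP[h3 h4]]; lra.
- by rewrite -AE.
rewrite Rintegral_itv_opp; last exact: measurable_increment.
have iP : mu.-integrable `]r, S] (EFin \o increment b x).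
  apply: integrableS iA; [exact: measurable_annulus|exact: measurable_itv|rewrite AE => z; by left].
(* The increment at -z equals the increment at z based at the mirror image 2 p - x, so the
   integrability already proved applies. *)
have iN : mu.-integrable `]r, S] (EFin \o (fun z => increment b x (- z))).
  have i : mu.-integrable `]r, S] (EFin \o increment b (2 * p - x)).
    apply: integrableS (integrable_increment (2 * p - x) S r0);
      [exact: measurable_annulus|exact: measurable_itv|rewrite AE => z; by left].
  apply: (integrable_ext _ _ i); first exact: measurable_itv.
  move=> z _; rewrite !incrementE sqrrN.
  have -> : 2 * p - x - p = - (x - p) by ring.
  by rewrite ell_opp -(ell_opp (- (x - p) + z)) opprD opprK.
rewrite -RintegralD// -integral_second_diff//.
apply: eq_Rintegral => z _; rewrite !incrementE /second_diff sqrrN.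
by rewrite -mulrDl; congr (_ / _); ring.
Qed.

End bubble_pv.

(** * One-sided sign of the principal value of a bubble *)

Section bubble_super.
Context (R : realType).
Variable a : R.
Hypothesis a0 : 0 < a.
Local Notation ell := (ell a).

Let ln_le_sub1 (x : R) : 0 < x -> ln x <= x - 1.
Proof. by move=> x0; rewrite -{1}(subrKC 1 x); apply: le_ln1Dx; rewrite -subr_gt0 opprK subrK. Qed.

Lemma ell_sub_le (s t : R) : ell s - ell t <= (s ^+ 2 - t ^+ 2) / (a ^+ 2 + t ^+ 2).
Proof.
have t0 := ell_arg_gt0 a0 t; have s0 := ell_arg_gt0 a0 s.
rewrite /ell -ln_div ?posrE//; apply: le_trans (ln_le_sub1 _) _; first by rewrite divr_gt0.
by rewrite le_eqVlt; apply/orP; left; apply/eqP; field; rewrite gt_eqF.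
Qed.

(** Minus the second difference is ln (q^2 / (p m)), at most (q^2 - p m)/(p m), where q^2 - p m <= 4
    y^2 z^2 and p m >= a^4. The quadratic order in z keeps the boundary term of [pv_primitive] under
    control near 0. *)
Lemma second_diff_ge (y z : R) : - (4 * y ^+ 2 / a ^+ 4) * z ^+ 2 <= second_diff a y z.
Proof.
have p0 := ell_arg_gt0 a0 (y + z); have m0 := ell_arg_gt0 a0 (y - z); have q0 := ell_arg_gt0 a0 y.
have a40 : 0 < a ^+ 4 by rewrite exprn_gt0.
set p := a ^+ 2 + (y + z) ^+ 2 in p0; set m := a ^+ 2 + (y - z) ^+ 2 in m0.
set q := a ^+ 2 + y ^+ 2 in q0.
have pm : a ^+ 4 <= p * m.
  have := @ler_pM _ (a ^+ 2) p (a ^+ 2) m (sqr_ge0 _) (sqr_ge0 _).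
  by rewrite -exprD !lerDl !sqr_ge0; exact.
have pm0 : 0 < p * m by rewrite mulr_gt0.
have e : ln (q * q / (p * m)) = - second_diff a y z.
  rewrite ln_div ?posrE ?mulr_gt0// (lnM (x := q)) ?posrE// (lnM (x := p)) ?posrE//.
    rewrite /second_diff /ell -/p -/m -/q. ring.
rewrite mulNr -[leRHS]opprK lerN2 -e; apply: le_trans (ln_le_sub1 _) _; first by rewrite divr_gt0 ?mulr_gt0.
have -> : q * q / (p * m) - 1 = (q * q - p * m) / (p * m) by field; rewrite !gt_eqF.
rewrite ler_pdivrMr//.
apply: (@le_trans _ _ (4 * y ^+ 2 / a ^+ 4 * z ^+ 2 * a ^+ 4)); last first.
  apply: ler_wpM2l pm; apply: mulr_ge0; last exact: sqr_ge0.
  by apply: divr_ge0; [rewrite mulr_ge0 ?sqr_ge0|exact: ltW].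
have -> : 4 * y ^+ 2 / a ^+ 4 * z ^+ 2 * a ^+ 4 = 4 * y ^+ 2 * z ^+ 2 by field; rewrite gt_eqF.
have -> : q * q - p * m = 4 * y ^+ 2 * z ^+ 2 - (2 * q * z ^+ 2 + z ^+ 2 * z ^+ 2).
  by rewrite /q /p /m; ring.
have z2 := sqr_ge0 z; have qz : 0 <= q * z ^+ 2 by rewrite mulr_ge0// ltW.
have := mulr_ge0 z2 z2; lra.
Qed.

(** By [second_diff_ge] the singular boundary term is at most C r. Replacing it by C r gives the
    majorant [g], which is continuous at 0 and vanishes there. *)
Lemma pv_primitive_small (y e : R) : 0 < e -> exists2 d, 0 < d &
  forall r, 0 < r < d -> pv_primitive a y r <= e.
Proof.
move=> e0; set C := 4 * y ^+ 2 / a ^+ 4; set q := a ^+ 2 + y ^+ 2.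
pose g r := C * r + 2 * a / q * (atan ((r + y) / a) + atan ((r - y) / a)) +
  y / q * (ell (y - r) - ell (y + r)).
have g0 : g 0 = 0.
  by rewrite /g mulr0 !add0r mulNr atanN subrr mulr0 add0r subr0 addr0 subrr mulr0.
have cg : {for 0, continuous g}.
  have ca s : {for 0, continuous (fun r : R => atan ((r + s) / a))}.
    apply: (continuous_comp (f := fun r => (r + s) / a)); last exact: continuous_atan.
    apply: (@cvgM _ R^o); last exact: cvg_cst.
    by apply: (@cvgD _ R^o); [exact: cvg_id|exact: cvg_cst].
  apply: (@cvgD _ R^o); first apply: (@cvgD _ R^o).
  - by apply: (@cvgM _ R^o); [exact: cvg_cst|exact: cvg_id].
  - by apply: (@cvgM _ R^o); [exact: cvg_cst|apply: (@cvgD _ R^o); exact: ca].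
  apply: (@cvgM _ R^o); first exact: cvg_cst.
  apply: (@cvgB _ R^o).
    apply: (continuous_comp (f := fun r => y - r)); last exact: continuous_ell.
    by apply: (@cvgB _ R^o); [exact: cvg_cst|exact: cvg_id].
  apply: (continuous_comp (f := fun r => y + r)); last exact: continuous_ell.
  by apply: (@cvgD _ R^o); [exact: cvg_cst|exact: cvg_id].
have /cvgrPdist_lt /(_ _ e0) := cg; rewrite g0 => -[d /= d0 hd].
exists d => // r /andP[r0 rd].
have := hd r; rewrite /ball_/= !sub0r !normrN gtr0_norm// => /(_ rd) ge.
apply: le_trans (ltW (le_lt_trans (ler_norm _) ge)).
rewrite /pv_primitive /g !lerD2r -mulNr ler_pdivrMr//.
have := second_diff_ge y r; rewrite -/C; lra.
Qed.

Lemma pv_primitive_opp (y z : R) : pv_primitive a (- y) z = pv_primitive a y z.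
Proof.
rewrite /pv_primitive /second_diff opprK sqrrN ell_opp.
have -> : ell (- y + z) = ell (y - z) by rewrite -ell_opp; congr ell; ring.
have -> : ell (- y - z) = ell (y + z) by rewrite -ell_opp; congr ell; ring.
by rewrite (addrC (atan _)); congr (_ + _ + _); [congr (- (_ / _))|]; ring.
Qed.

(** As S grows, the arctangent term tends to 2 pi a / q, which is pi times the half-Laplacian of the
    bubble and positive, while the two other terms tend to 0. *)
Lemma pv_primitive_large (y M : R) : exists2 S, M <= S & 0 <= pv_primitive a y S.
Proof.
wlog y0 : y / 0 <= y => [h|].
  have [|/ltW y0] := leP 0 y; first exact: h.
  by have [S MS hS] := h (- y) (ltac:(by rewrite oppr_ge0)); exists S => //; rewrite -pv_primitive_opp.
have apos := a0; set q := a ^+ 2 + y ^+ 2; have q0 : 0 < q := ell_arg_gt0 a0 y.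
(* The condition k^2 a >= 2 is what the bound of the logarithm in [t1] by 4 ln (k s) requires. *)
have [k k1 ka] : exists2 k, 1 <= k & 2 / a <= k ^+ 2.
  have a20 : 0 <= 2 / a by rewrite divr_ge0 ?ltW.
  by exists (1 + 2 / a); [rewrite lerDl|nra].
have [s1 s10 t4] : exists2 s1, 0 <= s1 & forall s, 0 < s -> s1 <= s -> (8 * k + 16) / s <= 2 * a / q.
  exists ((8 * k + 16) * q / (2 * a)).
    by apply: divr_ge0; [apply: mulr_ge0; [lra|exact: ltW]|lra].
  move=> s s0; rewrite ler_pdivrMr ?mulr_gt0// => h.
  by rewrite ler_pdivrMr// mulrAC ler_pdivlMr//; lra.
have [s s1s [s6 [sM Ss]]] : exists2 s, s1 <= s & 6 <= s /\ M <= s /\ 2 * y + a + 6 <= s.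
  have := normr_ge0 M; have := ler_norm M => ? ?.
  by exists (s1 + 6 + 2 * y + a + `|M|); [|do 2?split]; lra.
have sS : s <= s ^+ 2 by rewrite expr2 ler_peMl//; lra.
have s0 : 0 < s by lra.
have S0 : 0 < s ^+ 2 by rewrite exprn_gt0.
(* A square is taken because ln (k s) <= k s then bounds the second difference by 8 k s, of the
   order of the root of S, so that division by S leaves a term of order 1/s. *)
exists (s ^+ 2); first exact: le_trans sS.
set S := s ^+ 2 in sS S0 *.
have S1 : 2 * y + a + 6 <= S by exact: le_trans sS.
have t1 : second_diff a y S / S <= 8 * k / s.
  rewrite ler_pdivrMr// /S expr2 mulrA mulfVK ?gt_eqF//.
  have h1 : ell (y - S) <= ell (y + S) by apply: (ell_le a0); nra.
  have h2 : ell 0 <= ell y by apply: (ell_le a0); rewrite expr0n sqr_ge0.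
  have h3 : ell (y + S) - ell 0 <= 4 * ln (k * s).
    have ks : 0 < k * s by rewrite mulr_gt0//; lra.
    have -> : 4 * ln (k * s) = ln ((k * s) ^+ 4) by rewrite lnXn// mulr_natl.
    rewrite /ell -ln_div ?posrE ?ell_arg_gt0// ler_ln ?posrE ?divr_gt0 ?ell_arg_gt0 ?exprn_gt0//.
    rewrite expr0n addr0 ler_pdivrMr ?exprn_gt0//.
    have e4 : (2 * S) ^+ 2 <= (k * s) ^+ 4 * a ^+ 2.
      have -> : (k * s) ^+ 4 * a ^+ 2 = (k ^+ 2 * a * S) ^+ 2 by rewrite /S; ring.
      have k2a : 2 <= k ^+ 2 * a by rewrite -ler_pdivrMr.
      have kk := ler_wpM2r (ltW S0) k2a.
      have S2 : 0 <= 2 * S by lra.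
      by rewrite lerXn2r ?nnegrE// (le_trans S2).
    apply: le_trans e4; nra.
  have h4 := ln_sublinear (_ : 0 < k * s).
  rewrite /second_diff; have := h4 (ltac:(by rewrite mulr_gt0//; lra)).
  have -> : 8 * k * s = 8 * (k * s) by ring.
  lra.
have t2 : 2 * a / q <= 2 * a / q * (atan ((S + y) / a) + atan ((S - y) / a)).
  rewrite ler_peMr//; first by rewrite divr_ge0 ?mulr_ge0 ?ltW.
  have at1 x : a <= x -> pi / 4 <= atan (x / a).
    by move=> ax; rewrite -atan1; apply: le_atan; rewrite ler_pdivlMr// mul1r.
  have h1 := at1 (S + y) (ltac:(lra)); have h2 := at1 (S - y) (ltac:(lra)).
  have := pihalf_ge1 R; move: h1 h2; move: (atan _) (atan _) (pi : R) => u v p; lra.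
have t3 : - (16 / s) <= y / q * (ell (y - S) - ell (y + S)).
  have h1 := ell_sub_le (y + S) (y - S).
  have m0 := ell_arg_gt0 a0 (y - S).
  have h2 : ((y + S) ^+ 2 - (y - S) ^+ 2) / (a ^+ 2 + (y - S) ^+ 2) <= 16 * y / S.
    rewrite ler_pdivrMr// mulrAC ler_pdivlMr//.
    have -> : ((y + S) ^+ 2 - (y - S) ^+ 2) * S = 4 * y * S ^+ 2 by ring.
    rewrite -!mulrA (mulrCA 4) (mulrCA 16) ler_wpM2l//.
    have := sqr_ge0 a; nra.
  have yq : 0 <= y / q by apply: divr_ge0 => //; exact: ltW.
  have h3 := ler_wpM2l yq (le_trans h1 h2).
  have h4 : y / q * (16 * y / S) <= 16 / s.
    have -> : y / q * (16 * y / S) = 16 * ((y ^+ 2 / q) / S).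
      by field; rewrite !gt_eqF.
    rewrite ler_wpM2l// -[leRHS]mul1r; apply: ler_pM.
    - by apply: divr_ge0; [exact: sqr_ge0|exact: ltW].
    - by rewrite invr_ge0 ltW.
    - by rewrite ler_pdivrMr// mul1r lerDr sqr_ge0.
    by rewrite lef_pV2 ?posrE.
  lra.
have {}t4 := t4 s s0 s1s.
have := mulrDl (8 * k) 16 s^-1.
rewrite /pv_primitive -/q; lra.
Qed.

End bubble_super.

(** * Bounds for correctors, bubbles and the coefficients mu *)

Section green_bounds.
Context (R : realType).
Local Notation mu := (@lebesgue_measure R).
Local Notation I := (two_intervals (2 : R)).

Lemma pv_super_bubble (a K p x : R) : 0 < a ->
  exists S, pv_super (fun x => K - ell a (x - p)) x S.
Proof.
move=> a0; set y := x - p.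
have [S SM S0] := pv_primitive_large a0 y (6 + 2 * `|y|).
have y0 := normr_ge0 y.
exists S; split.
- lra.
- move=> z Sz; rewrite lerD2l lerN2; apply: (ell_le a0).
  have -> : x + z - p = z + y by rewrite /y; ring.
  rewrite -(real_normK (num_real y)) -(real_normK (num_real (z + y))).
  rewrite lerXn2r ?nnegrE//; have := lerB_normD z y; lra.
- by move=> r r0; exact: integrable_increment.
move=> e e0; have [d d0 hd] := pv_primitive_small a0 y e0.
exists (Num.min d S); first by rewrite lt_min d0; lra.
move=> r; rewrite lt_min => /andP[r0 /andP[rd rS]].
rewrite integral_increment ?r0// -/y.
have := hd r; rewrite r0 rd => /(_ isT); lra.
Qed.

Lemma pv_super0 (x : R) : pv_super (fun=> 0) x 6.
Proof.
have i0 z : increment (fun=> 0 : R) x z = 0 by rewrite /increment subrr mul0r.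
split => //.
- move=> r r0; rewrite (_ : _ \o _ = cst 0%E); first exact: integrable0.
  by apply/funext => z; rewrite /= i0.
- move=> e e0; exists 1 => // r _.
  rewrite (_ : Rintegral _ _ _ = 0) ?oppr_le0 ?ltW//.
  rewrite /Rintegral (_ : (\int[mu]_(z in _) _)%E = 0%E)//.
  by rewrite integral0_eq// => z _; rewrite i0.
Qed.

Lemma two_intervals_bound (x : R) : I x -> -3 < x < 3.
Proof. by rewrite /two_intervals /= !in_itv/= => -[/andP[? ?]|/andP[? ?]]; apply/andP; split; lra. Qed.

Lemma pv_ge (h : R -> R) (L : R) : continuous h -> (forall x, I x -> pv0 h x) ->
  (forall x, ~ I x -> L <= h x) -> forall x, L <= h x.
Proof.
move=> ch hI off x; rewrite -[leRHS]addr0.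
apply: (pv_super_ge ch (b := fun=> 0) _ two_intervals_bound hI) => //.
- by move=> t; exact: cvg_cst.
- by move=> t _; exists 6; exact: pv_super0.
- by move=> t It; rewrite addr0; exact: off.
Qed.

Section bubble_bounds.
Variables (eps m p : R) (h : R -> R).
Hypothesis eps0 : 0 < eps.
Hypothesis m0 : 0 < m.
Hypothesis hh : half_dirichlet I (fun x => - bubble eps m p x) h.

Let a0 : 0 < m * eps. Proof. exact: mulr_gt0. Qed.

Lemma bubbleE x : bubble eps m p x = ln (2 * m) - ell (m * eps) (x - p).
Proof. by rewrite /bubble ln_div ?posrE ?mulr_gt0// -exprMn// ell_arg_gt0. Qed.

Lemma dirichlet_bubble_ge0 x : 0 <= bubble eps m p x + h x.
Proof.
have [ch lh oh] := hh.
rewrite bubbleE addrC.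
apply: (pv_super_ge (b := fun x => ln (2 * m) - ell (m * eps) (x - p)) (I := I)).
- exact: ch.
- move=> t; apply: (@cvgB _ R^o); first exact: cvg_cst.
  apply: (continuous_comp (f := fun r => r - p)); last exact: continuous_ell.
  by apply: (@cvgB _ R^o); [exact: cvg_id|exact: cvg_cst].
- exact: two_intervals_bound.
- by move=> t It; apply: half_laplacian_at_pv0; exact: lh.
- by move=> t It; exact: pv_super_bubble.
- by move=> t It; rewrite oh// bubbleE addNr.
Qed.

(** Off I the corrector is at least ln (d^2) - ln (2 m), hence everywhere by the maximum principle.
    At the points considered the bubble is at least ln (2 m) - ln (d^2 / 8). The dependence on m and
    d cancels, and the sum is at least ln 8 >= 7/8. *)
Lemma dirichlet_bubble_large (d x : R) : 0 < d -> (forall t, ~ I t -> d <= `|p - t|) ->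
  m * eps <= d / 4 -> `|x - p| <= d / 4 -> 2^-1 <= bubble eps m p x + h x.
Proof.
move=> d0 far small near.
have [ch lh oh] := hh.
have d20 : 0 < d ^+ 2 by rewrite exprn_gt0.
have low : ln (d ^+ 2) - ln (2 * m) <= h x.
  apply: pv_ge => //.
    by move=> t It; apply: half_laplacian_at_pv0; exact: lh.
  move=> t It; rewrite oh// bubbleE opprB lerD2r ler_ln ?posrE ?ell_arg_gt0//.
  have dt : d ^+ 2 <= (t - p) ^+ 2.
    by rewrite -(real_normK (num_real (t - p))) lerXn2r ?nnegrE ?(ltW d0)// distrC far.
  by apply: le_trans dt _; rewrite lerDr sqr_ge0.
rewrite bubbleE.
have e0 := ell_arg_gt0 a0 (x - p).
suff : 2^-1 <= ln (d ^+ 2) - ell (m * eps) (x - p) by lra.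
have s1 : (m * eps) ^+ 2 + (x - p) ^+ 2 <= d ^+ 2 / 8.
  have -> : d ^+ 2 / 8 = (d / 4) ^+ 2 + (d / 4) ^+ 2 by field.
  rewrite -(real_normK (num_real (x - p))).
  have d4 : 0 <= d / 4 by rewrite divr_ge0 ?ltW.
  by apply: lerD; rewrite lerXn2r// nnegrE ltW.
have s2 : ell (m * eps) (x - p) <= ln (d ^+ 2 / 8) by rewrite ler_ln ?posrE// divr_gt0.
have s3 : ln (d ^+ 2 / 8) = ln (d ^+ 2) + ln 8^-1 by rewrite lnM ?posrE.
have s4 : ln (8^-1 : R) <= 8^-1 - 1.
  by have := @le_ln1Dx R (8^-1 - 1); rewrite subrKC; apply; lra.
lra.
Qed.

End bubble_bounds.

(** [regular_part] gives continuity in x for each pole but nothing jointly in the pole. Uniformity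
    comes from comparison with a single pole [z0]: the difference of the two regular parts has zero
    principal value in I and explicit boundary values off I. *)
Lemma regular_part_le (H : R -> R -> R) : regular_part I H ->
  exists K, forall x z, I x -> I z -> H x z <= K.
Proof.
move=> HH; pose z0 : R := 5 / 2.
have Iz0 : I z0 by rewrite /two_intervals /= !in_itv/= /z0; right; apply/andP; split; lra.
have [c0 l0 o0] := HH _ Iz0.
have le33 : -3 <= 3 :> R by lra.
have [x0 _ x0max] := EVT_max le33 (continuous_subspaceT c0).
exists (H x0 z0 + 2 * ln 13) => x z Ix Iz.
have [c1 l1 o1] := HH _ Iz.
suff hx : - (2 * ln 13) <= H x z0 - H x z.
  have /andP[/ltW x3 /ltW x3'] := two_intervals_bound Ix.
  have := x0max x; rewrite in_itv/= x3 x3' => /(_ isT) ?; lra.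
apply: (@pv_ge (fun x => H x z0 - H x z)).
- by move=> t; apply: (@cvgB _ R^o); [exact: c0|exact: c1].
- by move=> t It; apply: pv0_sub; apply: half_laplacian_at_pv0; [exact: l0|exact: l1].
move=> t It; rewrite o0// o1// /Gam.
have tz0 : 2^-1 <= `|t - z0|.
  rewrite leNgt; apply/negP; rewrite ltr_distl => /andP[t1 t2]; apply: It.
  by rewrite /two_intervals /= !in_itv/=; right; rewrite /z0 in t1 t2; apply/andP; split; lra.
have tz : 0 < `|t - z|.
  by rewrite normr_gt0 subr_eq0; apply/eqP => tz; apply: It; rewrite tz.
(* [z0] is the midpoint of a unit component, so |t - z0| >= 1/2 and |z0 - z| <= 6 <= 12 |t - z0|. *)
have t13 : `|t - z| <= 13 * `|t - z0|.
  have -> : t - z = (t - z0) + (z0 - z) by ring.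
  apply: le_trans (ler_normD _ _) _.
  have : `|z0 - z| <= 6.
    by have /andP[? ?] := two_intervals_bound Iz; rewrite ler_norml /z0; apply/andP; split; lra.
  lra.
have : ln `|t - z| <= ln (13 * `|t - z0|) by rewrite ler_ln ?posrE// mulr_gt0//; lra.
rewrite lnM ?posrE//; last lra.
lra.
Qed.

(** Uniformity in [xi] lets one threshold for eps make all products mu_j eps small. Here the
    separation of the points is used: it bounds the logarithmic part of each Green function from
    above. *)
Lemma mu_coef_le (H : R -> R -> R) (n : nat) (delta : R) : regular_part I H -> 0 < delta ->
  exists2 B, 0 < B & forall xi : 'I_n -> R, (forall j, I (xi j)) ->
    (forall i j, i != j -> delta <= `|xi j - xi i|) -> forall j, mu_coef H xi j <= B.
Proof.
move=> HH d0; have [K hK] := regular_part_le HH.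
pose T := `|K| + `|2 * ln delta|.
exists (2^-1 * expR (K + n%:R * T)).
  by rewrite mulr_gt0// expR_gt0.
move=> xi Ixi sep j; rewrite /mu_coef ler_wpM2l// ler_expR; apply: lerD; first exact: hK.
apply: (@le_trans _ _ (\sum_(i < n | i != j) T)).
  apply: ler_sum => i ij; rewrite /green /T; apply: lerD.
    exact: le_trans (hK _ _ _ _) (ler_norm _).
  rewrite /Gam -[X in _ <= `|X|]opprK normrN; apply: le_trans (ler_norm _).
  have : ln delta <= ln `|xi j - xi i| by rewrite ler_ln ?posrE ?sep// (lt_le_trans d0)// sep.
  lra.
rewrite sumr_const -[leLHS]mulr_natl ler_wpM2r//; first by rewrite addr_ge0.
by rewrite ler_nat -[leqRHS]card_ord max_card.
Qed.

End green_bounds.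

(** * Mass of the ansatz and conclusion *)

Lemma ae_bounded_near0 (R : realType) (I : set R) (psi : R -> R -> R) :
  ('N[Leb]_+oo[(fun x : R => (\1_I x * psi eps x)%:E)] @[eps --> 0^'+] --> 0)%E ->
  exists2 d : R, 0 < d & forall eps, 0 < eps < d ->
    {ae Leb, forall x : R, I x -> `|psi eps x| <= 1}.
Proof.
move=> psi0.
have n1 : nbhs (0%E : \bar R) [set y | (y < 1)%E].
  by apply: open_nbhs_nbhs; split; [exact: open_ereal_lt_ereal|rewrite /= lte01].
have := psi0 _ n1; rewrite /at_right /= => -[d /= d0 hd]; exists d => // eps /andP[e0 ed].
have := hd eps; rewrite /ball_/= sub0r normrN gtr0_norm// => /(_ ed e0).
have T0 := lebesgue_measureT_gt0 R.
rewrite unlock /= T0 => /ltW /ess_supP.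
apply: (@filterS _ _ (ae_Leb_filter R)) => x /=.
by rewrite lee_fin => h Ix; move: h; rewrite indicE mem_set// mul1r.
Qed.

Lemma integral_sum_indic (R : realType) (I : set R) (m : nat) (d : R) (xi : 'I_m -> R) :
  measurable I -> 0 < d -> (forall j x, `|x - xi j| <= d -> I x) ->
  (\int[Leb]_(x in I) (\sum_(j < m) (2^-1 * \1_(`[xi j - d, xi j + d]%classic : set R) x))%:E =
    (m%:R * d)%:E)%E.
Proof.
move=> mI d0 dI.
under eq_integral do rewrite -sumEFin.
have mB j : measurable_fun I (\1_(`[xi j - d, xi j + d]%classic : set R) : R -> R).
  exact: measurable_indic.
transitivity (\sum_(j < m) \int[Leb]_(x in I) (2^-1 * \1_(`[xi j - d, xi j + d]%classic : set R) x)%:E)%E.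
  apply: ge0_integral_sum; first exact: mI.
    by move=> j; apply/measurable_EFinP; apply: measurable_funM => //; exact: mB.
  by move=> j x _; rewrite lee_fin mulr_ge0.
rewrite (eq_bigr (fun=> d%:E)) => [|j _].
  by rewrite sumEFin sumr_const card_ord mulr_natl.
under eq_integral do rewrite EFinM.
rewrite ge0_integralZl//; last first.
  by apply/measurable_EFinP; exact: mB.
rewrite integral_indic//.
rewrite setIidl; last first.
  by move=> x; rewrite /= in_itv/= -ler_distlC => h; apply: (dI j); rewrite distrC.
rewrite /= lebesgue_measure_itv/= lte_fin ifT; last lra.
by rewrite -EFinB -EFinM; congr _%:E; field.
Qed.

Lemma set_dist_le (R : realType) (x t : R) (A : set R) : A t -> set_dist x A <= `|x - t|.
Proof.
by move=> At; apply: ge_inf; [exists 0 => _ [y _ <-]|exists t].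
Qed.

Theorem proposition1p2 (R : realType) (delta0 : R)
    (hdelta0 : 0 < delta0 <= 10^-1) :
  exists (b : R) (mstar : nat), 1 <= b /\ (2 < mstar)%N /\
  let I := two_intervals b in
  forall H : R -> R -> R, regular_part I H ->
  forall m : nat, (mstar <= m)%N ->
  forall delta : R, 0 < delta <= 10^-1 ->
  forall psi : R -> R -> R,
    (forall eps : R, 0 < eps < 1 -> psi eps \in Lfun (@Leb R) +oo%E) ->
    (forall eps : R, 0 < eps < 1 ->
       {ae Leb, forall x : R, ~ I x -> psi eps x = 0}) ->
    ('N[Leb]_+oo[(fun x : R => (\1_I x * psi eps x)%:E)] @[eps --> 0^'+] --> 0)%E ->
  exists eps0 : R, 0 < eps0 < 1 /\
  forall eps : R, 0 < eps < eps0 ->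
  forall xi : 'I_m -> R, (forall j, I (xi j)) ->
    (forall j, delta0 <= set_dist (xi j) (~` I)) ->
    (forall i j : 'I_m, i != j -> delta <= `|xi j - xi i|) ->
  forall h : 'I_m -> R -> R,
    (forall j, half_dirichlet I
       (fun x => - bubble eps (mu_coef H xi j) (xi j) x) (h j)) ->
  ~ is_solution I eps
      (fun x => \sum_(j < m) (bubble eps (mu_coef H xi j) (xi j) x + h j x)
                + psi eps x).
Proof.
have [d00 d01] := andP hdelta0.
have c0 : 0 <= 432 / delta0 by rewrite divr_ge0// ltW.
(* 432 is 4 (102 + 6): 102 bounds the mass of a solution and 6, the length of [-3, 3], bounds what
   the perturbation, at most 1 in absolute value, can take away. The summand 3 secures a threshold
   above 2. *)
exists 2, (3 + Num.Def.archi_bound (432 / delta0))%N; split; first lra.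
split=> // I H HH m mlarge delta /andP[delta_gt0 _] psi _ _ psi0.
have mbig : 432 < m%:R * delta0.
  rewrite -ltr_pdivrMr//; apply: lt_le_trans (Num.Theory.archi_boundP c0) _.
  by rewrite ler_nat; apply: leq_trans mlarge; rewrite leq_addl.
have [d d0 hpsi] := ae_bounded_near0 psi0.
have [B B0 hB] := mu_coef_le m HH delta_gt0.
pose d4 := delta0 / 4; have d40 : 0 < d4 by rewrite divr_gt0.
pose eps0 := Num.min 2^-1 (Num.min d (d4 / B)).
have eps00 : 0 < eps0 by rewrite !lt_min d0 divr_gt0// invr_gt0 ltr0n.
have eps02 : eps0 <= 2^-1 by rewrite ge_min lexx.
exists eps0; split; first by rewrite eps00/=; lra.
move=> eps /andP[e0]; rewrite !lt_min => /andP[_ /andP[ed eB]] xi Ixi far sep h hh sol.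
have [ut [mut ut0 utu utI]] := solution_mass e0 sol.
have mI : measurable I := measurable_two_intervals 2.
have mu0 j : 0 < mu_coef H xi j by rewrite mulr_gt0// expR_gt0.
have far' j t : ~ I t -> delta0 <= `|xi j - t|.
  by move=> It; apply: le_trans (far j) _; exact: set_dist_le.
have inI j x : `|x - xi j| <= d4 -> I x.
  move=> xj; apply: contrapT => /(far' j); rewrite distrC => /le_trans/(_ xj).
  by rewrite /d4; lra.
have small j : mu_coef H xi j * eps <= d4.
  apply: (@le_trans _ _ (B * eps)); first by rewrite ler_wpM2r ?hB// ltW.
  by rewrite mulrC -ler_pdivlMr// ltW.
(* The intervals around the points may overlap, their radius being fixed while [delta] is
   arbitrarily small. No disjointness enters: every term of the ansatz is nonnegative, so the lower
   bounds 1/2 add up. *)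
pose G (x : R) : R := \sum_(j < m) (2^-1 * \1_(`[xi j - d4, xi j + d4]%classic : set R) x).
have G0 x : 0 <= G x by apply: sumr_ge0 => j _; rewrite mulr_ge0.
have Gw x : G x <= \sum_(j < m) (bubble eps (mu_coef H xi j) (xi j) x + h j x).
  apply: ler_sum => j _; rewrite indicE.
  have [|_] := boolP (x \in _); last by rewrite mulr0; exact: dirichlet_bubble_ge0 (hh j) x.
  rewrite inE /= in_itv/= -ler_distlC distrC mulr1 => xj.
  exact: (dirichlet_bubble_large e0 (mu0 j) (hh j) d00 (far' j)).
have mG : measurable_fun [set: R] G.
  apply: measurable_sum => j; apply: measurable_funM => //; exact: measurable_indic.
have ed' : 0 < eps < d by rewrite e0.
have ae1 : {ae Leb, forall x, I x -> (G x)%:E <= (ut x)%:E + 1%:E}%E.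
  move: utu (hpsi _ ed'); apply: (@filterS2 _ _ (ae_Leb_filter R)) => x utx psix Ix.
  rewrite -EFinD lee_fin utx//; have := Gw x; have := psix Ix.
  rewrite ler_norml => /andP[? _]; lra.
have := integral_sum_indic mI d40 inI; rewrite -/G => intG.
have : ((m%:R * d4)%:E <= 102%:E + 6%:E)%E.
  rewrite -intG; apply: (@le_trans _ _ (\int[Leb]_(x in I) ((ut x)%:E + 1%:E)))%E.
    apply: ae_ge0_le_integral => //.
    - by move=> x _; rewrite lee_fin; exact: G0.
    - by apply/measurable_EFinP; exact: measurable_funTS.
    - by move=> x _; rewrite -EFinD lee_fin addr_ge0.
    - apply/measurable_EFinP; apply: measurable_funTS; exact: measurable_funD.
  rewrite ge0_integralD//; last 2 first.
  - by move=> x _; rewrite lee_fin.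
  - by apply/measurable_EFinP; exact: measurable_funTS.
  apply: leeD => //; rewrite integral_cst// mul1e.
  apply: (@le_trans _ _ (Leb (`[-3, 3]%classic : set R))).
    apply: le_measure; rewrite ?inE; [exact: mI|exact: measurable_itv|].
    by move=> x /two_intervals_bound/andP[? ?]; rewrite /= in_itv/= !ltW.
  by rewrite lebesgue_measure_itv/=; case: ifP => _; rewrite ?lee_fin -?EFinB ?lee_fin; lra.
rewrite -EFinD lee_fin /d4 mulrA ler_pdivrMr//; lra.
Qed.
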